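(* (1) Given $-1/2<s<1/2$, for every $f\in L^2(\mathbb{R})$ there is a unique $u\in \widehat{H}^{|s|}(\mathbb{R})$ such that the following decomposition holds: $$f=\boldsymbol{D}^{-s}u+\boldsymbol{D}^{s*}u .$$ Furthermore, $f\in \widehat{H}^t(\mathbb{R})$ if and only if $u\in \widehat{H}^{s+t}(\mathbb{R})$, where $0<t$. (2) Given $-1/2<s<1/2$, for any $f\in L^2(\mathbb{R})$ there exists a unique $u\in \widehat{H}^{|s|}(\mathbb{R})$ such that the following decomposition holds: $$f=\boldsymbol{D}^{-s}u+\boldsymbol{D}^{s}u .$$ Furthermore, $f\in \widehat{H}^t(\mathbb{R})$ if and only if $u\in \widehat{H}^{s+t}(\mathbb{R})$, where $0<t$.
   Context: All functions are real valued (except Fourier transforms), $L^2(\mathbb{R})$ is the space of real-valued square-integrable functions, functions are identified when equal a.e., and $(f,g)=\int_{\mathbb{R}} fg$. $C_0^\infty(\mathbb{R})$ is the space of infinitely differentiable compactly supported functions. $\widehat{w}$ is the Plancherel transform of $w\in L^2(\mathbb{R})$, i.e. the $L^2$-isometric extension of $\mathcal{F}(w)(\xi)=\int_{\mathbb{R}} e^{-2\pi i x\xi}w(x)\,dx$. Sobolev space: for $\mu\ge 0$, $\widehat{H}^\mu(\mathbb{R})=\{w\in L^2(\mathbb{R}): \int_{\mathbb{R}}(1+|2\pi\xi|^{2\mu})|\widehat{w}(\xi)|^2\,d\xi<\infty\}$. Riemann-Liouville integrals: for $\sigma>0$, $$\boldsymbol{D}^{-\sigma}u(x)=\frac{1}{\Gamma(\sigma)}\int_{-\infty}^{x}(x-y)^{\sigma-1}u(y)\,dy,\qquad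 \boldsymbol{D}^{-\sigma*}u(x)=\frac{1}{\Gamma(\sigma)}\int_{x}^{\infty}(y-x)^{\sigma-1}u(y)\,dy .$$ Riemann-Liouville derivatives of a test function: for $\mu>0$, let $n$ be the smallest integer greater than $\mu$ and $\sigma=n-\mu$; for $\psi\in C_0^\infty(\mathbb{R})$, $$\boldsymbol{D}^{\mu}\psi=\frac{d^n}{dx^n}\boldsymbol{D}^{-\sigma}\psi,\qquad \boldsymbol{D}^{\mu*}\psi=(-1)^n\frac{d^n}{dx^n}\boldsymbol{D}^{-\sigma*}\psi .$$ Weak fractional derivatives: for $\mu>0$ and $u,w\in L^1_{loc}(\mathbb{R})$, one writes $\boldsymbol{D}^\mu u=w$ if $(u,\boldsymbol{D}^{\mu*}\psi)=(w,\psi)$ for all $\psi\in C_0^\infty(\mathbb{R})$, and $\boldsymbol{D}^{\mu*}u=w$ if $(u,\boldsymbol{D}^{\mu}\psi)=(w,\psi)$ for all $\psi\in C_0^\infty(\mathbb{R})$. Convention: for a real exponent $\mu$, $\boldsymbol{D}^{\mu}u$ and $\boldsymbol{D}^{\mu*}u$ denote the left and right Riemann-Liouville integrals (in the usual sense) of order $-\mu$ if $\mu<0$, the identity if $\mu=0$, and the left and right weak fractional derivatives of order $\mu$ if $\mu>0$. Here $\boldsymbol{D}^{s*}$ means the right operator with exponent $s$ (so for $s<0$ it is the right integral of order $|s|$).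
   Formalization: For s<0 the regularity clause is stated with H^{|s|+t} instead of H^{s+t}: as printed it fails there (s=-1/4, t=1/4: every u lies in H^0=L^2, but not every f in L^2 lies in H^{1/4}); for s≥0 it is unchanged. *)

(* Defs.v *)
From HB Require Import structures.
From mathcomp Require Import all_boot all_order all_algebra.
From mathcomp Require Import all_classical all_reals all_analysis.
From mathcomp Require Import complex.

Set Implicit Arguments.
Unset Strict Implicit.
Unset Printing Implicit Defensive.
Import Order.TTheory GRing.Theory Num.Theory.
Import numFieldNormedType.Exports.
Local Open Scope classical_set_scope.
Local Open Scope ring_scope.

Local Notation normc := ComplexField.Normc.normc.

Section FractionalCalculus.
Context {R : realType}.
Local Notation leb := (@lebesgue_measure R).
Implicit Types (f g u w psi : R -> R) (W : R -> R[i]) (mu sigma s : R).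

Definition L1 : {pred R -> R} := Lfun leb 1%E.
Definition L2 : {pred R -> R} := Lfun leb 2%:E.

Definition ae_eq_fun f g : Prop := {ae leb, forall x, f x = g x}.

Definition inner f g : R := \int[leb]_x (f x * g x).

Definition test_function psi : Prop :=
  (forall n x, derivable (derive1n n psi) x 1) /\
  (exists a, forall x, a < `|x| -> psi x = 0).

(** Fourier and Plancherel transforms *)

(* \int e^{-2 i pi x xi} w(x) dx; a complex-valued function is integrated
   componentwise *)
Definition fourier w : R -> R[i] := fun xi =>
  ((\int[leb]_x (cos (2 * pi * x * xi) * w x)) +i*
   (- \int[leb]_x (sin (2 * pi * x * xi) * w x)))%C.

Definition L2C W : Prop :=
  (fun xi => complex.Re (W xi)) \in L2 /\ (fun xi => complex.Im (W xi)) \in L2.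

Definition cvg_L2 (v_ : nat -> R -> R) w : Prop :=
  (\int[leb]_x ((v_ n x - w x) ^+ 2)%:E)%E @[n --> \oo] --> 0%E.

Definition cvg_L2C (V_ : nat -> R -> R[i]) W : Prop :=
  (\int[leb]_xi (normc (V_ n xi - W xi) ^+ 2)%:E)%E @[n --> \oo] --> 0%E.

(* Graph of the continuous extension to L2 of [fourier], which is an
   L2-isometry on the dense subspace of functions that are both L1 and L2.
   W is determined by w up to a.e. equality. *)
Definition is_plancherel w W : Prop :=
  L2C W /\
  exists v_ : nat -> R -> R,
    [/\ forall n, v_ n \in L1 /\ v_ n \in L2,
        cvg_L2 v_ w
      & cvg_L2C (fun n => fourier (v_ n)) W].

(* The fractional Sobolev space, for an exponent mu >= 0 *)
Definition Hhat mu w : Prop :=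
  w \in L2 /\
  exists W, is_plancherel w W /\
    (\int[leb]_xi ((1 + `|2 * pi * xi| `^ (2 * mu)) * normc (W xi) ^+ 2)%:E
      < +oo)%E.

(** Riemann-Liouville integrals, sigma > 0 *)

Definition Gamma sigma : R :=
  \int[leb]_(t in `]0, +oo[) (t `^ (sigma - 1) * expR (- t)).

Definition kernel_l sigma u (x y : R) : R := (x - y) `^ (sigma - 1) * u y.
Definition kernel_r sigma u (x y : R) : R := (y - x) `^ (sigma - 1) * u y.

Definition RLint_l sigma u : R -> R := fun x =>
  (Gamma sigma)^-1 * \int[leb]_(y in `]-oo, x[) kernel_l sigma u x y.

Definition RLint_r sigma u : R -> R := fun x =>
  (Gamma sigma)^-1 * \int[leb]_(y in `]x, +oo[) kernel_r sigma u x y.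

(* [Rintegral] returns a junk value on non-integrable functions, so a.e.
   convergence of the defining integral is part of these two predicates. *)
Definition is_RLint_l sigma u w : Prop :=
  {ae leb, forall x,
    leb.-integrable `]-oo, x[ (EFin \o kernel_l sigma u x) /\
    w x = RLint_l sigma u x}.

Definition is_RLint_r sigma u w : Prop :=
  {ae leb, forall x,
    leb.-integrable `]x, +oo[ (EFin \o kernel_r sigma u x) /\
    w x = RLint_r sigma u x}.

(** Riemann-Liouville derivatives of test functions, mu > 0 *)

(* for mu >= 0, the smallest integer greater than mu *)
Definition RLorder mu : nat := (Num.truncn mu).+1.

Definition RLder_l mu psi : R -> R :=
  derive1n (RLorder mu) (RLint_l ((RLorder mu)%:R - mu) psi).

Definition RLder_r mu psi : R -> R := fun x =>
  (-1) ^+ RLorder mu * 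
    derive1n (RLorder mu) (RLint_r ((RLorder mu)%:R - mu) psi) x.

(** Weak fractional derivatives, mu > 0 *)

Definition is_weak_l mu u w : Prop :=
  [/\ locally_integrable setT u, locally_integrable setT w &
      forall psi, test_function psi ->
        leb.-integrable setT (fun x => (u x * RLder_r mu psi x)%:E) /\
        inner u (RLder_r mu psi) = inner w psi].

Definition is_weak_r mu u w : Prop :=
  [/\ locally_integrable setT u, locally_integrable setT w &
      forall psi, test_function psi ->
        leb.-integrable setT (fun x => (u x * RLder_l mu psi x)%:E) /\
        inner u (RLder_l mu psi) = inner w psi].

(** The operators of arbitrary real order: [is_D_l s u w] reads D^s u = w and
    [is_D_r s u w] reads D^{s*} u = w. *)

Definition is_D_l s u w : Prop :=
  if s < 0 then is_RLint_l (- s) u w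
  else if s == 0 then ae_eq_fun w u
  else is_weak_l s u w.

Definition is_D_r s u w : Prop :=
  if s < 0 then is_RLint_r (- s) u w
  else if s == 0 then ae_eq_fun w u
  else is_weak_r s u w.

(* f = D^{-s} u + D^{s*} u *)
Definition decomp_lr s f u : Prop :=
  exists g h, [/\ is_D_l (- s) u g, is_D_r s u h &
                  ae_eq_fun f (fun x => g x + h x)].

(* f = D^{-s} u + D^{s} u *)
Definition decomp_ll s f u : Prop :=
  exists g h, [/\ is_D_l (- s) u g, is_D_l s u h &
                  ae_eq_fun f (fun x => g x + h x)].

End FractionalCalculus.

(* Main.v *)
Require Import Defs.
From HB Require Import structures.
From mathcomp Require Import all_boot all_order all_algebra.
From mathcomp Require Import all_classical all_reals all_analysis.
From mathcomp Require Import measurable_realfun lebesgue_integral_under.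
From mathcomp Require Import complex.
From mathcomp Require Import ring lra.

Set Implicit Arguments.
Unset Strict Implicit.
Unset Printing Implicit Defensive.
Import Order.TTheory GRing.Theory Num.Theory.
Import numFieldNormedType.Exports.
Local Open Scope classical_set_scope.
Local Open Scope ring_scope.

(** Write [rho = |2 pi xi|]. The proof works with the Hartley transform
    [h xi = int (cos + sin) (2 pi x xi) w x dx], a real isometric involution of [L2]
    whose even and odd parts are, up to sign, the real and imaginary parts of the Fourier
    transform; [HhatP] restates the Sobolev condition with it. The operator of Fourier
    symbol [rho^p (a - i b sgn xi)] acts on [h] as [mult p a b], that is, it produces
    [rho^p (a h(xi) + b sgn xi h(-xi))].

    For [0 < s < 1/2] the fractional integral of order [s] has such a symbol with [p = - s]
    ([isH_RL], [isH_RL_L2], [RL_L2_symbol]) and the weak derivative of order [s] one with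
    [p = s] ([isH_RLtest], [isH_weak]); in both, [a > 0], whatever the directions. If [k] is
    the transform of [u], then [f = I u + D u] becomes
    [h_f(xi) = P k(xi) + sgn xi Q k(-xi)] with [P = a1 rho^(-s) + a2 rho^s] and [Q] even.
    For each pair [xi], [- xi] this is a linear system of determinant
    [P^2 + Q^2 >= P^2 > 0], so [k] is determined by [f] and
    [|k(xi)| <= (|h_f(xi)| + |h_f(-xi)|) / P]. Since [P] dominates [rho^(-s)], [1] and
    [rho^s], the functions [k], [rho^(-s) k] and [rho^s k] are square integrable
    ([inv_symb_L2]): [u] lies in the Sobolev space of order [s] and both operators apply to
    it. The same bound multiplied by [rho^t], and its converse [sum_symb_L2], give the
    equivalence of regularity. All this is [two_sided_solvable], where the directions are
    arbitrary. Both parts of the theorem are instances of it: for [s < 0] the integral and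
    the derivative exchange places, and for [s = 0] the equation is [f = 2 u].

    The symbols are found by subordination: [z^(s-1)] is, up to the factor [Gamma (1 - s)],
    the mixture [int l^(-s) exp(-l z) dl] of exponentials, which have rational transforms;
    homogeneity gives the power [rho^(-s)], with coefficients that are integrals of positive
    functions ([rlk_symbol]). This takes place on bounded summable functions and passes to
    [L2] by transposition, locally summable functions being determined by their pairings
    with test functions ([test_function_ext]). The condition [s < 1/2] makes [rho^(-s)]
    locally square integrable, so that low frequencies cause no obstruction.

    The [L2] theory of the transform itself rests on damping by [exp(-e |xi|)], which
    corresponds to averaging with the Poisson kernel; it yields that the transform is a
    contraction ([hartley_contraction]) and inverts itself against test functions
    ([hartley_test_Parseval]). *)

(** * Almost everywhere statements and summable functions *)
Section Toolkit.
Context {R : realType}.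
Local Notation mu := (@lebesgue_measure R).
Implicit Types (f g h : R -> R).

Lemma aeS (P Q : R -> Prop) : (forall x, P x -> Q x) ->
  {ae mu, forall x, P x} -> {ae mu, forall x, Q x}.
Proof.
move=> PQ; rewrite /almost_everywhere /=; apply: negligibleS => x /= nQ p.
exact/nQ/PQ.
Qed.

Lemma aeS2 (P Q S : R -> Prop) : (forall x, P x -> Q x -> S x) ->
  {ae mu, forall x, P x} -> {ae mu, forall x, Q x} -> {ae mu, forall x, S x}.
Proof.
move=> PQS hP hQ; have /negligibleS := @negligibleU _ _ _ mu _ _ hP hQ; apply.
by move=> x /= nS; apply/not_andP => -[p q]; exact/nS/PQS.
Qed.

Lemma aeS3 (P Q S T : R -> Prop) : (forall x, P x -> Q x -> S x -> T x) ->
  {ae mu, forall x, P x} -> {ae mu, forall x, Q x} -> {ae mu, forall x, S x} ->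
  {ae mu, forall x, T x}.
Proof.
move=> PQST hP hQ; apply: aeS2 (aeS2 (fun x p q => conj p q) hP hQ).
by move=> x [p q]; exact: PQST.
Qed.

Definition Int f : Prop := mu.-integrable setT (EFin \o f).

Lemma Int_mfun f : Int f -> measurable_fun setT f.
Proof. by move=> /integrableP[/measurable_EFinP]. Qed.

Lemma Int_le_ae f g : measurable_fun setT f ->
  {ae mu, forall x, `|f x| <= g x} -> Int g -> Int f.
Proof.
move=> mf fg ig; have mg := Int_mfun ig.
apply/integrableP; split; first exact/measurable_EFinP.
case/integrableP : (ig) => _; apply: le_lt_trans.
apply: ae_ge0_le_integral => //.
- by apply: measurableT_comp => //; exact/measurable_EFinP.
- by apply: measurableT_comp => //; exact/measurable_EFinP.
- apply: aeS fg => x fgx _ /=; rewrite lee_fin (le_trans fgx)//.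
  exact: ler_norm.
Qed.

Lemma Int_le f g : measurable_fun setT f ->
  (forall x, `|f x| <= g x) -> Int g -> Int f.
Proof. by move=> mf fg; apply: Int_le_ae => //; exact: aeW. Qed.

Lemma IntD f g : Int f -> Int g -> Int (fun x => f x + g x).
Proof. by move=> If Ig; have := integrableD measurableT If Ig. Qed.

Lemma IntN f : Int f -> Int (fun x => - f x).
Proof. by move=> If; have := integrableN If. Qed.

Lemma IntB f g : Int f -> Int g -> Int (fun x => f x - g x).
Proof. by move=> If Ig; apply: IntD => //; exact: IntN. Qed.

Lemma IntZl c f : Int f -> Int (fun x => c * f x).
Proof. by move=> If; have := integrableZl measurableT c If. Qed.

Lemma IntZr c f : Int f -> Int (fun x => f x * c).
Proof. by move=> If; under eq_fun do rewrite mulrC; exact: IntZl. Qed.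

Lemma Int_norm f : Int f -> Int (fun x => `|f x|).
Proof. by move=> If; have := integrable_norm If. Qed.

Lemma Int_ae_eq f g : measurable_fun setT g -> {ae mu, forall x, f x = g x} ->
  Int f -> Int g.
Proof.
move=> mg fg If; apply: Int_le_ae (Int_norm If) => //.
by apply: aeS fg => x ->.
Qed.

Lemma Int0 : Int (fun=> 0).
Proof. by have := @integrable0 _ _ R mu setT. Qed.

Lemma EFin_int f : Int f -> (\int[mu]_x (f x)%:E)%E = (\int[mu]_x f x)%:E.
Proof. by move=> If; rewrite /Rintegral fineK//; exact: integrable_fin_num. Qed.

Lemma intD f g : Int f -> Int g ->
  \int[mu]_x (f x + g x) = \int[mu]_x f x + \int[mu]_x g x.
Proof. exact: RintegralD. Qed.

Lemma intB f g : Int f -> Int g ->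
  \int[mu]_x (f x - g x) = \int[mu]_x f x - \int[mu]_x g x.
Proof. exact: RintegralB. Qed.

Lemma intZl c f : Int f -> \int[mu]_x (c * f x) = c * \int[mu]_x f x.
Proof. exact: RintegralZl. Qed.

Lemma intZr c f : Int f -> \int[mu]_x (f x * c) = (\int[mu]_x f x) * c.
Proof. exact: RintegralZr. Qed.

Lemma intN f : Int f -> \int[mu]_x (- f x) = - \int[mu]_x f x.
Proof.
by move=> If; under eq_Rintegral do rewrite -mulN1r; rewrite intZl// mulN1r.
Qed.

Lemma eq_int f g : (forall x, f x = g x) -> \int[mu]_x f x = \int[mu]_x g x.
Proof. by move=> fg; apply: eq_Rintegral => x _; exact: fg. Qed.

Lemma int_ge0 f : (forall x, 0 <= f x) -> 0 <= \int[mu]_x f x.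
Proof. by move=> f0; apply: Rintegral_ge0. Qed.

Lemma int_le f g : Int f -> Int g -> (forall x, f x <= g x) ->
  \int[mu]_x f x <= \int[mu]_x g x.
Proof. by move=> If Ig fg; apply: le_Rintegral. Qed.

Lemma int_norm f : Int f -> `|\int[mu]_x f x| <= \int[mu]_x `|f x|.
Proof. by move=> If; apply: le_normr_Rintegral. Qed.

Lemma int_ae_eq f g : measurable_fun setT f -> measurable_fun setT g ->
  {ae mu, forall x, f x = g x} -> \int[mu]_x f x = \int[mu]_x g x.
Proof.
move=> mf mg fg; rewrite /Rintegral; congr fine.
apply: ae_eq_integral => //; try exact/measurable_EFinP.
by apply: aeS fg => x -> _.
Qed.

Lemma Int_ge0P f : measurable_fun setT f -> (forall x, 0 <= f x) ->
  Int f <-> (\int[mu]_x (f x)%:E < +oo)%E.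
Proof.
move=> mf f0; have E : (\int[mu]_x `|(EFin \o f) x| = \int[mu]_x (f x)%:E)%E.
  by apply: eq_integral => x _; rewrite /= ger0_norm.
split; first by case/integrableP => _; rewrite E.
by move=> foo; apply/integrableP; split; [exact/measurable_EFinP | rewrite E].
Qed.

Lemma Int_0_ae f : Int f -> (forall x, 0 <= f x) -> \int[mu]_x f x = 0 ->
  {ae mu, forall x, f x = 0}.
Proof.
move=> If f0 if0; have mf := Int_mfun If.
have E : (\int[mu]_x `|(EFin \o f) x| = 0)%E.
  transitivity (\int[mu]_x (f x)%:E)%E.
    by apply: eq_integral => x _; rewrite /= ger0_norm.
  by rewrite EFin_int// if0.
have H : measurable_fun setT (EFin \o f) by exact/measurable_EFinP.
have [+ _] := @ae_eq_integral_abs _ _ R mu setT measurableT _ H => /(_ E).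
by apply: aeS => x /(_ Logic.I) [].
Qed.

Lemma int_DC (F : nat -> R -> R) f g :
  (forall n, measurable_fun setT (F n)) -> measurable_fun setT f ->
  {ae mu, forall x, F n x @[n --> \oo] --> f x} ->
  {ae mu, forall x, forall n, `|F n x| <= g x} -> Int g ->
  Int f /\ \int[mu]_x F n x @[n --> \oo] --> \int[mu]_x f x.
Proof.
move=> mF mf Ff Fg Ig.
have IF n : Int (F n).
  by apply: (Int_le_ae (mF n) _ Ig); apply: aeS Fg => x; exact.
have [] := @dominated_convergence _ _ R mu setT measurableT
   (fun n => EFin \o F n) (EFin \o f) (EFin \o g).
- by move=> n; apply/measurable_EFinP; exact: mF.
- by apply/measurable_EFinP.
- apply: aeS Ff => x Ffx _.
  by apply: cvg_EFin; [exact: nearW|exact: Ffx].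
- exact: Ig.
- by apply: aeS Fg => x Fgx n _; rewrite /= lee_fin.
move=> If _ C; split=> //.
move: C => /=; under eq_fun do rewrite EFin_int//.
by rewrite EFin_int// => /fine_cvgP[_]; exact.
Qed.

Lemma int_fatou (F : nat -> R -> R) f C :
  (forall n, Int (F n)) -> (forall n x, 0 <= F n x) ->
  (forall n, \int[mu]_x F n x <= C) ->
  (forall x, F n x @[n --> \oo] --> f x) ->
  [/\ Int f, (forall x, 0 <= f x) & \int[mu]_x f x <= C].
Proof.
move=> IF F0 FC Ff.
have mf : measurable_fun setT f.
  by apply: (measurable_fun_cvg (fun n => Int_mfun (IF n))) => x _; exact: Ff.
have f0 x : 0 <= f x.
  by apply: (cvgr_to_ge (Ff x)); exact: nearW.
have H : (\int[mu]_x (f x)%:E <= C%:E)%E.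
  have := @fatou _ _ R mu setT measurableT (fun n => EFin \o F n) _ _.
  have -> : (\int[mu]_x (limn_einf ((fun n => EFin \o F n) ^~ x)) = \int[mu]_x (f x)%:E)%E.
    apply: eq_integral => x _.
    have cx : (EFin \o F n) x @[n --> \oo] --> (f x)%:E.
      by apply: cvg_EFin; [exact: nearW|exact: Ff].
    rewrite is_cvg_limn_einfE; first exact/cvg_lim.
    by apply/cvg_ex; exists (f x)%:E.
  move=> /(_ _ _)/le_trans -> //.
  - by move=> n; apply/measurable_EFinP; exact: Int_mfun.
  - by move=> n x _; rewrite /= lee_fin.
  - rewrite limn_einf_lim; apply: lime_le; first exact: is_cvg_einfs.
    apply: nearW => n; apply: (@le_trans _ _ (\int[mu]_x (F n x)%:E)%E).
      by apply: ereal_inf_lbound; exists n => /=.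
    by rewrite EFin_int// lee_fin.
have If : Int f by apply/Int_ge0P => //; rewrite (le_lt_trans H)// ltry.
by split=> //; rewrite -lee_fin -EFin_int.
Qed.

End Toolkit.

(** * The space of square-integrable functions *)
Section SquareIntegrable.
Context {R : realType}.
Local Notation mu := (@lebesgue_measure R).
Implicit Types (f g h : R -> R).

Lemma L2P f : f \in L2 <-> measurable_fun setT f /\ Int (fun x => f x ^+ 2).
Proof.
split=> [fL|[mf If]].
  split; last exact: Lfun2_integrable_sqr fL.
  by move: fL => /andP[]; rewrite inE.
apply/andP; split; first by rewrite inE.
rewrite inE /finite_norm /=; rewrite unlock; apply: poweR_lty.
have [_] := (integrableP _ _ _ If).
congr (_ < _)%E; apply: eq_integral => x _ /=.
by rewrite ger0_norm ?sqr_ge0// powR_mulrn// real_normK// num_real.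
Qed.

Lemma L1P f : f \in L1 <-> Int f.
Proof. exact: Lfun1_integrable. Qed.

End SquareIntegrable.

Section Affine.
Context {R : realType}.
Local Notation mu := (@lebesgue_measure R).
Implicit Types (f g h : R -> R).

Lemma measurable_affine (c d : R) : measurable_fun setT (fun x : R => c * x + d).
Proof. by apply: measurable_funD => //; exact: measurable_funM. Qed.

(** The right-hand side is a measure in [A] with the same value on intervals, so
    uniqueness of the Lebesgue measure applies. *)
Lemma lebesgue_affine (c d : R) (A : set R) : c != 0 -> measurable A ->
  (mu A = `|c|%:E * mu ((fun x : R => (c * x + d)%R) @^-1` A))%E.
Proof.
move=> c0 mA; have mphi := measurable_affine c d.
pose nu : {measure set (measurableTypeR R) -> \bar R} :=
  @measure_function_pushforward__canonical__measure_function_Measure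
    _ _ (measurableTypeR R) (measurableTypeR R) _ mu _ mphi.
pose nu' := mscale (NngNum (normr_ge0 c)) nu.
apply: (@lebesgue_measure_unique R nu') mA => _ [[a b] _ <-] /=.
rewrite /nu' /mscale /nu /= /pushforward /=.
move: c0; rewrite neq_lt => /orP[] c0.
- have -> : (fun x => c * x + d) @^-1` `]a, b] = `[(b - d) / c, (a - d) / c[%classic.
    apply/seteqP; split => x /=; rewrite !in_itv/= => /andP[];
    by rewrite ler_ndivrMr// ltr_ndivlMr// lerBrDr ltrBlDr mulrC => -> ->.
  rewrite !lebesgue_measure_itv/= !lte_fin ltr_ndivrMr// divfK ?lt_eqF// ltrD2r.
  case: ifP => ab; last by rewrite mule0.
  by rewrite -!EFinD -EFinM ltr0_norm//; congr EFin; field; rewrite lt_eqF.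
- have -> : (fun x => c * x + d) @^-1` `]a, b] = `](a - d) / c, (b - d) / c]%classic.
    apply/seteqP; split => x /=; rewrite !in_itv/= => /andP[];
    by rewrite ler_pdivlMr// ltr_pdivrMr// lerBrDr ltrBlDr mulrC => -> ->.
  rewrite !lebesgue_measure_itv/= !lte_fin ltr_pM2r ?invr_gt0// ltrD2r.
  case: ifP => ab; last by rewrite mule0.
  by rewrite -!EFinD -EFinM gtr0_norm//; congr EFin; field; rewrite gt_eqF.
Qed.

Lemma ge0_integral_affine (c d : R) f : c != 0 -> measurable_fun setT f ->
  (forall x, 0 <= f x) ->
  (\int[mu]_x (f x)%:E = `|c|%:E * \int[mu]_x (f (c * x + d)%R)%:E)%E.
Proof.
move=> c0 mf f0; have mphi := measurable_affine c d.
pose nu : {measure set (measurableTypeR R) -> \bar R} :=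
  @measure_function_pushforward__canonical__measure_function_Measure
    _ _ (measurableTypeR R) (measurableTypeR R) _ mu _ mphi.
pose nu' := mscale (NngNum (normr_ge0 c)) nu.
have mEf : measurable_fun setT (EFin \o f) by exact/measurable_EFinP.
transitivity (\int[nu']_x (f x)%:E)%E.
  by apply: eq_measure_integral => A mA _; exact: lebesgue_affine.
rewrite ge0_integral_mscale//; last by move=> x _; rewrite lee_fin.
congr (_ * _)%E.
apply: (@ge0_integral_pushforward _ _ (measurableTypeR R) (measurableTypeR R)
  R _ mphi mu setT (EFin \o f)) => //.
by move=> x _; rewrite lee_fin.
Qed.

Lemma Int_affine (c d : R) f : c != 0 -> Int f -> Int (fun x => f (c * x + d)).
Proof.
move=> c0 If; have mf := Int_mfun If.
have mfc : measurable_fun setT (fun x => f (c * x + d)).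
  exact: (measurableT_comp mf (measurable_affine c d)).
apply/integrableP; split; first exact/measurable_EFinP.
case/integrableP : (If) => _ /=.
rewrite (@ge0_integral_affine c d (fun x => `|f x|))//; last exact: measurableT_comp.
set J := integral _ _ _; rewrite !ltey; apply: contra_neq => ->.
by rewrite mulry gtr0_sg ?normr_gt0// mul1e.
Qed.

Lemma int_affine (c d : R) f : c != 0 -> Int f ->
  \int[mu]_x f x = `|c| * \int[mu]_x f (c * x + d).
Proof.
move=> c0 If.
have H g : Int g -> (forall x, 0 <= g x) ->
    \int[mu]_x g x = `|c| * \int[mu]_x g (c * x + d).
  move=> Ig g0; rewrite /Rintegral (@ge0_integral_affine c d)//; last exact: Int_mfun Ig.
  by rewrite fineM// integrable_fin_num//; exact: (Int_affine d c0 Ig).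
have In := Int_norm If; have Ip := IntD If In.
have E x : f x = (f x + `|f x|) - `|f x| by rewrite addrK.
rewrite (eq_int E) intB// H//; last first.
  by move=> x; have := ler_norm (- f x); rewrite normrN; lra.
rewrite (H (fun x => `|f x|))//.
rewrite -mulrBr -intB; [|exact: (Int_affine d c0 Ip)|exact: (Int_affine d c0 In)].
by congr (_ * _); apply: eq_int => x; rewrite addrK.
Qed.

End Affine.

Section FubiniTonelli.
Context {R : realType}.
Local Notation mu := (@lebesgue_measure R).

Let measurable_absF (F : R * R -> R) : measurable_fun setT F ->
  measurable_fun setT (fun z => `|F z|%:E).
Proof. by move=> mF; apply/measurable_EFinP; exact: measurableT_comp. Qed.

Let Fubini_left (F : R * R -> R) : measurable_fun setT F ->
  (\int[mu]_x \int[mu]_y `|F (x, y)|%:E < +oo)%E ->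
  [/\ {ae mu, forall x, Int (fun y => F (x, y))},
      Int (fun x => \int[mu]_y `|F (x, y)|),
      Int (fun x => \int[mu]_y F (x, y)) &
   (\int[mu]_x \int[mu]_y (F (x, y))%:E =
    (\int[mu]_x (\int[mu]_y F (x, y)))%:E)%E].
Proof.
move=> mF Foo.
have mEF : measurable_fun setT (EFin \o F) by exact/measurable_EFinP.
have IF : (mu \x mu)%E.-integrable setT (EFin \o F).
  exact/integrable12ltyP.
have ae1 : {ae mu, forall x, Int (fun y => F (x, y))} := ae_integrable1 IF.
have I1 := integrable_fubini_F IF.
have mfine (J : R -> \bar R) : measurable_fun setT J ->
    measurable_fun setT (fun x => fine (J x)).
  by move=> mJ; apply: (measurableT_comp (fine_measurable measurableT) mJ).
have mI : measurable_fun setT (fun x => \int[mu]_y F (x, y)).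
  by apply: mfine; exact: (measurable_int _ I1).
have mA : measurable_fun setT (fun x => \int[mu]_y `|F (x, y)|%:E)%E.
  exact: (measurable_fun_fubini_tonelli_F (m2:=mu) _ (measurable_absF mF)).
have mA' : measurable_fun setT (fun x => \int[mu]_y `|F (x, y)|) by exact: mfine.
have IA : Int (fun x => \int[mu]_y `|F (x, y)|).
  apply/Int_ge0P => //; first by move=> x; exact: int_ge0.
  apply: le_lt_trans Foo; apply: ae_ge0_le_integral => //.
  - by move=> x _; rewrite lee_fin; exact: int_ge0.
  - by apply/measurable_EFinP.
  - by move=> x _; exact: integral_ge0.
  - by apply: aeS ae1 => x Ix _ /=; rewrite (EFin_int (Int_norm Ix)).
have IB : Int (fun x => \int[mu]_y F (x, y)).
  by apply: (Int_le_ae mI _ IA); apply: aeS ae1 => x; exact: int_norm.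
split=> //; rewrite -EFin_int//; apply: ae_eq_integral => //.
- exact: (measurable_int _ I1).
- by apply/measurable_EFinP.
- by apply: aeS ae1 => x Ix _ /=; rewrite EFin_int.
Qed.

(** Real-valued integrals are total, so a single hypothesis of absolute convergence has to
    deliver the summability of the sections along with the exchange. *)
Lemma Fubini_package (F : R * R -> R) : measurable_fun setT F ->
  (\int[mu]_x \int[mu]_y `|F (x, y)|%:E < +oo)%E ->
  [/\ {ae mu, forall x, Int (fun y => F (x, y))},
      {ae mu, forall y, Int (fun x => F (x, y))},
      Int (fun x => \int[mu]_y F (x, y)), Int (fun y => \int[mu]_x F (x, y)) &
   \int[mu]_x (\int[mu]_y F (x, y)) = \int[mu]_y (\int[mu]_x F (x, y))].
Proof.
move=> mF Foo; have [ae1 _ I1 E1] := Fubini_left mF Foo.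
have mswap : measurable_fun setT (F \o @unstable.swap R R).
  by apply: measurableT_comp => //; exact: measurable_swap.
have [|ae2 _ I2 E2] := Fubini_left mswap.
  apply: le_lt_trans Foo.
  by rewrite (fubini_tonelli (m1:=mu) (m2:=mu) _ (measurable_absF mF)).
have IF : (mu \x mu)%E.-integrable setT (EFin \o F).
  by apply/integrable12ltyP => //; exact/measurable_EFinP.
have E := Fubini IF.
split; [exact: ae1|exact: ae2|exact: I1|exact: I2|apply: EFin_inj; rewrite -E1 -E2; exact: E].
Qed.

(** In the applications the inner integral of the majorant has a closed form, so that its
    summability is a statement in one variable. *)
Lemma Fubini_majorant (F : R * R -> R) (G : R -> R -> R) : measurable_fun setT F ->
  {ae mu, forall x, Int (G x) /\ forall y, `|F (x, y)| <= G x y} ->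
  Int (fun x => \int[mu]_y G x y) ->
  (\int[mu]_x \int[mu]_y `|F (x, y)|%:E < +oo)%E.
Proof.
move=> mF FG IG; case/integrableP : (IG) => _; apply: le_lt_trans.
have mA : measurable_fun setT (fun x => \int[mu]_y `|F (x, y)|%:E)%E.
  exact: (measurable_fun_fubini_tonelli_F (m2:=mu) _ (measurable_absF mF)).
apply: ae_ge0_le_integral => //.
- by move=> x _; exact: integral_ge0.
- by apply: measurableT_comp => //; exact: (measurable_int _ IG).
apply: aeS FG => x [IGx FGx] _ /=.
apply: (@le_trans _ _ (\int[mu]_y (G x y)%:E)%E).
  apply: ge0_le_integral => //.
  - by apply/measurable_EFinP; apply: measurableT_comp => //; apply: measurableT_comp.
  - by apply/measurable_EFinP; exact: Int_mfun IGx.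
  - by move=> y _; rewrite lee_fin.
by rewrite (EFin_int IGx) lee_fin ler_norm.
Qed.

Lemma Fubini_majorant_swap (F : R * R -> R) (G : R -> R -> R) :
  measurable_fun setT F ->
  {ae mu, forall y, Int (G y) /\ forall x, `|F (x, y)| <= G y x} ->
  Int (fun y => \int[mu]_x G y x) ->
  (\int[mu]_x \int[mu]_y `|F (x, y)|%:E < +oo)%E.
Proof.
move=> mF FG IG.
rewrite (fubini_tonelli (m1:=mu) (m2:=mu) _ (measurable_absF mF))//.
apply: (@Fubini_majorant (F \o @unstable.swap R R) G _ FG IG).
by apply: measurableT_comp => //; exact: measurable_swap.
Qed.

End FubiniTonelli.

(** * Convergence in mean square *)
Section MeanSquare.
Context {R : realType}.
Local Notation mu := (@lebesgue_measure R).
Implicit Types (f g h w : R -> R) (v : nat -> R -> R).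

Lemma L2_mfun f : f \in L2 -> measurable_fun setT f.
Proof. by move=> /L2P[]. Qed.

Lemma L2_sqr f : f \in L2 -> Int (fun x => f x ^+ 2).
Proof. by move=> /L2P[]. Qed.

Lemma L2_mul f g : f \in L2 -> g \in L2 -> Int (fun x => f x * g x).
Proof.
move=> /L2P[mf If] /L2P[mg Ig]; apply: (Int_le _ _ (IntD If Ig)).
  exact: measurable_funM.
move=> x; rewrite ler_norml; have := sqr_ge0 (f x + g x); have := sqr_ge0 (f x - g x).
by move=> A B; apply/andP; split; nra.
Qed.

Lemma L2_le_ae f g : measurable_fun setT f -> g \in L2 ->
  {ae mu, forall x, `|f x| <= `|g x|} -> f \in L2.
Proof.
move=> mf /L2P[mg Ig] fg; apply/L2P; split=> //.
apply: (Int_le_ae _ _ Ig); first exact: measurable_funX.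
apply: aeS fg => x fgx; rewrite ger0_norm ?sqr_ge0//.
by rewrite -(real_normK (num_real (f x))) -(real_normK (num_real (g x))) ler_pXn2r// nnegrE.
Qed.

Lemma L2_le f g : measurable_fun setT f -> g \in L2 ->
  (forall x, `|f x| <= `|g x|) -> f \in L2.
Proof. by move=> mf Lg fg; apply: L2_le_ae mf Lg _; exact: aeW. Qed.

Lemma L2_ae_eq f g : measurable_fun setT g -> {ae mu, forall x, f x = g x} ->
  f \in L2 -> g \in L2.
Proof.
by move=> mg fg fL; apply: (L2_le_ae mg fL); apply: aeS fg => x ->.
Qed.

Lemma L2D f g : f \in L2 -> g \in L2 -> (fun x => f x + g x) \in L2.
Proof.
move=> Lf Lg; have mf := L2_mfun Lf; have mg := L2_mfun Lg; apply/L2P; split.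
  exact: measurable_funD.
apply: (Int_le _ _ (IntD (IntZl 2 (L2_sqr Lf)) (IntZl 2 (L2_sqr Lg)))).
  by apply: measurable_funX; exact: measurable_funD.
move=> x; rewrite ger0_norm ?sqr_ge0//; have := sqr_ge0 (f x - g x).
by nra.
Qed.

Lemma L2Z c f : f \in L2 -> (fun x => c * f x) \in L2.
Proof.
move=> Lf; have mf := L2_mfun Lf; apply/L2P; split; first exact: measurable_funM.
by under eq_fun do rewrite exprMn; apply: IntZl; exact: L2_sqr.
Qed.

Lemma L2N f : f \in L2 -> (fun x => - f x) \in L2.
Proof. by move=> /(L2Z (-1)); under eq_fun do rewrite mulN1r. Qed.

Lemma L2B f g : f \in L2 -> g \in L2 -> (fun x => f x - g x) \in L2.
Proof. by move=> Lf Lg; apply: L2D => //; exact: L2N. Qed.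

Lemma L2_norm f : f \in L2 -> (fun x => `|f x|) \in L2.
Proof.
move=> Lf; apply: (L2_le _ Lf) => [|x]; last by rewrite normr_id.
by apply: measurableT_comp => //; exact: L2_mfun.
Qed.

Lemma L2_affine (c d : R) f : c != 0 -> f \in L2 -> (fun x => f (c * x + d)) \in L2.
Proof.
move=> c0 /L2P[mf If]; apply/L2P; split; last exact: (Int_affine d c0 If).
exact: (measurableT_comp mf (measurable_affine c d)).
Qed.

(** The discriminant of the nonnegative quadratic [t |-> int (f + t g)^2]. *)
Lemma CauchySchwarz f g : f \in L2 -> g \in L2 ->
  (\int[mu]_x (f x * g x)) ^+ 2 <= \int[mu]_x (f x ^+ 2) * \int[mu]_x (g x ^+ 2).
Proof.
move=> Lf Lg; set a := \int[mu]_x _; set A := \int[mu]_x _; set B := \int[mu]_x _.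
have H t : 0 <= A + 2 * t * a + t ^+ 2 * B.
  have -> : A + 2 * t * a + t ^+ 2 * B = \int[mu]_x ((f x + t * g x) ^+ 2).
    have I1 := L2_sqr Lf; have I2 := IntZl (2 * t) (L2_mul Lf Lg).
    have I3 := IntZl (t ^+ 2) (L2_sqr Lg).
    rewrite /A /a /B -intZl; last exact: L2_mul.
    rewrite -intD// -intZl; last exact: L2_sqr.
    rewrite -intD//; last exact: IntD.
    by apply: eq_int => x; ring.
  by apply: int_ge0 => x; exact: sqr_ge0.
have A0 : 0 <= A by apply: int_ge0 => x; exact: sqr_ge0.
have B0 : 0 <= B by apply: int_ge0 => x; exact: sqr_ge0.
have [B_eq0|Bn0] := eqVneq B 0.
  rewrite B_eq0 mulr0; have [->|an0] := eqVneq a 0; first by rewrite expr0n.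
  have := H (- (A + 1) / (2 * a)); rewrite B_eq0 mulr0 addr0.
  have -> : 2 * (- (A + 1) / (2 * a)) * a = - (A + 1) by field.
  by lra.
have Bp : 0 < B by rewrite lt_neqAle eq_sym Bn0.
have := H (- a / B); have -> : A + 2 * (- a / B) * a + (- a / B) ^+ 2 * B = A - a ^+ 2 / B.
  by field.
by rewrite subr_ge0 ler_pdivrMr.
Qed.

Definition cvL2 v w : Prop := \int[mu]_x ((v n x - w x) ^+ 2) @[n --> \oo] --> 0.

Lemma cvg_L2P v w : (forall n, v n \in L2) -> w \in L2 -> cvg_L2 v w <-> cvL2 v w.
Proof.
move=> Lv Lw; rewrite /cvg_L2 /cvL2.
under eq_fun do rewrite (EFin_int (L2_sqr (L2B (Lv _) Lw))).
split; first by move=> /fine_cvgP[_]; exact.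
by move=> H; apply: cvg_EFin; [exact: nearW|exact: H].
Qed.

Lemma cvL2_inner v w g : (forall n, v n \in L2) -> w \in L2 -> g \in L2 ->
  cvL2 v w -> \int[mu]_x (v n x * g x) @[n --> \oo] --> \int[mu]_x (w x * g x).
Proof.
move=> Lv Lw Lg vw; apply/cvgrPdist_lt => e e0.
set C := \int[mu]_x (g x ^+ 2) + 1.
have C0 : 0 < C by rewrite ltr_wpDl// int_ge0// => x; exact: sqr_ge0.
have e2 : 0 < e ^+ 2 / C by rewrite divr_gt0// exprn_gt0.
near=> n.
rewrite -intB; [|exact: L2_mul|exact: L2_mul].
have -> : \int[mu]_x (w x * g x - v n x * g x) = \int[mu]_x ((w x - v n x) * g x).
  by apply: eq_int => x; rewrite mulrBl.
rewrite -(ltr_pXn2r (ltn0Sn 1)) ?nnegrE ?(ltW e0)// real_normK ?num_real//.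
apply: (le_lt_trans (CauchySchwarz (L2B Lw (Lv n)) Lg)).
have -> : \int[mu]_x ((w x - v n x) ^+ 2) = \int[mu]_x ((v n x - w x) ^+ 2).
  by apply: eq_int => x; ring.
set D := \int[mu]_x ((v n x - w x) ^+ 2).
have D0 : 0 <= D by apply: int_ge0 => x; exact: sqr_ge0.
apply: (@le_lt_trans _ _ (D * C)); first by rewrite ler_wpM2l// /C lerDl.
rewrite -ltr_pdivlMr// /D; clear D D0; near: n.
have /cvgrPdist_lt/(_ _ e2) := vw; apply: filterS => n.
by rewrite sub0r normrN ger0_norm// int_ge0// => x; exact: sqr_ge0.
Unshelve. all: by end_near. Qed.

Lemma cvL2_dominated v w g : (forall n, measurable_fun setT (v n)) ->
  measurable_fun setT w -> g \in L2 ->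
  {ae mu, forall x, v n x @[n --> \oo] --> w x} ->
  {ae mu, forall x, forall n, `|v n x| <= g x} ->
  [/\ forall n, v n \in L2, w \in L2 & cvL2 v w].
Proof.
move=> mv mw Lg vw vg.
have wg : {ae mu, forall x, `|w x| <= g x}.
  apply: aeS2 vw vg => x vwx vgx.
  by apply: (cvgr_to_le (cvg_norm vwx)); apply: nearW => n; exact: vgx.
have Lv n : v n \in L2.
  by apply: L2_le_ae Lg _ => //; apply: aeS vg => x /(_ n)/le_trans -> //; exact: ler_norm.
have Lw : w \in L2.
  by apply: L2_le_ae Lg _ => //; apply: aeS wg => x /le_trans -> //; exact: ler_norm.
split=> //.
have [|||||_ +] := @int_DC R (fun n x => (v n x - w x) ^+ 2) (fun=> 0) (fun x => 4 * g x ^+ 2).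
- by move=> n; apply: measurable_funX; exact: measurable_funB.
- exact: measurable_cst.
- apply: aeS vw => x vwx.
  have H : v n x - w x @[n --> \oo] --> 0 by apply/subr_cvg0.
  by under eq_fun do rewrite expr2; have := cvgM H H; rewrite mulr0; exact.
- apply: aeS2 vg wg => x vgx wgx n; rewrite ger0_norm ?sqr_ge0//.
  have := vgx n; move: wgx; rewrite !ler_norml => /andP[a b] /andP[c d].
  by nra.
- exact/IntZl/L2_sqr.
by rewrite /Rintegral integral0_eq.
Qed.

End MeanSquare.

(** * Test functions separate locally integrable functions *)
Section SmoothFunctions.
Context {R : realType}.
Implicit Types (f g : R -> R).

(** [n] times differentiable functions; the recursion on the first derivative
    is the one along which products are stable. *)
Fixpoint diff_times n f : Prop :=
  if n is m.+1 then (forall x, derivable f x 1) /\ diff_times m (derive1 f) else True.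

Lemma diff_timesW n f : diff_times n.+1 f -> diff_times n f.
Proof. by elim: n f => [//|n IH] f [df] /IH. Qed.

Lemma smoothP f : (forall n x, derivable (derive1n n f) x 1) <->
  (forall n, diff_times n f).
Proof.
split.
- move=> + n; elim: n f => [//|n IH] f sf; split; first exact: (sf 0%N).
  by apply: IH => m x; rewrite -derive1Sn; exact: sf.
- move=> + n; elim: n f => [|n IH] f sf x; first by case: (sf 1%N) => + _; exact.
  by rewrite derive1Sn; apply: IH => m; case: (sf m.+1).
Qed.

Lemma diff_timesD n f g : diff_times n f -> diff_times n g ->
  diff_times n (fun x => f x + g x).
Proof.
elim: n f g => [//|n IH] f g [df cf] [dg cg]; split.
  by move=> x; exact: derivableD.
suff -> : derive1 (fun x => f x + g x) = (fun x => derive1 f x + derive1 g x) by exact: IH.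
by apply/funext => x; rewrite !derive1E deriveD.
Qed.

Lemma diff_timesM n f g : diff_times n f -> diff_times n g ->
  diff_times n (fun x => f x * g x).
Proof.
elim: n f g => [//|n IH] f g [df cf] [dg cg]; split.
  by move=> x; exact: derivableM.
have -> : derive1 (fun x => f x * g x) = (fun x => f x * derive1 g x + g x * derive1 f x).
  by apply/funext => x; rewrite !derive1E deriveM.
by apply: diff_timesD; apply: IH => //; exact: diff_timesW.
Qed.

Lemma diff_times_cst n c : diff_times n (fun=> c : R).
Proof.
elim: n c => [//|n IH] c; split => [x|]; first exact: derivable_cst.
rewrite (_ : derive1 _ = fun=> 0); first exact: IH.
by apply/funext => x; rewrite derive1_cst.
Qed.

Lemma is_derive_affine (c d x : R) : is_derive x 1 (fun y : R => c * y + d) c.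
Proof.
have H : is_derive x 1 (fun y : R => c * y + d) (c *: 1 + 0) :=
  is_deriveD (is_deriveZ c (is_derive_id x 1)) (is_derive_cst d x 1).
by apply: is_derive_eq H _; rewrite addr0 [c *: 1]mulr1.
Qed.

Lemma diff_times_affine n c d f : diff_times n f ->
  diff_times n (fun x => f (c * x + d)).
Proof.
elim: n f => [//|n IH] f [df cf].
have D (x : R) : is_derive x 1 (fun y : R => f (c * y + d)) (c * derive1 f (c * x + d)).
  have := is_derive_affine c d x => A.
  have B : is_derive (c * x + d) 1 f (derive1 f (c * x + d)).
    by rewrite derive1E; exact/derivableP.
  by have := @is_derive1_comp R f (fun y => c * y + d) x _ _ B A; rewrite mulrC.
split; first by move=> x; exact: ex_derive.
rewrite (_ : derive1 _ = fun x => c * derive1 f (c * x + d)).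
  by apply: diff_timesM; [exact: diff_times_cst|exact: IH].
by apply/funext => x; rewrite derive1E; exact: derive_val.
Qed.

Lemma pow_expR_bound k : exists2 C : R, 0 <= C &
  forall y : R, 0 <= y -> y ^+ k * expR (- y) <= C.
Proof.
exists (k`!%:R) => // y y0; rewrite expRN ler_pdivrMr ?expR_gt0//.
case: k => [|k]; first by rewrite fact0 mul1r expr0 -expR0 ler_expR.
rewrite mulrC -ler_pdivrMr ?ltr0n ?fact_gt0//.
by apply: le_trans (expR_ge1Dxn k y0); rewrite lerDr.
Qed.

(** Exponential decay beats every power: this is the flatness at [0] of the
    functions below. *)
Lemma poly_expR_bound (p : {poly R}) k : exists2 C : R, 0 <= C &
  forall y : R, 0 <= y -> `|p.[y]| * y ^+ k * expR (- y) <= C.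
Proof.
elim/poly_ind: p k => [|p c IH] k.
  by exists 0 => // y _; rewrite horner0 normr0 !mul0r.
have [C C0 HC] := IH k.+1; have [D D0 HD] := pow_expR_bound k.
exists (C + `|c| * D) => [|y y0]; first by rewrite addr_ge0// mulr_ge0.
rewrite hornerMXaddC.
have E : 0 <= y ^+ k * expR (- y) by rewrite mulr_ge0 ?exprn_ge0 ?expR_ge0.
rewrite -mulrA.
apply: (@le_trans _ _ ((`|p.[y]| * y + `|c|) * (y ^+ k * expR (- y)))).
  apply: ler_wpM2r => //; apply: (le_trans (ler_normD _ _)).
  by rewrite normrM (ger0_norm y0).
rewrite mulrDl lerD//; last by rewrite ler_wpM2l// HD.
by apply: le_trans (HC _ y0); rewrite exprS !mulrA.
Qed.

(** The functions [p(1/x) exp(-1/x)] on the positive half-line, extended by [0],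
    are stable under differentiation. *)
Definition flat (p : {poly R}) (x : R) : R :=
  if 0 < x then p.[x^-1] * expR (- x^-1) else 0.

(** As [d/dx p(1/x) exp(-1/x) = x^-2 (p - p')(1/x) exp(-1/x)], every derivative is
    again of this form, and smoothness needs only the derivative at [0]. *)
Lemma is_derive_flat (p : {poly R}) (x : R) :
  is_derive x 1 (flat p) (flat ('X ^+ 2 * (p - p^`())) x).
Proof.
have [x0|x0|<-] := ltgtP 0 x.
- have D : is_derive x 1 (fun y : R => p.[y^-1] * expR (- y^-1))
      (flat ('X ^+ 2 * (p - p^`())) x).
    have Di : is_derive x 1 (fun y : R => y^-1) (- x ^- 2).
      have H := is_deriveV (f := id) (lt0r_neq0 x0) (is_derive_id x 1).
      by apply: (is_derive_eq H); rewrite [_ *: _]mulr1.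
    have Dp := @is_derive1_comp R (horner p) (fun y => y^-1) x _ _ (is_derive_poly p x^-1) Di.
    have De := @is_derive1_comp R expR (fun y => - y^-1) x _ _ (is_derive_expR (- x^-1)) (is_deriveN Di).
    have H := is_deriveM Dp De; apply: (is_derive_eq H).
    by rewrite /flat x0 !hornerE/= /GRing.scale/= -exprVn; ring.
  apply: near_eq_is_derive D; near=> y.
  by rewrite /flat ifT//; near: y; exact: lt_nbhsr.
- have -> : flat ('X ^+ 2 * (p - p^`())) x = 0 by rewrite /flat ltNge ltW.
  apply: near_eq_is_derive (is_derive_cst 0 x 1); near=> y.
  rewrite /flat ltNge ltW//; near: y; exact: lt_nbhsl.
have -> : flat ('X ^+ 2 * (p - p^`())) 0 = 0 by rewrite /flat ltxx.
have [C C0 HC] := poly_expR_bound p 2.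
have H : h^-1 *: (flat p (h *: 1 + 0) - flat p 0) @[h --> 0^'] --> 0.
  apply: norm_cvg0; have := @squeeze_cvgr _ _ _ _ (fun=> 0) (fun h : R => C * `|h|)
    (fun h : R => `|h^-1 *: (flat p (h *: 1 + 0) - flat p 0)|) _ 0; apply.
  - near=> h; rewrite normr_ge0/= {2}/flat ltxx subr0 addr0 [h *: 1]mulr1.
    rewrite [_ *: _]mulrC normrM normfV ler_pdivrMr; last first.
      by rewrite normr_gt0; near: h; exact: nbhs_dnbhs_neq.
    rewrite /flat; case: ifPn => [h0|_]; last by rewrite normr0 !mulr_ge0.
    have hV : 0 <= h^-1 by rewrite invr_ge0 ltW.
    have := HC _ hV; rewrite -mulrA mulrCA -ler_pdivlMl ?exprn_gt0 ?invr_gt0//.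
    rewrite exprVn invrK normrM (ger0_norm (expR_ge0 _)) (gtr0_norm h0) => /le_trans; apply.
    by rewrite mulrC -mulrA -expr2.
  - exact: cvg_cst.
  - rewrite -[X in _ --> X](mulr0 C); apply: cvgM; first exact: cvg_cst.
    rewrite -[X in _ --> X](@normr0 _ R); apply: cvg_norm.
    exact: cvg_within.
apply: DeriveDef; first by apply/cvg_ex; exists 0.
exact/cvg_lim.
Unshelve. all: by end_near. Qed.

Lemma diff_times_flat n p : diff_times n (flat p).
Proof.
elim: n p => [//|n IH] p; split => [x|].
  by have H := is_derive_flat p x; exact: ex_derive.
rewrite (_ : derive1 _ = flat ('X ^+ 2 * (p - p^`()))); first exact: IH.
by apply/funext => x; rewrite derive1E; have H := is_derive_flat p x; exact: derive_val.
Qed.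

(** A test function for each [n]; these converge boundedly to the indicator of
    [`]a, b[], whence [test_function_separate]. *)
Definition bump (a b : R) (n : nat) (x : R) : R :=
  flat 1 (n.+1%:R * x + - (n.+1%:R * a)) * flat 1 (- n.+1%:R * x + n.+1%:R * b).

Lemma bumpE a b n x :
  bump a b n x = flat 1 (n.+1%:R * (x - a)) * flat 1 (n.+1%:R * (b - x)).
Proof. by rewrite /bump; congr (flat 1 _ * flat 1 _); ring. Qed.

Lemma flat1E x : flat 1 x = if 0 < x then expR (- x^-1) else 0.
Proof. by rewrite /flat hornerC mul1r. Qed.

Lemma flat1_itv x : 0 <= flat 1 x <= 1.
Proof.
rewrite flat1E; case: ifPn => [x0|_]; last by rewrite lexx ler01.
by rewrite expR_ge0/= expR_le1 oppr_le0 invr_ge0 ltW.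
Qed.

Lemma bump_out a b n x : x \notin `]a, b[ -> bump a b n x = 0.
Proof.
move=> xab; have n0 : 0 < n.+1%:R :> R by rewrite ltr0n.
rewrite bumpE; have [ax|xa] := ltP a x; last first.
  by rewrite flat1E pmulr_rgt0// subr_gt0 ltNge xa mul0r.
have bx : b <= x by rewrite leNgt; apply: contra xab => xb; rewrite in_itv/= ax.
by rewrite [X in _ * X]flat1E pmulr_rgt0// subr_gt0 ltNge bx mulr0.
Qed.

Lemma bump_itv a b n x : 0 <= bump a b n x <= 1.
Proof.
rewrite /bump; have /andP[A B] := flat1_itv (n.+1%:R * x + - (n.+1%:R * a)).
have /andP[C D] := flat1_itv (- n.+1%:R * x + n.+1%:R * b).
by rewrite mulr_ge0// mulr_ile1.
Qed.

Lemma test_function_bump a b n : test_function (bump a b n).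
Proof.
split.
  by apply/smoothP => k; apply: diff_timesM; apply: diff_times_affine; exact: diff_times_flat.
exists (`|a| + `|b|) => x abx; apply: bump_out; apply: contraTN abx.
rewrite in_itv/= -leNgt => /andP[ax xb]; rewrite ler_norml; apply/andP; split.
  by have := ler_norm (- a); rewrite normrN; have := normr_ge0 b; lra.
by have := ler_norm b; have := normr_ge0 a; lra.
Qed.

Lemma cvg_flat1 (y : R) :
  0 < y -> flat 1 (n.+1%:R * y) @[n --> \oo] --> (1 : R).
Proof.
move=> y0.
have -> : (fun n => flat 1 (n.+1%:R * y)) = (fun n => expR (- (y^-1 * n.+1%:R^-1))).
  by apply/funext => n; rewrite flat1E pmulr_rgt0 ?ltr0n// y0 invfM mulrC.
have H : - (y^-1 * n.+1%:R^-1) @[n --> \oo] --> (0 : R).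
  rewrite -oppr0; apply: cvgN.
  by have := cvgM (cvg_cst y^-1) (@cvg_harmonic R); rewrite mulr0; exact.
by rewrite -[X in _ --> X]expR0; apply: continuous_cvg; [exact: continuous_expR|exact: H].
Qed.

Lemma cvg_bump a b x : x \in `]a, b[ -> bump a b n x @[n --> \oo] --> (1 : R).
Proof.
rewrite in_itv/= => /andP[ax xb]; rewrite -[X in _ --> X](mulr1 1).
under eq_fun do rewrite bumpE.
by apply: cvgM; apply: cvg_flat1; rewrite subr_gt0.
Qed.

Lemma test_function_continuous f : test_function f -> continuous f.
Proof.
move=> [sf _] x; apply: differentiable_continuous; apply/derivable1_diffP.
exact: (sf 0%N).
Qed.

Lemma test_function_derive f : test_function f -> test_function (derive1 f).
Proof.
move=> [sf [a fa]]; split; first by move=> n x; rewrite -derive1Sn; exact: sf.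
exists a => x ax; rewrite derive1E.
suff H : \near x, f x = cst 0 x by rewrite (near_eq_derive _ H) derive_cst.
near=> y.
apply: fa; near: y.
have : `|y| @[y --> x] --> `|x| by apply: cvg_norm; exact: cvg_id.
by move/cvgr_gt; apply.
Unshelve. all: by end_near. Qed.

Lemma test_function_bounded f : test_function f ->
  exists2 a, forall x, a < `|x| -> f x = 0 & exists2 M, 0 <= M & forall x, `|f x| <= M.
Proof.
move=> tf; have cf := test_function_continuous tf; case: (tf) => _ [a fa].
exists a => //.
have [||c cI] := @EVT_max R (fun x => `|f x|) (- `|a|) `|a|.
- by have := normr_ge0 a; lra.
- by apply: continuous_subspaceT => x; apply: cvg_norm; exact: cf.
move=> fM; exists `|f c| => // x.
have [xa|ax] := leP `|x| `|a|.
  by apply: fM; rewrite in_itv/= -ler_norml.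
by rewrite fa ?normr0// (le_lt_trans (ler_norm _) ax).
Qed.

End SmoothFunctions.

Section FundamentalLemma.
Context {R : realType}.
Local Notation mu := (@lebesgue_measure R).
Implicit Types (f g q : R -> R).

Lemma test_function_Int (psi : R -> R) : test_function psi -> Int psi.
Proof.
move=> tpsi; have [a pa [M M0 pM]] := test_function_bounded tpsi.
have mpsi : measurable_fun setT psi.
  by apply: continuous_measurable_fun; exact: test_function_continuous.
apply: (@Int_le _ _ (fun x => M * \1_(`[- a, a]) x)) => //.
  move=> x; rewrite indicE; case: (boolP (x \in _)) => [_|]; first by rewrite mulr1.
  rewrite mem_setE in_itv/= -ler_norml -ltNge => /pa ->.
  by rewrite normr0 mulr0.
exact/IntZl/integrable_indic_itv.
Qed.

Lemma test_function_L2 (psi : R -> R) : test_function psi -> psi \in L2.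
Proof.
move=> tpsi; have [a pa [M M0 pM]] := test_function_bounded tpsi.
have Ip := test_function_Int tpsi; have mpsi := Int_mfun Ip.
apply/L2P; split=> //; apply: (Int_le _ _ (IntZl M (Int_norm Ip))).
  exact: measurable_funX.
by move=> x; rewrite normrX expr2 ler_wpM2r.
Qed.

Definition loc_Int q := measurable_fun setT q /\
  forall a b, Int (fun x => q x * \1_(`[a, b]) x).

Lemma loc_Int_itv q a b : loc_Int q -> mu.-integrable `[a, b] (EFin \o q).
Proof.
move=> [_ lq]; apply/integrable_mkcond => //.
have := lq a b; apply: eq_integrable => // x _.
by rewrite /= patchE indicE; case: ifPn => _; rewrite ?mulr1 ?mulr0.
Qed.

Lemma loc_IntP q : loc_Int q <-> locally_integrable setT q.
Proof.
split=> [lq|[mq _ lq]].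
  split=> //; [exact: lq.1|exact: openT|].
  move=> K _ /[dup] cK /compact_bounded[M [_ HM]].
  pose N := `|M| + 1.
  have KN : K `<=` `[- N, N].
    by move=> x Kx; rewrite /= in_itv/= -ler_norml; apply: HM => //; rewrite /N ltr_pwDr// ler_norm.
  have mK : measurable K by exact: compact_measurable.
  have /integrableP[_] := loc_Int_itv (- N) N lq.
  apply: le_lt_trans; apply: ge0_subset_integral => //=.
  apply/measurable_EFinP; apply: measurableT_comp => //.
  apply: measurable_funTS; exact: lq.1.
split=> // a b.
have I : mu.-integrable `[a, b] (EFin \o q).
  apply/integrableP; split; first by apply/measurable_EFinP; exact: measurable_funTS.
  by apply: lq; [exact: subsetT|exact: segment_compact].
have /integrable_mkcond : mu.-integrable `[a, b] (EFin \o q) := I.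
move=> H; have {H} := H (measurable_itv _); apply: eq_integrable => // x _.
by rewrite /= patchE indicE; case: ifPn => _; rewrite ?mulr1 ?mulr0.
Qed.

(** Passing to the limit in the bumps kills the integral of [q] over every interval;
    [q] vanishes at its Lebesgue points. *)
Lemma test_function_separate q : loc_Int q ->
  (forall chi, test_function chi -> \int[mu]_x (q x * chi x) = 0) ->
  {ae mu, forall x, q x = 0}.
Proof.
move=> lq q0; have mq := lq.1.
have Iq a b := loc_Int_itv a b lq.
have locq := (loc_IntP q).1 lq.
have I a b : a < b -> \int[mu]_x (q x * \1_(`]a, b[) x) = 0.
  move=> ab.
  have [|||||_ C] := @int_DC R (fun n x => q x * bump a b n x)
      (fun x => q x * \1_(`]a, b[) x) (fun x => `|q x * \1_(`[a, b]) x|).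
  - move=> n; apply: measurable_funM => //; apply: continuous_measurable_fun.
    exact/test_function_continuous/test_function_bump.
  - by apply: measurable_funM => //; exact: measurable_indic.
  - apply: aeW => x; apply: cvgM; first exact: cvg_cst.
    rewrite indicE mem_setE; case: (boolP (x \in _)) => xab; first exact: cvg_bump.
    by under eq_fun do rewrite bump_out//; exact: cvg_cst.
  - apply: aeW => x n; rewrite normrM [leRHS]normrM ler_wpM2l// indicE mem_setE.
    case: (boolP (x \in `[a, b])) => xab.
      by have /andP[A B] := bump_itv a b n x; rewrite normr1 ger0_norm.
    rewrite bump_out ?normr0//; apply: contra xab; exact: subset_itv_oo_cc.
  - exact: (Int_norm (lq.2 a b)).
  have E : (fun n => \int[mu]_x (q x * bump a b n x)) = (fun=> 0).
    by apply/funext => n; rewrite q0//; exact: test_function_bump.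
  rewrite E in C.
  exact: (cvg_unique _ C (cvg_cst _)).
have J a b : a < b -> \int[mu]_(x in `[a, b]) q x = 0.
  move=> ab; have Iab := Iq a b; rewrite -Rintegral_itv_obnd_cbnd; last first.
    by apply: integrableS Iab => //; exact: subset_itv_oc_cc.
  rewrite -Rintegral_itv_bndo_bndc; last first.
    by apply: integrableS Iab => //; exact: subset_itv_oo_cc.
  rewrite Rintegral_mkcond -[RHS](I _ _ ab); apply: eq_int => x.
  by rewrite patchE indicE; case: ifPn => _; rewrite ?mulr1 ?mulr0.
suff H n : {ae mu, forall x, - n%:R < x -> q x = 0}.
  have := ae_foralln H; apply: aeS => x Hx.
  apply: (Hx (Num.bound `|x|)).
  by rewrite ltrNl (le_lt_trans (ler_norm _))// normrN archi_boundP.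
have := @FTC1 R q (BLeft (- n%:R)) (fun y => Iq _ y) locq.
apply: aeS => x Hx nx.
have [|_ <-] := Hx; first by rewrite (@lte_fin R) ?ltW.
rewrite derive1E; set F : R -> R := fun y => _.
suff H : \near x, F x = cst 0 x by rewrite (near_eq_derive _ H) derive_cst.
near=> y; rewrite /F; apply: J; near: y; exact: lt_nbhsr.
Unshelve. all: by end_near. Qed.

End FundamentalLemma.

(** * The Hartley transform of summable functions *)
Section Exponentials.
Context {R : realType}.
Local Notation mu := (@lebesgue_measure R).
Implicit Types (f g F : R -> R) (w x y z l e : R).

Lemma Int_patch (D : set R) f : measurable D ->
  mu.-integrable D (EFin \o f) <-> Int (f \_ D).
Proof.
move=> mD; have E : (EFin \o f) \_ D = EFin \o (f \_ D).
  by apply/funext => x; rewrite /= !patchE; case: ifP.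
by rewrite /Int -E; exact: (@integrable_mkcond _ _ R mu D (EFin \o f) mD).
Qed.

Lemma int_FTC_halfline f F l : continuous f -> (forall x, is_derive x 1 F (f x)) ->
  F x @[x --> +oo] --> l -> Int (f \_ `[0, +oo[) ->
  \int[mu]_x (f \_ `[0, +oo[) x = l - F 0.
Proof.
move=> cf dF Fl If.
have cF : continuous F.
  by move=> x; apply: differentiable_continuous; apply/derivable1_diffP; exact: ex_derive.
have E n : \int[mu]_x (f \_ `[0, n.+1%:R]) x = F n.+1%:R - F 0.
  rewrite -Rintegral_mkcond /Rintegral (@continuous_FTC2 _ f F)//.
  - exact: continuous_subspaceT.
  - split; first by move=> x _; exact: ex_derive.
    + by apply: cvg_at_right_filter; exact: cF.
    + by apply: cvg_at_left_filter; exact: cF.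
  - by move=> x _; rewrite derive1E; exact: derive_val.
have [|||||_] := @int_DC R (fun n => f \_ `[0, n.+1%:R]) (f \_ `[0, +oo[)
   (fun x => `|(f \_ `[0, +oo[) x|).
- move=> n; apply/(measurable_restrictT f) => //; apply: measurable_funTS.
  exact: continuous_measurable_fun.
- exact: Int_mfun.
- apply: aeW => x; apply: (@cvg_near_cst _ _ _ _ _ _ _).
  near=> n; rewrite !patchE !mem_setE !in_itv/= andbT.
  suff -> : x <= n.+1%:R by rewrite andbT.
  rewrite (le_trans (ler_norm _))//.
  apply: (@le_trans _ _ (n%:R)); last by rewrite ler_nat.
  by near: n; exact: nbhs_infty_ger.
- apply: aeW => x n; rewrite !patchE !mem_setE !in_itv/= andbT.
  by case: (0 <= x) => //=; case: ifP => // _; rewrite normr0.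
- exact: Int_norm.
under eq_fun do rewrite E.
move=> H; apply: (cvg_unique _ H); first exact: Rhausdorff.
apply: cvgB; last exact: cvg_cst.
have := (cvg_pinftyP F l).1 Fl (fun n => n.+1%:R); apply.
apply/cvgryPge => A; near=> n.
apply: (@le_trans _ _ n%:R); last by rewrite ler_nat.
by near: n; exact: nbhs_infty_ger.
Unshelve. all: by end_near. Qed.

Lemma is_derive_cos_scale w x : is_derive x 1 (fun y : R => cos (w * y)) (- (w * sin (w * x))).
Proof.
have A : is_derive x 1 (fun y : R => w * y) w.
  by have := is_derive_affine w 0 x; under eq_fun do rewrite addr0.
have H := @is_derive1_comp R (@cos R) (fun y => w * y) x _ _ (is_derive_cos _) A.
by apply: (is_derive_eq H); ring.
Qed.

Lemma is_derive_sin_scale w x : is_derive x 1 (fun y : R => sin (w * y)) (w * cos (w * x)).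
Proof.
have A : is_derive x 1 (fun y : R => w * y) w.
  by have := is_derive_affine w 0 x; under eq_fun do rewrite addr0.
have H := @is_derive1_comp R (@sin R) (fun y => w * y) x _ _ (is_derive_sin _) A.
by apply: (is_derive_eq H); ring.
Qed.

Lemma is_derive_expR_scale w x : is_derive x 1 (fun y : R => expR (w * y)) (w * expR (w * x)).
Proof.
have A : is_derive x 1 (fun y : R => w * y) w.
  by have := is_derive_affine w 0 x; under eq_fun do rewrite addr0.
have H := @is_derive1_comp R (@expR R) (fun y => w * y) x _ _ (is_derive_expR _) A.
by apply: (is_derive_eq H); ring.
Qed.

Lemma cvgy_expRN l : 0 < l -> expR (- l * x) @[x --> +oo] --> (0 : R).
Proof.
move=> l0; apply/cvgrPdist_lt => e e0; near=> x.
rewrite sub0r normrN ger0_norm ?expR_ge0// -[ltRHS]lnK ?posrE// ltr_expR mulNr ltrNl.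
rewrite -ltr_pdivrMl//; near: x; apply: nbhs_pinfty_gt; exact: num_real.
Unshelve. all: by end_near. Qed.

(** The one-sided exponentials are the building blocks both of the Poisson kernel and of
    the kernels [x^(s-1)]. *)
Definition exph l x : R := ((fun x => expR (- l * x)) \_ `[0, +oo[) x.

Lemma exphE l x : exph l x = if 0 <= x then expR (- l * x) else 0.
Proof. by rewrite /exph patchE mem_setE in_itv/= andbT. Qed.

Lemma exph_ge0 l x : 0 <= exph l x.
Proof. by rewrite exphE; case: ifP => // _; exact: expR_ge0. Qed.

Lemma continuous_scale w : continuous (fun x : R => w * x).
Proof. by move=> x; apply: cvgM; [exact: cvg_cst|exact: cvg_id]. Qed.

Lemma continuous_expR_scale l : continuous (fun x : R => expR (l * x)).
Proof.
move=> x; apply: (continuous_comp (continuous_scale (w:=l) (x:=x))).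
exact: continuous_expR.
Qed.

Lemma continuous_cos_scale l : continuous (fun x : R => cos (l * x)).
Proof.
move=> x; apply: (continuous_comp (continuous_scale (w:=l) (x:=x))).
exact: continuous_cos.
Qed.

Lemma continuous_sin_scale l : continuous (fun x : R => sin (l * x)).
Proof.
move=> x; apply: (continuous_comp (continuous_scale (w:=l) (x:=x))).
exact: continuous_sin.
Qed.

Lemma is_derive_cst_scale (c df x : R) F : is_derive x 1 F df ->
  is_derive x 1 (fun y => c * F y) (c * df).
Proof. by move=> H; have := is_deriveZ c H. Qed.

Lemma Int_exph l : 0 < l -> Int (exph l).
Proof.
move=> l0; suff H : mu.-integrable `[0, +oo[ (EFin \o (fun x => expR (- l * x))).
  exact: ((@Int_patch _ (fun x => expR (- l * x)) (measurable_itv _)).1 H).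
apply/integrableP; split.
  apply/measurable_EFinP; apply: measurable_funTS; apply: continuous_measurable_fun.
  exact: continuous_expR_scale.
have D x : is_derive x 1 (fun y : R => - l^-1 * expR (- l * y)) (expR (- l * x)).
  apply: (is_derive_eq (is_derive_cst_scale (- l^-1) (is_derive_expR_scale (- l) x))).
  by field; rewrite gt_eqF.
have -> : (\int[mu]_(x in `[0%R, +oo[) `|(EFin \o (fun x => expR (- l * x))) x| =
          \int[mu]_(x in `[0%R, +oo[) (expR (- l * x))%:E)%E.
  by apply: eq_integral => x _; rewrite /= ger0_norm// expR_ge0.
rewrite (@ge0_continuous_FTC2y _ _ (fun y : R => - l^-1 * expR (- l * y)) 0 0).
- by rewrite -EFinB ltry.
- by move=> x _; exact: expR_ge0.
- exact/continuous_subspaceT/continuous_expR_scale.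
- rewrite -[X in _ --> X](mulr0 (- l^-1)); apply: cvgM; first exact: cvg_cst.
  exact: cvgy_expRN.
- by move=> x _; exact: ex_derive.
- apply: cvg_at_right_filter; apply: cvgM; first exact: cvg_cst.
  exact: continuous_expR_scale.
- by move=> x _; rewrite derive1E; exact: derive_val.
Qed.

Lemma sqrD_gt0 l w : 0 < l -> 0 < l ^+ 2 + w ^+ 2.
Proof. by move=> l0; rewrite ltr_pwDl ?sqr_ge0// exprn_gt0. Qed.

Lemma Int_bounded_mul f g (M : R) : measurable_fun setT f ->
  (forall x, `|f x| <= M) -> Int g -> Int (fun x => f x * g x).
Proof.
move=> mf fM Ig; apply: (Int_le _ _ (IntZl M (Int_norm Ig))).
  by apply: measurable_funM => //; exact: Int_mfun.
by move=> x; rewrite normrM ler_wpM2r.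
Qed.

Lemma abs_cos_le1 x : `|cos x| <= 1.
Proof. by rewrite ler_norml cos_geN1 cos_le1. Qed.

Lemma abs_sin_le1 x : `|sin x| <= 1.
Proof. by rewrite ler_norml sin_geN1 sin_le1. Qed.

Lemma cvgy_bounded_expRN l f (M : R) : 0 < l -> (forall x, `|f x| <= M) ->
  f x * expR (- l * x) @[x --> +oo] --> (0 : R).
Proof.
move=> l0 fM; apply: norm_cvg0.
have := @squeeze_cvgr _ _ _ _ (fun=> 0) (fun x => M * expR (- l * x))
  (fun x => `|f x * expR (- l * x)|) _ 0; apply.
- apply: nearW => x; rewrite normr_ge0/= normrM (ger0_norm (expR_ge0 _)).
  by rewrite ler_wpM2r// expR_ge0.
- exact: cvg_cst.
- rewrite -[X in _ --> X](mulr0 M); apply: cvgM; first exact: cvg_cst.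
  exact: cvgy_expRN.
Qed.

Lemma measurable_cos_scale w : measurable_fun setT (fun x : R => cos (w * x)).
Proof. by apply: continuous_measurable_fun; exact: continuous_cos_scale. Qed.

Lemma measurable_sin_scale w : measurable_fun setT (fun x : R => sin (w * x)).
Proof. by apply: continuous_measurable_fun; exact: continuous_sin_scale. Qed.

(** The cosine and sine transforms of the one-sided exponential, taken together
    because integration mixes them. *)
Let int_trig_exph (a b l w : R) : 0 < l ->
  \int[mu]_x ((a * cos (w * x) + b * sin (w * x)) * exph l x) =
  (a * l + b * w) / (l ^+ 2 + w ^+ 2).
Proof.
move=> l0; have D0 := sqrD_gt0 w l0.
pose t x := a * cos (w * x) + b * sin (w * x).
pose f x := t x * expR (- l * x).
pose p := a * w - b * l; pose q := - (a * l + b * w).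
(* [g x exp(-l x)] is the antiderivative of [f]. *)
pose g x := (l ^+ 2 + w ^+ 2)^-1 * (p * sin (w * x) + q * cos (w * x)).
have E x : t x * exph l x = (f \_ `[0, +oo[) x.
  by rewrite /exph !patchE; case: ifP => //; rewrite mulr0.
have trig_le (c d x : R) : `|c * cos (w * x) + d * sin (w * x)| <= `|c| + `|d|.
  apply: (le_trans (ler_normD _ _)); rewrite !normrM.
  by apply: lerD; rewrite ler_piMr// ?abs_cos_le1 ?abs_sin_le1.
have ct : continuous t.
  by move=> x; apply: cvgD; apply: cvgM;
    [exact: cvg_cst|exact: continuous_cos_scale|exact: cvg_cst|exact: continuous_sin_scale].
have If : Int (f \_ `[0, +oo[).
  rewrite -(funext E); apply: (Int_bounded_mul (continuous_measurable_fun ct) (trig_le a b)).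
  exact: Int_exph.
rewrite (eq_int E); transitivity (0 - g 0 * expR (- l * 0)); last first.
  by rewrite /g /p /q !mulr0 sin0 cos0 expR0; field; rewrite gt_eqF.
refine (@int_FTC_halfline f (fun x => g x * expR (- l * x)) 0 _ _ _ If).
- by move=> x; apply: cvgM; [exact: ct|exact: continuous_expR_scale].
- move=> x; have Dg : is_derive x 1 g ((l ^+ 2 + w ^+ 2)^-1 *
      (p * (w * cos (w * x)) + q * - (w * sin (w * x)))).
    exact: (is_derive_cst_scale _ (is_deriveD
      (is_derive_cst_scale p (is_derive_sin_scale w x)) (is_derive_cst_scale q (is_derive_cos_scale w x)))).
  apply: (is_derive_eq (is_deriveM Dg (is_derive_expR_scale (- l) x))).
  by rewrite /f /t /g /p /q /GRing.scale/=; field; rewrite gt_eqF.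
- apply: (@cvgy_bounded_expRN _ _ ((l ^+ 2 + w ^+ 2)^-1 * (`|q| + `|p|))) => // x.
  rewrite /g normrM gtr0_norm ?invr_gt0// ler_pM2l ?invr_gt0//.
  by rewrite addrC; exact: trig_le.
Qed.

Lemma int_cos_exph l w : 0 < l ->
  \int[mu]_x (cos (w * x) * exph l x) = l / (l ^+ 2 + w ^+ 2).
Proof.
move=> l0; have := int_trig_exph 1 0 w l0; rewrite mul1r mul0r addr0 => <-.
by apply: eq_int => x; rewrite mul1r mul0r addr0.
Qed.

Lemma int_sin_exph l w : 0 < l ->
  \int[mu]_x (sin (w * x) * exph l x) = w / (l ^+ 2 + w ^+ 2).
Proof.
move=> l0; have := int_trig_exph 0 1 w l0; rewrite mul1r mul0r add0r => <-.
by apply: eq_int => x; rewrite mul1r mul0r add0r.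
Qed.

End Exponentials.

Section Hartley.
Context {R : realType}.
Local Notation mu := (@lebesgue_measure R).
Implicit Types (f g v w : R -> R) (x y z xi e : R).

Lemma int_refl f : Int f -> \int[mu]_x f (- x) = \int[mu]_x f x.
Proof.
move=> If; have N0 : (-1 : R) != 0 by rewrite oppr_eq0.
rewrite (int_affine 0 N0 If) normrN1 mul1r.
by apply: eq_int => x; rewrite mulN1r addr0.
Qed.

Lemma Int_refl f : Int f -> Int (fun x => f (- x)).
Proof.
move=> If; have N0 : (-1 : R) != 0 by rewrite oppr_eq0.
have := Int_affine 0 N0 If; congr Int.
by apply/funext => x; rewrite mulN1r addr0.
Qed.

Lemma L2_refl f : f \in L2 -> (fun x => f (- x)) \in L2.
Proof.
move=> If; have N0 : (-1 : R) != 0 by rewrite oppr_eq0.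
have := L2_affine 0 N0 If.
have -> // : (fun x => f (-1 * x + 0)) = (fun x => f (- x)).
by apply/funext => x; rewrite mulN1r addr0.
Qed.

Lemma int_sub x f : Int f -> \int[mu]_y f (x - y) = \int[mu]_y f y.
Proof.
move=> If; have N0 : (-1 : R) != 0 by rewrite oppr_eq0.
rewrite (int_affine x N0 If) normrN1 mul1r.
by apply: eq_int => y; rewrite mulN1r addrC.
Qed.

Lemma Int_sub x f : Int f -> Int (fun y => f (x - y)).
Proof.
move=> If; have N0 : (-1 : R) != 0 by rewrite oppr_eq0.
have := Int_affine x N0 If; congr Int.
by apply/funext => y; rewrite mulN1r addrC.
Qed.

Lemma int_shift x f : Int f -> \int[mu]_y f (y - x) = \int[mu]_y f y.
Proof.
move=> If; rewrite (int_affine (- x) (oner_neq0 R) If) normr1 mul1r.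
by apply: eq_int => y; rewrite mul1r.
Qed.

Lemma Int_shift x f : Int f -> Int (fun y => f (y - x)).
Proof.
move=> If; have := Int_affine (- x) (oner_neq0 R) If; congr Int.
by apply/funext => y; rewrite mul1r.
Qed.

Lemma measurable_fun_refl f : measurable_fun setT f ->
  measurable_fun setT (fun x => f (- x)).
Proof. by move=> mf; apply: (measurableT_comp mf); apply: continuous_measurable_fun; exact: opp_continuous. Qed.

Lemma ae_neq0 : {ae mu, forall x : R, x != 0}.
Proof.
exists [set 0]; split => //; first exact: lebesgue_measure_set1.
by move=> x /= /negP; rewrite negbK => /eqP.
Qed.

(** The two-sided exponential and its cosine transform, the Poisson kernel. *)
Definition expa e xi : R := expR (- e * `|xi|).

Definition poisson e z : R := 2 * e / (e ^+ 2 + (2 * pi * z) ^+ 2).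

Lemma continuous_expa e : continuous (expa e).
Proof.
move=> x; apply: (@continuous_comp _ _ _ (fun y : R => `|y|) (fun y => expR (- e * y))).
  exact: norm_continuous.
exact: continuous_expR_scale.
Qed.

Lemma measurable_expa e : measurable_fun setT (expa e).
Proof. by apply: continuous_measurable_fun; exact: continuous_expa. Qed.

Lemma expa_exph e : {ae mu, forall xi, exph e xi + exph e (- xi) = expa e xi}.
Proof.
apply: aeS ae_neq0 => x; rewrite neq_lt !exphE /expa oppr_ge0 => /orP[x0|x0].
  by rewrite leNgt x0/= add0r ltW// ltr0_norm.
by rewrite (ltW x0) leNgt x0/= addr0 gtr0_norm.
Qed.

Lemma Int_expa e : 0 < e -> Int (expa e).
Proof.
move=> e0; apply: (Int_ae_eq _ (expa_exph e)); first exact: measurable_expa.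
by apply: IntD; [|apply: Int_refl]; exact: Int_exph.
Qed.

Lemma int_expa_split e f : 0 < e -> measurable_fun setT f ->
  (forall x, `|f x| <= 1) ->
  \int[mu]_x (f x * expa e x) =
  \int[mu]_x (f x * exph e x) + \int[mu]_x (f (- x) * exph e x).
Proof.
move=> e0 mf f1.
have I1 : Int (fun x => f x * exph e x) by apply: Int_bounded_mul f1 _ => //; exact: Int_exph.
have mfr := measurable_fun_refl mf.
have I2 : Int (fun x => f (- x) * exph e x).
  by apply: (Int_bounded_mul mfr (fun x => f1 _)); exact: Int_exph.
rewrite -(int_refl I2) -intD//; last exact: Int_refl I2.
apply: int_ae_eq.
- by apply: measurable_funM => //; exact: measurable_expa.
- by apply: Int_mfun; apply: IntD => //; exact: Int_refl I2.
- by apply: aeS (expa_exph e) => x <-; rewrite opprK mulrDr.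
Qed.

Lemma int_cos_expa e z : 0 < e ->
  \int[mu]_xi (cos (2 * pi * z * xi) * expa e xi) = poisson e z.
Proof.
move=> e0; rewrite int_expa_split//.
- rewrite int_cos_exph//.
  under [X in _ + X]eq_int do rewrite mulrN cosN.
  by rewrite int_cos_exph// /poisson; field; rewrite gt_eqF// sqrD_gt0.
- by apply: continuous_measurable_fun; exact: continuous_cos_scale.
- by move=> x; exact: abs_cos_le1.
Qed.

Lemma int_sin_expa e z : 0 < e ->
  \int[mu]_xi (sin (2 * pi * z * xi) * expa e xi) = 0.
Proof.
move=> e0; rewrite int_expa_split//.
- under [X in _ + X]eq_int do rewrite mulrN sinN mulNr.
  rewrite intN ?subrr//; apply: (Int_bounded_mul _ (fun x => abs_sin_le1 _)).
    by apply: continuous_measurable_fun; exact: continuous_sin_scale.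
  exact: Int_exph.
- by apply: continuous_measurable_fun; exact: continuous_sin_scale.
- by move=> x; exact: abs_sin_le1.
Qed.

End Hartley.

Section Hartley.
Context {R : realType}.
Local Notation mu := (@lebesgue_measure R).
Implicit Types (f g v w : R -> R) (x y z xi e : R).

Lemma twopi_gt0 : 0 < 2 * pi :> R.
Proof. by rewrite mulr_gt0// pi_gt0. Qed.

Lemma poisson_ge0 e z : 0 < e -> 0 <= poisson e z.
Proof. by move=> e0; rewrite divr_ge0 ?mulr_ge0// ?ltW// sqrD_gt0. Qed.

Lemma poisson_scale e z : 0 < e -> e * poisson e (e * z + 0) = poisson 1 z.
Proof.
move=> e0; rewrite /poisson.
have -> : e ^+ 2 + (2 * pi * (e * z + 0)) ^+ 2 = e ^+ 2 * (1 ^+ 2 + (2 * pi * z) ^+ 2).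
  by ring.
have D1 := sqrD_gt0 (2 * pi * z) (ltr01 : 0 < (1 : R)).
by move: D1; set D := _ + _ => D1; field; rewrite !gt_eqF.
Qed.

Lemma measurable_poisson e : 0 < e -> measurable_fun setT (poisson e).
Proof.
move=> e0; apply: continuous_measurable_fun => x; apply: cvgM; first exact: cvg_cst.
apply: cvgV; first by rewrite gt_eqF// sqrD_gt0.
apply: cvgD; first exact: cvg_cst.
by apply: (@continuous_comp _ _ _ (fun x : R => 2 * pi * x) (fun y => y ^+ 2)); [exact: continuous_scale|exact: exprn_continuous].
Qed.

Let h x : R := (1 + x ^+ 2)^-1.

Let Int_h : Int h /\ \int[mu]_x h x = pi.
Proof.
have ch : continuous h := @continuous_oneDsqrV R.
have h0 x : 0 <= h x by rewrite invr_ge0 addr_ge0 ?sqr_ge0.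
have E : (\int[mu]_x (h x)%:E = (pi : R)%:E)%E.
  rewrite (ge0_symfun_integralT h0 ch); last by move=> x; rewrite /h /= sqrrN.
  rewrite -set_itvcy; have := @integral0y_oneDsqr R => ->.
  by rewrite -EFinM; congr EFin; field.
have Ih : Int h.
  by apply/Int_ge0P => //; [exact: continuous_measurable_fun|rewrite E ltry].
by split=> //; apply: EFin_inj; rewrite -EFin_int.
Qed.

Lemma poisson_h e z : 0 < e -> poisson e z = 2 / e * h (2 * pi / e * z + 0).
Proof.
move=> e0; have := lt0r_neq0 e0 => en0.
rewrite addr0 /poisson /h; have D := sqrD_gt0 (2 * pi * z) e0.
have -> : 1 + (2 * pi / e * z) ^+ 2 = (e ^+ 2 + (2 * pi * z) ^+ 2) / e ^+ 2 by field.
by move: D; set D := e ^+ 2 + _ => D0; field; rewrite en0 gt_eqF.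
Qed.

Lemma Int_poisson e : 0 < e -> Int (poisson e).
Proof.
move=> e0; have [Ih _] := Int_h.
have c0 : 2 * pi / e != 0 :> R by rewrite gt_eqF// divr_gt0// twopi_gt0.
have := IntZl (2 / e) (Int_affine 0 c0 Ih); congr Int; apply/funext => x.
by rewrite -poisson_h.
Qed.

Lemma int_poisson e : 0 < e -> \int[mu]_z poisson e z = 1.
Proof.
move=> e0; have [Ih hpi] := Int_h.
have cp : 0 < 2 * pi / e :> R by rewrite divr_gt0// twopi_gt0.
have c0 := lt0r_neq0 cp.
rewrite (eq_int (fun z => poisson_h z e0)) intZl; last exact: Int_affine.
have := int_affine 0 c0 Ih; rewrite hpi gtr0_norm// => E.
set I := Rintegral _ _ _ in E *.
apply: (mulfI (lt0r_neq0 (pi_gt0 R))); rewrite mulr1 [RHS]E; field.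
exact: lt0r_neq0.
Qed.

Definition cas x : R := cos x + sin x.

Lemma abs_cas_le2 x : `|cas x| <= 2.
Proof.
apply: (le_trans (ler_normD _ _)).
by have := abs_cos_le1 x; have := abs_sin_le1 x; lra.
Qed.

Lemma casD x y : cas (x + y) = cos y * cas x + sin y * cas (- x).
Proof. by rewrite /cas cosD sinD cosN sinN; ring. Qed.

Lemma cas_mul x y : cas x * cas y = cos (x - y) + sin (x + y).
Proof. by rewrite /cas cosB sinD; ring. Qed.

Lemma continuous_cas : continuous cas.
Proof. by move=> x; apply: cvgD; [exact: continuous_cos|exact: continuous_sin]. Qed.

Lemma measurable_cas : measurable_fun setT cas.
Proof. by apply: continuous_measurable_fun; exact: continuous_cas. Qed.

(** The real substitute for the Fourier transform: for real [w], [hartley w] carries the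
    same information, and it is its own inverse. *)
Definition hartley w xi : R := \int[mu]_x (cas (2 * pi * x * xi) * w x).

Lemma measurable_casl xi : measurable_fun setT (fun x => cas (2 * pi * x * xi)).
Proof.
apply: (measurableT_comp measurable_cas); apply: measurable_funM => //.
Qed.

Lemma Int_cas w xi : Int w -> Int (fun x => cas (2 * pi * x * xi) * w x).
Proof.
move=> Iw; apply: (Int_bounded_mul (measurable_casl xi) (fun x => abs_cas_le2 _) Iw).
Qed.

Lemma hartley_bound w xi : Int w -> `|hartley w xi| <= 2 * \int[mu]_x `|w x|.
Proof.
move=> Iw; apply: (le_trans (int_norm (Int_cas xi Iw))).
rewrite -intZl; last exact: Int_norm.
apply: int_le; [exact/Int_norm/Int_cas|exact/IntZl/Int_norm|].
by move=> x; rewrite normrM ler_wpM2r// abs_cas_le2.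
Qed.

Lemma continuous_hartley w : Int w -> continuous (hartley w).
Proof.
move=> Iw xi.
have := @continuity_under_integral R _ _ mu (fun xi x => cas (2 * pi * x * xi) * w x)
  setT measurableT (xi - 1) (xi + 1) _ _ (fun x => 2 * `|w x|) _ _ xi.
apply.
- by move=> y _; exact: Int_cas.
- apply: aeW => x _ y _; apply: cvgM; last exact: cvg_cst.
  apply: (@continuous_comp _ _ _ (fun y => 2 * pi * x * y)); first exact: continuous_scale.
  exact: continuous_cas.
- exact/IntZl/Int_norm.
- by move=> y _; apply: aeW => x _; rewrite normrM ler_wpM2r// abs_cas_le2.
- by rewrite inE/= in_itv/= ltrBlDr ltrDl ltr01.
Qed.

Lemma measurable_hartley w : Int w -> measurable_fun setT (hartley w).
Proof. by move=> Iw; apply: continuous_measurable_fun; exact: continuous_hartley. Qed.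

Lemma Int_hartley_mul w v : Int w -> Int v -> Int (fun xi => hartley w xi * v xi).
Proof.
move=> Iw Iv; apply: (Int_bounded_mul (measurable_hartley Iw) _ Iv) => xi.
exact: hartley_bound.
Qed.

Lemma measurable_cas2 : measurable_fun setT (fun p : R * R => cas (2 * pi * p.1 * p.2)).
Proof.
apply: (measurableT_comp measurable_cas); apply: measurable_funM; last exact: measurable_snd.
by apply: measurable_funM => //; exact: measurable_fst.
Qed.

(** The kernel is symmetric in [x] and [xi], and Fubini applies. *)
Lemma hartley_mulC w v : Int w -> Int v ->
  \int[mu]_xi (hartley w xi * v xi) = \int[mu]_x (w x * hartley v x).
Proof.
move=> Iw Iv.
pose F (p : R * R) := cas (2 * pi * p.1 * p.2) * w p.1 * v p.2.
have mF : measurable_fun setT F.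
  apply: measurable_funM; last exact: (measurableT_comp (Int_mfun Iv) measurable_snd).
  by apply: measurable_funM; [exact: measurable_cas2|exact: (measurableT_comp (Int_mfun Iw) measurable_fst)].
have [] := Fubini_package mF.
  apply: (@Fubini_majorant _ F (fun x xi => 2 * `|w x| * `|v xi|) mF).
    apply: aeW => x; split; first by apply: IntZl; exact: Int_norm.
    by move=> y; rewrite /F/= !normrM ler_wpM2r// ler_wpM2r// abs_cas_le2.
  under eq_fun do rewrite (intZl _ (Int_norm Iv)).
  by apply: IntZr; apply: IntZl; exact: Int_norm.
move=> _ _ _ _ E.
transitivity (\int[mu]_xi (\int[mu]_x F (x, xi))).
  by apply: eq_int => xi; rewrite /hartley -intZr//; exact: Int_cas.
rewrite -E; apply: eq_int => x; rewrite /hartley -intZl; last exact: Int_cas.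
apply: eq_int => y; rewrite /F/=; have -> : 2 * pi * y * x = 2 * pi * x * y by ring.
by ring.
Qed.

End Hartley.

Section HartleyContraction.
Context {R : realType}.
Local Notation mu := (@lebesgue_measure R).
Implicit Types (f g v w phi K : R -> R) (x y z xi e : R).

Lemma measurable_sub2 K : measurable_fun setT K ->
  measurable_fun setT (fun p : R * R => K (p.1 - p.2)).
Proof.
move=> mK; apply: (measurableT_comp mK).
by apply: measurable_funB; [exact: measurable_fst|exact: measurable_snd].
Qed.

(** The choice [g = 1] gives summability and the mass of a convolution, [g = cas] its
    transform. *)
Lemma convolution_pairing K phi g (M : R) : Int K -> Int phi ->
  measurable_fun setT g -> (forall x, `|g x| <= M) ->
  [/\ {ae mu, forall x, Int (fun y => K (x - y) * phi y)},
      Int (fun x => \int[mu]_y (K (x - y) * phi y)) &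
      \int[mu]_x ((\int[mu]_y (K (x - y) * phi y)) * g x) =
      \int[mu]_y (phi y * \int[mu]_x (K (x - y) * g x))].
Proof.
move=> IK Iphi mg gM; have mK := Int_mfun IK; have mphi := Int_mfun Iphi.
have M0 : 0 <= M by apply: le_trans (gM 0).
pose F g (p : R * R) := K (p.1 - p.2) * phi p.2 * g p.1.
have mF f : measurable_fun setT f -> measurable_fun setT (F f).
  move=> mf; apply: measurable_funM; last exact: (measurableT_comp mf measurable_fst).
  by apply: measurable_funM; [exact: measurable_sub2|exact: (measurableT_comp mphi measurable_snd)].
have FF f (N : R) : measurable_fun setT f -> (forall x, `|f x| <= N) ->
  (\int[mu]_x \int[mu]_y `|F f (x, y)|%:E < +oo)%E.
  move=> mf fN.
  have IKy y := Int_shift y (Int_norm IK).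
  apply: (@Fubini_majorant_swap _ (F f) (fun y x => N * `|phi y| * `|K (x - y)|)).
  - exact: mF.
  - apply: aeW => y; split; first by apply: IntZl; exact: IKy.
    move=> x; rewrite /F/= !normrM (mulrC (`|K _| * _)) [`|K _| * _]mulrC mulrA.
    by rewrite !ler_wpM2r.
  - have E y : \int[mu]_x (N * `|phi y| * `|K (x - y)|) =
        N * `|phi y| * \int[mu]_x `|K x|.
      by rewrite (intZl _ (IKy y)) (int_shift y (Int_norm IK)).
    by rewrite (funext E); apply: IntZr; apply: IntZl; exact: Int_norm.
have one1 : forall x : R, `|(1 : R)| <= 1 by move=> x; rewrite normr1.
have m1 : measurable_fun setT (fun _ : R => (1 : R)) by exact: measurable_cst.
have [ae1 _ I1 _ _] := Fubini_package (mF _ m1) (FF _ 1 m1 one1).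
have [ae2 _ I2 I3 E] := Fubini_package (mF _ mg) (FF _ M mg gM).
have H1 x y : F (fun=> 1) (x, y) = K (x - y) * phi y by rewrite /F mulr1.
have ae3 : {ae mu, forall x, Int (fun y => K (x - y) * phi y)}.
  by apply: aeS ae1 => x; rewrite (funext (H1 x)).
have I4 : Int (fun x => \int[mu]_y (K (x - y) * phi y)).
  have H x : \int[mu]_y F (fun=> 1) (x, y) = \int[mu]_y (K (x - y) * phi y).
    by apply: eq_int => y; exact: H1.
  by rewrite -(funext H).
split; [exact: ae3|exact: I4|].
transitivity (\int[mu]_x \int[mu]_y F g (x, y)).
  apply: int_ae_eq.
  - by apply: measurable_funM; [exact: Int_mfun I4|exact: mg].
  - exact: Int_mfun I2.
  - by apply: aeS ae3 => x Ix; rewrite -intZr.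
rewrite E; apply: eq_int => y; rewrite -intZl.
  by apply: eq_int => x; rewrite /F/=; ring.
under eq_fun do rewrite mulrC; apply: (Int_bounded_mul mg gM).
exact: Int_shift.
Qed.

Lemma Int_convolution K phi : Int K -> Int phi ->
  Int (fun x => \int[mu]_y (K (x - y) * phi y)).
Proof.
move=> IK Iphi; have one1 : forall x : R, `|(1 : R)| <= 1 by move=> x; rewrite normr1.
have m1 : measurable_fun setT (fun _ : R => (1 : R)) by exact: measurable_cst.
by have [] := convolution_pairing IK Iphi m1 one1.
Qed.

Lemma int_convolution K phi : Int K -> Int phi ->
  \int[mu]_x (\int[mu]_y (K (x - y) * phi y)) =
  (\int[mu]_x K x) * \int[mu]_y phi y.
Proof.
move=> IK Iphi; have one1 : forall x : R, `|(1 : R)| <= 1 by move=> x; rewrite normr1.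
have m1 : measurable_fun setT (fun _ : R => (1 : R)) by exact: measurable_cst.
have [_ _] := convolution_pairing IK Iphi m1 one1.
under eq_int do rewrite mulr1; move=> ->.
rewrite -intZl//; apply: eq_int => y; under eq_int do rewrite mulr1.
by rewrite int_shift// mulrC.
Qed.

(** Damping the transform by [exp(-e |xi|)] and transforming back amounts to
    convolving with the Poisson kernel. *)
Lemma hartley_expa_hartley v e x : Int v -> 0 < e ->
  hartley (fun xi => hartley v xi * expa e xi) x =
  \int[mu]_y (poisson e (x - y) * v y).
Proof.
move=> Iv e0; have Ie := Int_expa e0.
pose F (p : R * R) := cas (2 * pi * p.1 * x) * (cas (2 * pi * p.2 * p.1) * v p.2 * expa e p.1).
have mF : measurable_fun setT F.
  apply: measurable_funM; first exact: (measurableT_comp (measurable_casl x) measurable_fst).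
  apply: measurable_funM; last exact: (measurableT_comp (measurable_expa e) measurable_fst).
  apply: measurable_funM; last exact: (measurableT_comp (Int_mfun Iv) measurable_snd).
  apply: (measurableT_comp measurable_cas); apply: measurable_funM; last exact: measurable_fst.
  by apply: measurable_funM => //; exact: measurable_snd.
have [] := Fubini_package mF.
  apply: (@Fubini_majorant _ F (fun xi y => 4 * expa e xi * `|v y|) mF).
    apply: aeW => xi; split; first by apply: IntZl; exact: Int_norm.
    move=> y; rewrite /F/= !normrM (ger0_norm (expR_ge0 _)).
    have A := abs_cas_le2 (2 * pi * xi * x); have B := abs_cas_le2 (2 * pi * y * xi).
    have -> : 4 * expa e xi * `|v y| = 2 * (2 * `|v y| * expa e xi) by ring.
    by apply: ler_pM => //; rewrite ?ler_wpM2r ?mulr_ge0 ?expR_ge0.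
  under eq_fun do rewrite (intZl _ (Int_norm Iv)).
  by apply: IntZr; exact: IntZl.
move=> _ _ _ _ E.
transitivity (\int[mu]_xi (\int[mu]_y F (xi, y))).
  apply: eq_int => xi; rewrite /hartley -intZr; last exact: Int_cas.
  rewrite -intZl; first by apply: eq_int => y; rewrite /F.
  by apply: IntZr; exact: Int_cas.
rewrite E; apply: eq_int => y.
have Ic : Int (fun xi => cos (2 * pi * (x - y) * xi) * expa e xi).
  apply: Int_bounded_mul Ie; last by move=> ?; exact: abs_cos_le1.
  by apply: continuous_measurable_fun; exact: continuous_cos_scale.
have Is : Int (fun xi => sin (2 * pi * (x + y) * xi) * expa e xi).
  apply: Int_bounded_mul Ie; last by move=> ?; exact: abs_sin_le1.
  by apply: continuous_measurable_fun; exact: continuous_sin_scale.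
transitivity (\int[mu]_xi (v y * (cos (2 * pi * (x - y) * xi) * expa e xi + sin (2 * pi * (x + y) * xi) * expa e xi))).
  apply: eq_int => xi; rewrite /F/=.
  have -> : cas (2 * pi * xi * x) * (cas (2 * pi * y * xi) * v y * expa e xi) =
     v y * (cas (2 * pi * xi * x) * cas (2 * pi * y * xi) * expa e xi) by ring.
  rewrite cas_mul mulrDl; congr (_ * (cos _ * _ + sin _ * _)); ring.
rewrite intZl; last exact: (IntD Ic Is).
have E1 := int_cos_expa (x - y) e0; have E2 := int_sin_expa (x + y) e0.
rewrite (intD Ic Is) E1 E2 addr0.
exact: mulrC.
Qed.

Lemma poisson_le e z : 0 < e -> `|poisson e z| <= 2 / e.
Proof.
move=> e0; rewrite ger0_norm ?poisson_ge0// /poisson.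
rewrite ler_pdivrMr ?sqrD_gt0//.
have -> : 2 / e * (e ^+ 2 + (2 * pi * z) ^+ 2) = 2 * e + 2 / e * (2 * pi * z) ^+ 2.
  by field; rewrite gt_eqF.
by rewrite lerDl mulr_ge0 ?sqr_ge0// divr_ge0// ltW.
Qed.

Lemma Int_poisson_mul e x f : 0 < e -> Int f -> Int (fun y => poisson e (x - y) * f y).
Proof.
move=> e0 If; apply: (Int_bounded_mul _ (fun y => poisson_le _ e0) If).
apply: (measurableT_comp (measurable_poisson e0)).
by apply: measurable_funB.
Qed.

(** The left-hand side is the pairing of [w] with its Poisson average; the kernel has
    mass [1] and [|w x w y| <= (w x ^ 2 + w y ^ 2) / 2]. *)
Lemma hartley_damped_le w e : Int w -> w \in L2 -> 0 < e ->
  \int[mu]_xi (hartley w xi ^+ 2 * expa e xi) <= \int[mu]_x (w x ^+ 2).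
Proof.
move=> Iw Lw e0; have Ie := Int_expa e0; have I2 := L2_sqr Lw.
have IP := Int_poisson e0.
have IhE : Int (fun xi => hartley w xi * expa e xi) by exact: Int_hartley_mul.
have -> : \int[mu]_xi (hartley w xi ^+ 2 * expa e xi) =
          \int[mu]_x (w x * \int[mu]_y (poisson e (x - y) * w y)).
  rewrite -(eq_int (fun x => congr1 (fun t => w x * t) (hartley_expa_hartley x Iw e0))).
  rewrite -hartley_mulC//; apply: eq_int => xi; ring.
have J1 := Int_convolution IP I2.
have J2 := int_convolution IP I2; rewrite int_poisson// mul1r in J2.
have mc : measurable_fun setT (fun x => w x * \int[mu]_y (poisson e (x - y) * w y)).
  rewrite -(funext (fun x => congr1 (fun t => w x * t) (hartley_expa_hartley x Iw e0))).
  by apply: measurable_funM; [exact: L2_mfun|exact: measurable_hartley].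
pose G x := 2^-1 * (w x ^+ 2 + \int[mu]_y (poisson e (x - y) * w y ^+ 2)).
have IG : Int G by apply: IntZl; exact: IntD.
have B x : `|w x * \int[mu]_y (poisson e (x - y) * w y)| <= G x.
  have Ix := Int_poisson_mul x e0 Iw; have Ixx := Int_poisson_mul x e0 I2.
  have Px := Int_sub x IP.
  rewrite -intZl//; apply: (le_trans (int_norm (IntZl _ Ix))).
  have -> : G x = \int[mu]_y (2^-1 * (w x ^+ 2 * poisson e (x - y) + poisson e (x - y) * w y ^+ 2)).
    have IA := IntZl (w x ^+ 2) Px.
    rewrite (intZl _ (IntD IA Ixx)) (intD IA Ixx) (intZl _ Px) (int_sub x IP).
    by rewrite int_poisson// mulr1.
  apply: int_le; [exact/Int_norm/IntZl|by apply: IntZl; apply: IntD => //; exact: IntZl|].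
  move=> y; rewrite normrM [`|poisson _ _ * _|]normrM (ger0_norm (poisson_ge0 _ e0)).
  have P0 := poisson_ge0 (x - y) e0.
  have -> : `|w x| * (poisson e (x - y) * `|w y|) = poisson e (x - y) * (`|w x| * `|w y|) by ring.
  have -> : 2^-1 * (w x ^+ 2 * poisson e (x - y) + poisson e (x - y) * w y ^+ 2) =
     poisson e (x - y) * (2^-1 * (w x ^+ 2 + w y ^+ 2)) by field.
  rewrite ler_wpM2l// -(real_normK (num_real (w x))) -(real_normK (num_real (w y))).
  by have := sqr_ge0 (`|w x| - `|w y|); nra.
apply: (@le_trans _ _ (\int[mu]_x G x)).
  apply: int_le => //; first exact: Int_le mc B IG.
  by move=> x; exact: le_trans (ler_norm _) (B x).
rewrite (intZl _ (IntD I2 J1)) (intD I2 J1) J2; lra.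
Qed.

End HartleyContraction.

Section HartleyL2.
Context {R : realType}.
Local Notation mu := (@lebesgue_measure R).
Implicit Types (f g h k v w phi : R -> R) (x y z xi e : R).

Let en n : R := n.+1%:R^-1.
Let en0 n : 0 < en n. Proof. by rewrite invr_gt0 ltr0n. Qed.
Let cvg_en : en n @[n --> \oo] --> (0 : R).
Proof. exact: cvg_harmonic. Qed.

Let cvg_expa xi : expa (en n) xi @[n --> \oo] --> (1 : R).
Proof.
rewrite /expa -[X in _ --> X]expR0; apply: continuous_cvg; first exact: continuous_expR.
have := cvgM (cvgN cvg_en) (cvg_cst `|xi|); rewrite oppr0 mul0r; exact.
Qed.

Let expa_itv n xi : 0 <= expa (en n) xi <= 1.
Proof.
by rewrite expR_ge0/= expR_le1 mulNr oppr_le0 mulr_ge0// ltW.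
Qed.

(** Remove the damping by Fatou. *)
Lemma hartley_contraction w : Int w -> w \in L2 ->
  hartley w \in L2 /\ \int[mu]_xi (hartley w xi ^+ 2) <= \int[mu]_x (w x ^+ 2).
Proof.
move=> Iw Lw; have mh := measurable_hartley Iw.
have mh2 := measurable_funX 2 mh.
have [||||I _ B] := @int_fatou R (fun n xi => hartley w xi ^+ 2 * expa (en n) xi)
  (fun xi => hartley w xi ^+ 2) (\int[mu]_x (w x ^+ 2)).
- move=> n; apply: (Int_bounded_mul mh2 _ (Int_expa (en0 n)) (M := (2 * \int[mu]_x `|w x|) ^+ 2)) => x.
  rewrite normrX ler_pXn2r ?nnegrE//; first exact: hartley_bound.
  by rewrite mulr_ge0// int_ge0.
- by move=> n x; rewrite mulr_ge0 ?sqr_ge0// expR_ge0.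
- by move=> n; exact: hartley_damped_le.
- move=> x; rewrite -[X in _ --> X]mulr1; apply: cvgM; first exact: cvg_cst.
  exact: cvg_expa.
by split=> //; apply/L2P.
Qed.

(** After rescaling the kernel to width [1], this is dominated convergence. *)
Lemma cvg_poisson f (M : R) x : continuous f -> (forall y, `|f y| <= M) ->
  \int[mu]_y (poisson (en n) (x - y) * f y) @[n --> \oo] --> f x.
Proof.
move=> cf fM; have mf := continuous_measurable_fun cf.
have p1 : 0 < 1 :> R by [].
have E n : \int[mu]_y (poisson (en n) (x - y) * f y) =
           \int[mu]_z (poisson 1 z * f (x - en n * z)).
  have Ip : Int (fun y => poisson (en n) (x - y) * f y).
    under eq_fun do rewrite mulrC; apply: (Int_bounded_mul mf fM).
    exact/Int_sub/Int_poisson.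
  have c0 : - en n != 0 by rewrite oppr_eq0 gt_eqF.
  rewrite (int_affine x c0 Ip) normrN (gtr0_norm (en0 n)) -intZl; last exact: (Int_affine x c0 Ip).
  apply: eq_int => z; rewrite -(poisson_scale z (en0 n)) mulrA; congr (_ * poisson _ _ * f _); ring.
under eq_fun do rewrite E.
have -> : f x = \int[mu]_z (poisson 1 z * f x).
  by rewrite intZr ?int_poisson ?mul1r//; exact: Int_poisson.
have [|||||_] // := @int_DC R (fun n z => poisson 1 z * f (x - en n * z))
  (fun z => poisson 1 z * f x) (fun z => M * poisson 1 z).
- move=> n; apply: measurable_funM; first exact: measurable_poisson.
  apply: (measurableT_comp mf); apply: measurable_funB => //.
- by apply: measurable_funM => //; exact: measurable_poisson.
- apply: aeW => z; apply: cvgM; first exact: cvg_cst.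
  apply: continuous_cvg; first exact: cf.
  have := cvgB (cvg_cst x) (cvgM cvg_en (cvg_cst z)); rewrite mul0r subr0; exact.
- by apply: aeW => z n; rewrite normrM ger0_norm ?poisson_ge0// mulrC ler_wpM2r ?poisson_ge0.
- exact/IntZl/Int_poisson.
Qed.

(** Inversion in weak form: damp by [exp(-e |xi|)], which turns the double transform of
    [chi] into its Poisson average, and let [e] tend to [0]. The contraction property
    dominates the frequency side. *)
Lemma hartley_test_Parseval w chi : Int w -> w \in L2 -> test_function chi ->
  \int[mu]_xi (hartley w xi * hartley chi xi) = \int[mu]_x (w x * chi x).
Proof.
move=> Iw Lw tchi; have Ic := test_function_Int tchi.
have Lc := test_function_L2 tchi.
have [_ _ [M M0 cM]] := test_function_bounded tchi.
have cc := test_function_continuous tchi.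
have [Lhw _] := hartley_contraction Iw Lw.
have [Lhc _] := hartley_contraction Ic Lc.
have mhw := measurable_hartley Iw; have mhc := measurable_hartley Ic.
have [|||||_ C1] := @int_DC R (fun n xi => hartley w xi * (hartley chi xi * expa (en n) xi))
  (fun xi => hartley w xi * hartley chi xi) (fun xi => `|hartley w xi * hartley chi xi|).
- move=> n; apply: measurable_funM => //; apply: measurable_funM => //.
  exact: measurable_expa.
- exact: measurable_funM.
- apply: aeW => x.
  have := cvgM (cvg_cst (hartley w x)) (cvgM (cvg_cst (hartley chi x)) (cvg_expa x)).
  rewrite mulr1; exact.
- apply: aeW => x n; rewrite mulrA normrM ler_piMr//.
  by have /andP[A B] := expa_itv n x; rewrite ger0_norm.
- exact/Int_norm/L2_mul.
have E n : \int[mu]_xi (hartley w xi * (hartley chi xi * expa (en n) xi)) =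
    \int[mu]_x (w x * \int[mu]_y (poisson (en n) (x - y) * chi y)).
  have IE := Int_hartley_mul Ic (Int_expa (en0 n)).
  rewrite (hartley_mulC Iw IE).
  by apply: eq_int => x; rewrite hartley_expa_hartley.
have [|||||_ C2] := @int_DC R (fun n x => w x * \int[mu]_y (poisson (en n) (x - y) * chi y))
  (fun x => w x * chi x) (fun x => M * `|w x|).
- move=> n; under eq_fun do rewrite -hartley_expa_hartley//.
  apply: measurable_funM; first exact: Int_mfun.
  by apply: measurable_hartley; apply: Int_hartley_mul => //; exact: Int_expa.
- by apply: measurable_funM; exact: Int_mfun.
- by apply: aeW => x; apply: cvgM; [exact: cvg_cst|exact: (@cvg_poisson _ M)].
- apply: aeW => x n; rewrite normrM mulrC ler_wpM2r//.
  have I1 := Int_poisson_mul x (en0 n) Ic.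
  have I2 := Int_sub x (Int_poisson (en0 n)).
  apply: (le_trans (int_norm I1)); apply: (@le_trans _ _ (\int[mu]_y (M * poisson (en n) (x - y)))).
    apply: int_le; [exact: Int_norm|exact: IntZl|] => y.
    by rewrite normrM ger0_norm ?poisson_ge0// mulrC ler_wpM2r// poisson_ge0.
  by rewrite intZl// (int_sub x (Int_poisson (en0 n))) int_poisson// mulr1.
- exact/IntZl/Int_norm.
rewrite (funext E) in C1.
exact: (cvg_unique _ C1 C2).
Qed.

End HartleyL2.

Section HartleyExtension.
Context {R : realType}.
Local Notation mu := (@lebesgue_measure R).
Implicit Types (f g h k v w phi : R -> R) (x y z xi e : R).

(** The limit comes with its rate, which the integration over [x] below requires: the
    sequences [u n -+ 2 t / 2^n] are monotone and adjacent. *)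
Lemma geometric_increments_cvg (u : nat -> R) (t : R) :
  (forall n, `|u n.+1 - u n| <= t / 2 ^+ n) ->
  exists L, forall n, `|u n - L| <= 2 * t / 2 ^+ n.
Proof.
move=> ut; have t0 : 0 <= t.
  by have := ut 0%N; rewrite expr0 divr1; apply: le_trans.
have E n : 2 * t / 2 ^+ n.+1 = t / 2 ^+ n by rewrite exprS; field; rewrite expf_neq0.
have E2 n : 2 * t / 2 ^+ n = t / 2 ^+ n + t / 2 ^+ n by field; rewrite expf_neq0.
pose p n := u n - 2 * t / 2 ^+ n; pose q n := u n + 2 * t / 2 ^+ n.
have nq n : q n.+1 <= q n.
  rewrite /q E E2; have := ut n; rewrite ler_norml => /andP[_]; set z := t / _; lra.
have np n : p n <= p n.+1.
  rewrite /p E E2; have := ut n; rewrite ler_norml => /andP[+ _]; set z := t / _; lra.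
have pq n : p n <= q n.
  rewrite /p /q; have : 0 <= 2 * t / 2 ^+ n by rewrite divr_ge0 ?mulr_ge0 ?exprn_ge0.
  by set z := _ / _; lra.
have ndp : nondecreasing_seq p by apply/nondecreasing_seqP.
have niq : nonincreasing_seq q by apply/nonincreasing_seqP.
have pqmn m n : p m <= q n.
  have [mn|nm] := leqP m n; first exact: le_trans (ndp _ _ mn) (pq n).
  by apply: le_trans (pq m) (niq _ _ (ltnW nm)).
have cp : cvgn p.
  by apply: nondecreasing_is_cvgn => //; exists (q 0%N) => _ [m _ <-].
exists (limn p) => n.
have A : p n <= limn p by exact: nondecreasing_cvgn_le.
have B : limn p <= q n by apply: limr_le => //; apply: nearW => m.
by move: A B; rewrite ler_norml /p /q; set z := _ / _; move=> A B; apply/andP; split; lra.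
Qed.

(** Completeness of [L2] along a sequence with geometrically small increments:
    where [T = sum_j 4^j (g_(j+1) - g_j)^2] is finite, the j-th increment is at most
    [2^-j sqrt T]. *)
Lemma L2_complete_fast (g : nat -> R -> R) (C : R) :
  (forall n, g n \in L2) ->
  (forall n, \int[mu]_x ((g n.+1 x - g n x) ^+ 2) <= C / 8 ^+ n) ->
  exists2 G, G \in L2 & cvL2 g G.
Proof.
move=> Lg gC.
have mg n := L2_mfun (Lg n).
pose a n x : R := 4 ^+ n * (g n.+1 x - g n x) ^+ 2.
have a0 n x : 0 <= a n x by rewrite mulr_ge0 ?sqr_ge0 ?exprn_ge0.
have Ia n : Int (a n) by apply: IntZl; apply: L2_sqr; exact: L2B.
pose T x := (\sum_(0 <= n <oo) (a n x)%:E)%E.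
have IT : mu.-integrable setT T.
  apply/integrableP; split.
    apply: ge0_emeasurable_sum => [n x _ _|n _]; first by rewrite lee_fin.
    by apply/measurable_EFinP; exact: Int_mfun.
  have -> : (\int[mu]_x `|T x| = \int[mu]_x T x)%E.
    apply: eq_integral => x _; rewrite gee0_abs//.
    by apply: nneseries_ge0 => n _ _; rewrite lee_fin.
  rewrite integral_nneseries//; last 2 first.
  - by move=> n; apply/measurable_EFinP; exact: Int_mfun.
  - by move=> n x _; rewrite lee_fin.
  apply: (@le_lt_trans _ _ (2 * C)%:E); last exact: ltry.
  apply: lime_le; first by apply: is_cvg_nneseries => n _ _; apply: integral_ge0 => x _; rewrite lee_fin.
  apply: nearW => n.
  have B m : (\int[mu]_x (a m x)%:E <= (C / 2 ^+ m)%:E)%E.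
    rewrite EFin_int// lee_fin /a intZl; last by apply: L2_sqr; exact: L2B.
    apply: (le_trans (ler_wpM2l _ (gC m))); first exact: exprn_ge0.
    have -> : (8 : R) = 4 * 2 by ring.
    by rewrite exprMn le_eqVlt; apply/orP; left; apply/eqP; field; rewrite !expf_neq0.
  apply: (@le_trans _ _ (\sum_(0 <= m < n) (C / 2 ^+ m)%:E)%E).
    by apply: lee_sum => m _; exact: B.
  rewrite sumEFin lee_fin.
  have C0 : 0 <= C by have := gC 0%N; rewrite expr0 divr1; apply: le_trans; apply: int_ge0 => x; exact: sqr_ge0.
  have -> : \sum_(0 <= m < n) C / 2 ^+ m = 2 * C * (1 - 2^-1 ^+ n).
    elim: n => [|n IH]; first by rewrite big_geq// expr0 subrr mulr0.
    by rewrite big_nat_recr//= IH exprS exprVn; field; rewrite expf_neq0.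
  by rewrite ler_piMr ?mulr_ge0// lerBlDr lerDl exprn_ge0.
pose D := [set x | T x \is a fin_num].
have mD : measurable D.
  by have := emeasurable_fin_num measurableT (measurable_int _ IT); rewrite setTI.
have aeD : {ae mu, forall x, D x}.
  by have := integrable_ae measurableT IT; apply: aeS => x /(_ Logic.I).
have T0 x : (0 <= T x)%E by apply: nneseries_ge0 => m _ _; rewrite lee_fin.
pose t x := Num.sqrt (fine (T x)).
have Ta x n : D x -> a n x <= fine (T x).
  move=> Dx; rewrite -lee_fin fineK//.
  have := @nneseries_lim_ge R (fun n => (a n x)%:E) xpredT 0 n.+1 (fun m _ _ => a0 m x).
  apply: le_trans; rewrite big_nat_recr//= leeDr// sumEFin lee_fin.
  by apply: sumr_ge0 => m _.
have inc x n : D x -> `|g n.+1 x - g n x| <= t x / 2 ^+ n.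
  move=> Dx; rewrite ler_pdivlMr ?exprn_gt0// -[leLHS]ger0_norm ?mulr_ge0//.
  rewrite -sqrtr_sqr ler_wsqrtr//; apply: le_trans (Ta x n Dx).
  rewrite exprMn real_normK ?num_real// mulrC /a -exprM mulnC exprM.
  by have -> : (2 : R) ^+ 2 = 4 by ring.
have /choice[G HG] : forall x, exists y,
    (D x -> forall n, `|g n x - y| <= 2 * t x / 2 ^+ n) /\ (~ D x -> y = 0).
  move=> x; have [Dx|nDx] := pselect (D x); last by exists 0.
  have [L HL] := geometric_increments_cvg (fun n => inc x n Dx).
  by exists L; split.
have pow0 (c : R) : c / 2 ^+ n @[n --> \oo] --> (0 : R).
  have := @cvg_geometric R c 2^-1.
  rewrite ger0_norm// invf_lt1// ltr1n => /(_ isT).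
  by apply: cvg_trans; apply: near_eq_cvg; apply: nearW => n /=; rewrite exprVn.
have gG x : D x -> g n x @[n --> \oo] --> G x.
  move=> Dx; apply/cvgrPdist_le => e e0.
  have /cvgrPdist_le/(_ _ e0) := pow0 (2 * t x).
  apply: filterS => n; rewrite sub0r normrN distrC => H.
  by apply: le_trans ((HG x).1 Dx n) (le_trans (ler_norm _) H).
have mG : measurable_fun setT G.
  apply: (@measurable_fun_cvg _ _ R setT (fun n x => g n x * \1_D x)) => [n|x _].
    by apply: measurable_funM => //; exact: measurable_indic.
  have [Dx|nDx] := pselect (D x).
    by rewrite indicE mem_set//; under eq_fun do rewrite mulr1; exact: gG.
  rewrite indicE memNset// (HG x).2//; under eq_fun do rewrite mulr0.
  exact: cvg_cst.
have mt : measurable_fun setT (fun x => fine (T x)).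
  exact: (measurableT_comp (fine_measurable measurableT) (measurable_int _ IT)).
have Ifine : Int (fun x => fine (T x)).
  apply/Int_ge0P => //; first by move=> x; apply: fine_ge0.
  have [_] := integrableP _ _ _ IT; apply: le_lt_trans.
  apply: ge0_le_integral => //.
  - by move=> x _; rewrite lee_fin fine_ge0.
  - by apply/measurable_EFinP.
  - by apply: measurableT_comp => //; exact: (measurable_int _ IT).
  - move=> x _; rewrite gee0_abs//; case: (T x) (T0 x) => [r|_|]//=; exact: leey.
have Bn n : {ae mu, forall x, (g n x - G x) ^+ 2 <= 4 / 4 ^+ n * fine (T x)}.
  apply: aeS aeD => x Dx; have := (HG x).1 Dx n.
  rewrite -(ler_pXn2r (ltn0Sn 1)) ?nnegrE ?divr_ge0 ?mulr_ge0 ?sqrtr_ge0 ?exprn_ge0//.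
  rewrite real_normK ?num_real// => /le_trans; apply.
  rewrite !exprMn sqr_sqrtr ?fine_ge0// exprVn -exprM mulnC exprM.
  have -> : (2 : R) ^+ 2 = 4 by ring.
  by rewrite mulrAC.
have LG : G \in L2.
  have Id : (fun x => g 0%N x - G x) \in L2.
    apply/L2P; split; first exact: measurable_funB.
    apply: (Int_le_ae _ _ (IntZl (4 / 4 ^+ 0) Ifine)).
      by apply: measurable_funX; exact: measurable_funB.
    by apply: aeS (Bn 0%N) => x Hx; rewrite ger0_norm ?sqr_ge0.
  have := L2B (Lg 0%N) Id; have -> // : (fun x => g 0%N x - (g 0%N x - G x)) = G.
  by apply/funext => x; ring.
exists G => //; rewrite /cvL2.
have H n : 0 <= \int[mu]_x ((g n x - G x) ^+ 2) <= 4 * (\int[mu]_x fine (T x)) / 4 ^+ n.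
  rewrite int_ge0/=; last by move=> x; exact: sqr_ge0.
  have -> : 4 * (\int[mu]_x fine (T x)) / 4 ^+ n = 4 / 4 ^+ n * \int[mu]_x fine (T x) by rewrite mulrAC.
  rewrite -intZl// -lee_fin -!EFin_int; last 2 first.
  - exact: IntZl.
  - by apply: L2_sqr; exact: L2B.
  apply: ae_ge0_le_integral => //.
  - by move=> x _; rewrite lee_fin sqr_ge0.
  - by apply/measurable_EFinP; exact: (Int_mfun (L2_sqr (L2B (Lg n) LG))).
  - by move=> x _; rewrite lee_fin mulr_ge0 ?fine_ge0// divr_ge0// exprn_ge0.
  - by apply/measurable_EFinP; exact: measurable_funM.
  - by apply: aeS (Bn n) => x Hx _; rewrite lee_fin.
have := @squeeze_cvgr _ _ _ _ (fun=> 0)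
  (fun n => 4 * (\int[mu]_x fine (T x)) / 4 ^+ n) _ (nearW _ H) 0; apply.
  exact: cvg_cst.
have := @cvg_geometric R (4 * (\int[mu]_x fine (T x))) 4^-1.
rewrite ger0_norm// invf_lt1// ltr1n => /(_ isT).
by apply: cvg_trans; apply: near_eq_cvg; apply: nearW => n /=; rewrite exprVn.
Qed.

End HartleyExtension.

(** * The Hartley transform on [L2] *)
Section HartleyL2.
Context {R : realType}.
Local Notation mu := (@lebesgue_measure R).
Implicit Types (f g h k q v w phi chi : R -> R) (x y z xi e : R).

Lemma L2_indic_itv (a b : R) : (\1_(`[a, b]) : R -> R) \in L2.
Proof.
have I := @integrable_indic_itv R a b true false.
apply/L2P; split; first exact: measurable_indic.
have : Int (\1_(`[a, b]) : R -> R) := I; congr Int.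
by apply/funext => x; rewrite indicE; case: (_ \in _); rewrite ?expr1n ?expr0n.
Qed.

Lemma loc_Int_mul f g : f \in L2 -> loc_Int (fun x => g x ^+ 2) ->
  measurable_fun setT g -> loc_Int (fun x => f x * g x).
Proof.
move=> Lf [_ lg] mg; split; first by apply: measurable_funM => //; exact: L2_mfun.
move=> a b.
have Lg : (fun x => g x * \1_(`[a, b]) x) \in L2.
  apply/L2P; split; first by apply: measurable_funM => //; exact: measurable_indic.
  have := lg a b; congr Int; apply/funext => x.
  by rewrite exprMn indicE; case: (_ \in _); rewrite ?expr1n ?expr0n.
by under eq_fun do rewrite -mulrA; exact: L2_mul.
Qed.

Lemma loc_Int_L2 f : f \in L2 -> loc_Int f.
Proof.
move=> Lf; split; first exact: L2_mfun.
by move=> a b; apply: L2_mul => //; exact: L2_indic_itv.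
Qed.

Lemma loc_IntB f g : loc_Int f -> loc_Int g -> loc_Int (fun x => f x - g x).
Proof.
move=> [mf If] [mg Ig]; split; first exact: measurable_funB.
move=> a b; under eq_fun do rewrite mulrBl.
by apply: IntB; [exact: If|exact: Ig].
Qed.

Lemma loc_Int_test f chi : loc_Int f -> test_function chi ->
  Int (fun x => f x * chi x).
Proof.
move=> [mf If] tc; have [a ca [M M0 cM]] := test_function_bounded tc.
have mc := Int_mfun (test_function_Int tc).
apply: (Int_le _ _ (IntZl M (Int_norm (If (- a) a)))); first exact: measurable_funM.
move=> x; rewrite !normrM indicE mem_setE; case: (boolP (x \in _)) => [_|].
  by rewrite normr1 mulr1 mulrC ler_wpM2r.
by rewrite in_itv/= -ler_norml -ltNge => /ca ->; rewrite !normr0 !mulr0.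
Qed.

(** Locally summable functions are determined by their pairings with test
    functions. *)
Lemma test_function_ext f g : loc_Int f -> loc_Int g ->
  (forall chi, test_function chi ->
     \int[mu]_x (f x * chi x) = \int[mu]_x (g x * chi x)) ->
  {ae mu, forall x, f x = g x}.
Proof.
move=> lf lg fg.
have := test_function_separate (loc_IntB lf lg).
have H chi : test_function chi -> \int[mu]_x ((f x - g x) * chi x) = 0.
  move=> tc; under eq_int do rewrite mulrBl.
  by rewrite (intB (loc_Int_test lf tc) (loc_Int_test lg tc)) fg// subrr.
by move=> /(_ H); apply: aeS => x /eqP; rewrite subr_eq0 => /eqP.
Qed.

Lemma hartleyB w v xi : Int w -> Int v ->
  hartley (fun x => w x - v x) xi = hartley w xi - hartley v xi.
Proof.
move=> Iw Iv; rewrite /hartley -(intB (Int_cas xi Iw) (Int_cas xi Iv)).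
by apply: eq_int => x; rewrite mulrBr.
Qed.

(** [isH w h] reads: [h] is the [L2] Hartley transform of [w], characterised by
    transposition. *)
Definition isH w h : Prop := [/\ w \in L2, h \in L2 &
  forall phi, Int phi -> phi \in L2 ->
    \int[mu]_x (h x * phi x) = \int[mu]_x (w x * hartley phi x)].

Lemma isH_uniq w w' h h' : isH w h -> isH w' h' ->
  {ae mu, forall x, w x = w' x} -> {ae mu, forall x, h x = h' x}.
Proof.
move=> [Lw Lh H] [Lw' Lh' H'] ww'; apply: test_function_ext; try exact: loc_Int_L2.
move=> chi tc; have Ic := test_function_Int tc; have Lc := test_function_L2 tc.
rewrite H// H'//; have mh := measurable_hartley Ic; apply: int_ae_eq.
- by apply: measurable_funM => //; exact: L2_mfun.
- by apply: measurable_funM => //; exact: L2_mfun.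
- by apply: aeS ww' => x ->.
Qed.

Lemma isH_ae w w' h h' : isH w h -> measurable_fun setT w' -> measurable_fun setT h' ->
  {ae mu, forall x, w x = w' x} -> {ae mu, forall x, h x = h' x} -> isH w' h'.
Proof.
move=> [Lw Lh H] mw' mh' ww' hh'; split; [exact: L2_ae_eq ww' _|exact: L2_ae_eq hh' _|].
move=> phi Ip Lp; have mh := measurable_hartley Ip; have mp := Int_mfun Ip.
transitivity (\int[mu]_x (h x * phi x)).
  apply: int_ae_eq; try by apply: measurable_funM => //; exact: L2_mfun.
  by apply: aeS hh' => x ->.
rewrite H//; apply: int_ae_eq; try by apply: measurable_funM => //; exact: L2_mfun.
by apply: aeS ww' => x ->.
Qed.

Lemma isH_hartley phi : Int phi -> phi \in L2 -> isH phi (hartley phi).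
Proof.
move=> Ip Lp; have [Lh _] := hartley_contraction Ip Lp.
by split=> // psi Ipsi _; exact: hartley_mulC.
Qed.

Lemma isH_lim (v : nat -> R -> R) w h : (forall n, Int (v n) /\ v n \in L2) ->
  w \in L2 -> h \in L2 -> cvL2 v w -> cvL2 (fun n => hartley (v n)) h -> isH w h.
Proof.
move=> Iv Lw Lh vw vh; split=> // phi Ip Lp.
have [Lhp _] := hartley_contraction Ip Lp.
have Lhv n : hartley (v n) \in L2 := (hartley_contraction (Iv n).1 (Iv n).2).1.
have C1 := cvL2_inner Lhv Lh Lp vh.
have C2 := cvL2_inner (fun n => (Iv n).2) Lw Lhp vw.
have E n : \int[mu]_x (hartley (v n) x * phi x) = \int[mu]_x (v n x * hartley phi x).
  by rewrite (hartley_mulC (Iv n).1 Ip).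
rewrite (funext E) in C1.
exact: (cvg_unique _ C1 C2).
Qed.

(** Truncations of [w] to bounded intervals are summable; along a subsequence they
    converge geometrically, and the contraction property carries this over to their
    transforms. *)
Lemma isH_exists w : w \in L2 -> exists (v : nat -> R -> R) h, [/\ isH w h,
  forall n, Int (v n) /\ v n \in L2, cvL2 v w & cvL2 (fun n => hartley (v n)) h].
Proof.
move=> Lw; have mw := L2_mfun Lw.
pose u n x := w x * \1_(`[- n%:R, n%:R]) x.
have Lu n : u n \in L2.
  apply: (L2_le _ Lw); first by apply: measurable_funM => //; exact: measurable_indic.
  by move=> x; rewrite normrM indicE; case: (_ \in _); rewrite ?normr1 ?normr0 ?mulr1 ?mulr0.
have Iu n : Int (u n) by apply: L2_mul => //; exact: L2_indic_itv.
have [|||||_ _ uw] := @cvL2_dominated R u w (fun x => `|w x|).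
- by move=> n; exact: L2_mfun.
- exact: mw.
- exact: L2_norm.
- apply: aeW => x; apply: cvg_near_cst; near=> n.
  rewrite /u indicE mem_set ?mulr1//= in_itv/= -ler_norml.
  by near: n; exact: nbhs_infty_ger.
- apply: aeW => x n; rewrite normrM indicE.
  by case: (_ \in _); rewrite ?normr1 ?normr0 ?mulr1 ?mulr0.
have pick (k : nat) : exists n, \int[mu]_x ((u n x - w x) ^+ 2) <= 8^-1 ^+ k.
  have e0 : 0 < 8^-1 ^+ k :> R by rewrite exprn_gt0.
  have /cvgrPdist_le/(_ _ e0) [N _ HN] := uw.
  exists N; have := HN N (leqnn N); rewrite /= sub0r normrN; apply: le_trans; exact: ler_norm.
have /choice[s Hs] := pick.
pose v (n : nat) := u (s n).
have Iv n : Int (v n) /\ v n \in L2 by split; [exact: Iu|exact: Lu].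
have vw : cvL2 v w.
  have H n : 0 <= \int[mu]_x ((v n x - w x) ^+ 2) <= 8^-1 ^+ n.
    by rewrite Hs andbT; apply: int_ge0 => x; exact: sqr_ge0.
  have := @squeeze_cvgr _ _ _ _ (fun=> 0) (fun n => 8^-1 ^+ n) _ (nearW _ H) 0; apply.
    exact: cvg_cst.
  by apply: cvg_expr; rewrite ger0_norm// invf_lt1// ltr1n.
have [n|n|h Lh vh] := @L2_complete_fast R (fun n => hartley (v n)) 4.
- exact: (hartley_contraction (Iv n).1 (Iv n).2).1.
- have IB : Int (fun x => v n.+1 x - v n x) by apply: IntB; [exact: (Iv n.+1).1|exact: (Iv n).1].
  have LB := L2B (Iv n.+1).2 (Iv n).2.
  have [_ H] := hartley_contraction IB LB.
  have -> : \int[mu]_x ((hartley (v n.+1) x - hartley (v n) x) ^+ 2) =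
            \int[mu]_x (hartley (fun x => v n.+1 x - v n x) x ^+ 2).
    by apply: eq_int => x; rewrite (hartleyB x (Iv n.+1).1 (Iv n).1).
  apply: (le_trans H).
  have I1 := L2_sqr (L2B (Iv n.+1).2 Lw); have I2 := L2_sqr (L2B (Iv n).2 Lw).
  apply: (@le_trans _ _ (\int[mu]_x (2 * (v n.+1 x - w x) ^+ 2 + 2 * (v n x - w x) ^+ 2))).
    apply: int_le; [exact: L2_sqr|by apply: IntD; exact: IntZl|] => x.
    by have := sqr_ge0 ((v n.+1 x - w x) + (v n x - w x)); nra.
  rewrite (intD (IntZl 2 I1) (IntZl 2 I2)) (intZl 2 I1) (intZl 2 I2).
  have := Hs n; have := Hs n.+1; rewrite -/(v n) -/(v n.+1) exprS -exprVn.
  have : 0 <= 8^-1 ^+ n :> R by rewrite exprn_ge0.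
  set a := \int[mu]_x _; set b := \int[mu]_x _; set c := 8^-1 ^+ n.
  by lra.
exists v, h; split=> //; exact: isH_lim vw vh.
Unshelve. all: by end_near. Qed.

Lemma isH_approx w h : isH w h -> exists v : nat -> R -> R, [/\ forall n, Int (v n) /\ v n \in L2,
  cvL2 v w & cvL2 (fun n => hartley (v n)) h].
Proof.
move=> wh; have [Lw Lh _] := wh; have [v [k [wk Iv vw vk]]] := isH_exists Lw.
exists v; split=> //.
have hk := isH_uniq wk wh (aeW _ (fun=> erefl)); have [_ Lk _] := wk.
rewrite /cvL2; have E n : \int[mu]_x ((hartley (v n) x - h x) ^+ 2) =
                         \int[mu]_x ((hartley (v n) x - k x) ^+ 2).
  have Lhv : hartley (v n) \in L2 := (hartley_contraction (Iv n).1 (Iv n).2).1.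
  apply: int_ae_eq.
  - exact: (Int_mfun (L2_sqr (L2B Lhv Lh))).
  - exact: (Int_mfun (L2_sqr (L2B Lhv Lk))).
  - by apply: aeS hk => x ->.
by rewrite (funext E).
Qed.

Lemma isH_pair w h v k : isH w h -> isH v k ->
  \int[mu]_x (h x * v x) = \int[mu]_x (w x * k x).
Proof.
move=> [Lw Lh wh] vk; have [Lv Lk _] := vk; have [u [Iu uv uk]] := isH_approx vk.
have Lhu n : hartley (u n) \in L2 := (hartley_contraction (Iu n).1 (Iu n).2).1.
have C1 := cvL2_inner (fun n => (Iu n).2) Lv Lh uv.
have C2 := cvL2_inner Lhu Lk Lw uk.
have E n : \int[mu]_x (u n x * h x) = \int[mu]_x (hartley (u n) x * w x).
  transitivity (\int[mu]_x (h x * u n x)); first by apply: eq_int => x; rewrite mulrC.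
  by rewrite (wh _ (Iu n).1 (Iu n).2); apply: eq_int => x; rewrite mulrC.
rewrite (funext E) in C1.
have := cvg_unique _ C1 C2 => H.
transitivity (\int[mu]_x (v x * h x)); first by apply: eq_int => x; rewrite mulrC.
by rewrite H//; apply: eq_int => x; rewrite mulrC.
Qed.

(** The transform is an involution of [L2]: both sides agree against test functions. *)
Lemma isH_sym w h : isH w h -> isH h w.
Proof.
move=> wh; have [Lw Lh wh'] := wh; have [_ [w' [hw' _ _ _]]] := isH_exists Lh.
have [_ Lw' hw2] := hw'; have [u [Iu uw uh]] := isH_approx wh.
have Lhu n : hartley (u n) \in L2 := (hartley_contraction (Iu n).1 (Iu n).2).1.
suff ww' : {ae mu, forall x, w' x = w x}.
  by apply: (isH_ae hw'); [exact: L2_mfun|exact: L2_mfun|exact: aeW|].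
apply: test_function_ext; try exact: loc_Int_L2.
move=> chi tc; have Ic := test_function_Int tc; have Lc := test_function_L2 tc.
have [Lhc _] := hartley_contraction Ic Lc.
rewrite hw2//.
have C1 := cvL2_inner (fun n => (Iu n).2) Lw Lc uw.
have C2 := cvL2_inner Lhu Lh Lhc uh.
have E n := hartley_test_Parseval (Iu n).1 (Iu n).2 tc.
rewrite (funext E) in C2.
exact: (cvg_unique _ C2 C1).
Qed.

Lemma isH_Parseval w h v k : isH w h -> isH v k ->
  \int[mu]_x (w x * v x) = \int[mu]_x (h x * k x).
Proof. by move=> /isH_sym; exact: isH_pair. Qed.

Lemma isH_lin (a b : R) w h v k : isH w h -> isH v k ->
  isH (fun x => a * w x + b * v x) (fun x => a * h x + b * k x).
Proof.
move=> [Lw Lh wh] [Lv Lk vk]; split; [by apply: L2D; exact: L2Z|by apply: L2D; exact: L2Z|].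
move=> phi Ip Lp; have [Lhp _] := hartley_contraction Ip Lp.
have H f g p : f \in L2 -> g \in L2 -> p \in L2 ->
  \int[mu]_x ((a * f x + b * g x) * p x) = a * \int[mu]_x (f x * p x) + b * \int[mu]_x (g x * p x).
  move=> Lf Lg Lp'; have I1 := L2_mul Lf Lp'; have I2 := L2_mul Lg Lp'.
  rewrite -(intZl a I1) -(intZl b I2) -(intD (IntZl a I1) (IntZl b I2)).
  by apply: eq_int => x; ring.
by rewrite !H// wh// vk.
Qed.

Lemma isH_inj w h w' h' : isH w h -> isH w' h' -> {ae mu, forall x, h x = h' x} ->
  {ae mu, forall x, w x = w' x}.
Proof. by move=> /isH_sym H /isH_sym H'; exact: isH_uniq H H'. Qed.

End HartleyL2.

(** * Sobolev spaces read on the Hartley side *)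
Section Sobolev.
Context {R : realType}.
Local Notation mu := (@lebesgue_measure R).
Local Notation normc := ComplexField.Normc.normc.
Implicit Types (f g h v w : R -> R) (W : R -> R[i]) (x xi s t : R).

Definition freq xi : R := `|2 * pi * xi|.

Lemma freqN xi : freq (- xi) = freq xi.
Proof. by rewrite /freq mulrN normrN. Qed.

Lemma measurable_freq : measurable_fun setT (@freq).
Proof.
apply: (@measurableT_comp _ _ _ _ _ _ (fun y : R => `|y|) _ (fun x => 2 * pi * x)) => //.
exact: measurable_funM.
Qed.

Lemma measurable_freq_powR t : measurable_fun setT (fun xi => freq xi `^ t).
Proof. exact: (measurableT_comp (measurable_powR t) measurable_freq). Qed.

Let cosT v xi : R := \int[mu]_x (cos (2 * pi * x * xi) * v x).
Let sinT v xi : R := \int[mu]_x (sin (2 * pi * x * xi) * v x).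

Let Int_cosT v xi : Int v -> Int (fun x => cos (2 * pi * x * xi) * v x).
Proof.
move=> Iv; apply: (Int_bounded_mul _ (fun x => abs_cos_le1 _) Iv).
apply: continuous_measurable_fun => x.
apply: (@continuous_comp _ _ _ (fun x => 2 * pi * x * xi) (@cos R)); last exact: continuous_cos.
by apply: cvgM; [exact: continuous_scale|exact: cvg_cst].
Qed.

Let Int_sinT v xi : Int v -> Int (fun x => sin (2 * pi * x * xi) * v x).
Proof.
move=> Iv; apply: (Int_bounded_mul _ (fun x => abs_sin_le1 _) Iv).
apply: continuous_measurable_fun => x.
apply: (@continuous_comp _ _ _ (fun x => 2 * pi * x * xi) (@sin R)); last exact: continuous_sin.
by apply: cvgM; [exact: continuous_scale|exact: cvg_cst].
Qed.

Let hartleyE v xi : Int v -> hartley v xi = cosT v xi + sinT v xi.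
Proof.
move=> Iv; rewrite -(intD (Int_cosT xi Iv) (Int_sinT xi Iv)).
by apply: eq_int => x; rewrite /cas mulrDl.
Qed.

Let hartleyNE v xi : Int v -> hartley v (- xi) = cosT v xi - sinT v xi.
Proof.
move=> Iv; rewrite -(intB (Int_cosT xi Iv) (Int_sinT xi Iv)).
by apply: eq_int => x; rewrite /cas mulrN cosN sinN mulrBl.
Qed.

Let normc_sqr (z : R[i]) : normc z ^+ 2 = complex.Re z ^+ 2 + complex.Im z ^+ 2.
Proof. by case: z => a b /=; rewrite sqr_sqrtr// addr_ge0 ?sqr_ge0. Qed.

(** The even part of the Hartley transform is the real part of the Fourier
    transform, its odd part the opposite of the imaginary part. *)
Let fourier_of_hartley h xi : R[i] :=
  (((h xi + h (- xi)) / 2) +i* (- ((h xi - h (- xi)) / 2)))%C.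

Let fourierE v xi : Int v -> fourier v xi = fourier_of_hartley (hartley v) xi.
Proof.
move=> Iv; rewrite /fourier_of_hartley hartleyE// hartleyNE// /fourier.
by congr (_ +i* _)%C; rewrite /cosT /sinT; field.
Qed.

Let normc_fourier_of_hartley h xi :
  normc (fourier_of_hartley h xi) ^+ 2 = 2^-1 * (h xi ^+ 2 + h (- xi) ^+ 2).
Proof. by rewrite normc_sqr /=; field. Qed.

(** The weight is even, so the weighted norms of the Fourier and of the Hartley transform
    coincide; approximating sequences correspond likewise. *)
Lemma HhatP m w : Hhat m w <-> exists2 h, isH w h &
  Int (fun xi => (1 + freq xi `^ (2 * m)) * h xi ^+ 2).
Proof.
have mwt : measurable_fun setT (fun xi => 1 + freq xi `^ (2 * m)).
  by apply: measurable_funD => //; exact: measurable_freq_powR.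
have wt0 xi : 0 <= 1 + freq xi `^ (2 * m) by rewrite addr_ge0 ?powR_ge0.
split.
- move=> [Lw [W [[[LRe LIm] [v [Lv vw vW]]] WI]]].
  have Iv n : Int (v n) /\ v n \in L2 by have [/L1P ? ?] := Lv n.
  (* the inverse of [fourier_of_hartley] *)
  pose h xi := complex.Re (W xi) - complex.Im (W xi).
  have Lh : h \in L2 by exact: L2B.
  have sqle (z : R[i]) : (complex.Re z - complex.Im z) ^+ 2 <= 2 * normc z ^+ 2.
    by rewrite normc_sqr; have := sqr_ge0 (complex.Re z + complex.Im z); nra.
  have mh := L2_mfun Lh; have mRe := L2_mfun LRe; have mIm := L2_mfun LIm.
  exists h.
  + apply: (isH_lim Iv Lw Lh); first by apply/cvg_L2P => // n; exact: (Iv n).2.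
    have Lhv n : hartley (v n) \in L2 := (hartley_contraction (Iv n).1 (Iv n).2).1.
    apply/(cvg_L2P Lhv Lh); rewrite /cvg_L2.
    have H n : (0 <= \int[mu]_x ((hartley (v n) x - h x) ^+ 2)%:E <=
        2%:E * \int[mu]_xi (normc (fourier (v n) xi - W xi) ^+ 2)%:E)%E.
      rewrite integral_ge0/=; last by move=> x _; rewrite lee_fin sqr_ge0.
      have mhv := L2_mfun (Lhv n); have mhvr := measurable_fun_refl mhv.
      have mN : measurable_fun setT (fun xi => normc (fourier (v n) xi - W xi) ^+ 2).
        have E xi : normc (fourier (v n) xi - W xi) ^+ 2 =
           ((hartley (v n) xi + hartley (v n) (- xi)) / 2 - complex.Re (W xi)) ^+ 2 +
           (- ((hartley (v n) xi - hartley (v n) (- xi)) / 2) - complex.Im (W xi)) ^+ 2.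
          by rewrite (fourierE xi (Iv n).1) normc_sqr; case: (W xi).
        rewrite (funext E); apply: measurable_funD; apply: measurable_funX; apply: measurable_funB => //.
          by apply: measurable_funM => //; exact: measurable_funD.
        apply: measurable_funN.
        by apply: measurable_funM => //; exact: measurable_funB.
      rewrite -ge0_integralZl//; last 2 first.
      - exact/measurable_EFinP.
      - by move=> x _; rewrite lee_fin sqr_ge0.
      apply: ge0_le_integral => //.
      - by move=> x _; rewrite lee_fin sqr_ge0.
      - by apply/measurable_EFinP; exact: (Int_mfun (L2_sqr (L2B (Lhv n) Lh))).
      - by under eq_fun do rewrite -EFinM; apply/measurable_EFinP; exact: measurable_funM.
      - move=> x _; rewrite -EFinM lee_fin.
        apply: le_trans (sqle _); rewrite (fourierE x (Iv n).1) /h.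
        by case: (W x) => a b /=; rewrite le_eqVlt; apply/orP; left; apply/eqP; field.
    apply: (squeeze_cvge (nearW _ H)); first exact: cvg_cst.
    by rewrite -(mule0 2%:E); apply: cvgeZl.
  + have mwh : measurable_fun setT (fun xi => (1 + freq xi `^ (2 * m)) * h xi ^+ 2).
      by apply: measurable_funM => //; exact: measurable_funX.
    have mN : measurable_fun setT (fun xi => (1 + freq xi `^ (2 * m)) * normc (W xi) ^+ 2).
      apply: measurable_funM => //; under eq_fun do rewrite normc_sqr.
      by apply: measurable_funD; exact: measurable_funX.
    have IN : Int (fun xi => (1 + freq xi `^ (2 * m)) * normc (W xi) ^+ 2).
      by apply/Int_ge0P => // xi; rewrite mulr_ge0// sqr_ge0.
    apply: (Int_le mwh _ (IntZl 2 IN)) => xi.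
    rewrite ger0_norm; last by rewrite mulr_ge0 ?sqr_ge0.
    rewrite [leRHS](_ : _ = (1 + freq xi `^ (2 * m)) * (2 * normc (W xi) ^+ 2)); last by ring.
    by apply: ler_wpM2l => //; exact: sqle.
- move=> [h wh Ih]; have [Lw Lh _] := wh.
  have [v [Iv vw vh]] := isH_approx wh.
  have Lhr := L2_refl Lh.
  have Lhv n : hartley (v n) \in L2 := (hartley_contraction (Iv n).1 (Iv n).2).1.
  have Ev f : \int[mu]_x f x = \int[mu]_x f x by [].
  have Lev : (fun xi => (h xi + h (- xi)) / 2) \in L2.
    by under eq_fun do rewrite mulrC; apply: L2Z; exact: L2D.
  have Lod : (fun xi => - ((h xi - h (- xi)) / 2)) \in L2.
    by apply: L2N; under eq_fun do rewrite mulrC; apply: L2Z; exact: L2B.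
  split=> //; exists (fourier_of_hartley h); split; first split.
  + by split; [exact: Lev|exact: Lod].
  + exists v; split.
    * by move=> n; have [/L1P ? ?] := Iv n.
    * by apply/cvg_L2P => // n; exact: (Iv n).2.
    * have E n : (\int[mu]_xi (normc (fourier (v n) xi - fourier_of_hartley h xi) ^+ 2)%:E =
          (\int[mu]_x ((hartley (v n) x - h x) ^+ 2))%:E)%E.
        pose d xi := hartley (v n) xi - h xi.
        have Id : Int (fun xi => d xi ^+ 2) := L2_sqr (L2B (Lhv n) Lh).
        have Idr := Int_refl Id.
        have Ed xi : normc (fourier (v n) xi - fourier_of_hartley h xi) ^+ 2 =
                     2^-1 * (d xi ^+ 2 + d (- xi) ^+ 2).
          rewrite (fourierE xi (Iv n).1) -normc_fourier_of_hartley !normc_sqr /d /=.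
          by congr (_ ^+ 2 + _ ^+ 2); field.
        under eq_integral do rewrite Ed.
        rewrite EFin_int; last by apply: IntZl; exact: IntD.
        by rewrite (intZl _ (IntD Id Idr)) (intD Id Idr) (int_refl Id); congr EFin; field.
      rewrite /cvg_L2C (funext E); apply: cvg_EFin; [exact: nearW|exact: vh].
  + have Ihr := Int_refl Ih.
    have := IntZl 2^-1 (IntD Ih Ihr).
    have E xi : 2^-1 * ((1 + freq xi `^ (2 * m)) * h xi ^+ 2 +
        (1 + freq (- xi) `^ (2 * m)) * h (- xi) ^+ 2) =
      (1 + freq xi `^ (2 * m)) * normc (fourier_of_hartley h xi) ^+ 2.
      by rewrite normc_fourier_of_hartley freqN; ring.
    rewrite (funext E) => IE; apply/Int_ge0P => //; first exact: Int_mfun IE.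
    by move=> xi; rewrite mulr_ge0// sqr_ge0.
Qed.

End Sobolev.

(** * Power weights and the constants of the fractional symbols *)
Section Powers.
Context {R : realType}.
Local Notation mu := (@lebesgue_measure R).
Implicit Types (f g h : R -> R) (x l p q s t : R).

Lemma measurable_powR_mul_indic p (D : set R) : measurable D ->
  measurable_fun setT (fun x => x `^ p * \1_D x).
Proof.
move=> mD; apply: measurable_funM; first exact: measurable_powR.
exact: measurable_indic.
Qed.

Lemma int_powR_itv p a b : 0 < a -> a < b -> p + 1 != 0 ->
  Int (fun x => x `^ p * \1_(`[a, b]) x) /\
  \int[mu]_x (x `^ p * \1_(`[a, b]) x) = (b `^ (p + 1) - a `^ (p + 1)) / (p + 1).
Proof.
move=> a0 ab p1.
have E x : x `^ p * \1_(`[a, b]) x = ((fun x => x `^ p) \_ `[a, b]) x.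
  by rewrite patchE indicE; case: ifP => _; rewrite ?mulr1 ?mulr0.
have D (x : R) : 0 < x -> is_derive x 1 (fun y : R => (p + 1)^-1 * y `^ (p + 1)) (x `^ p).
  move=> x0; have H := is_derive_cst_scale (p + 1)^-1 (is_derive1_powR (p + 1) x0).
  by apply: (is_derive_eq H); rewrite addrK mulrA mulVf// mul1r.
have C (x : R) : 0 < x -> {for x, continuous (fun y : R => (p + 1)^-1 * y `^ (p + 1))}.
  move=> x0; have H := D x x0; apply: differentiable_continuous.
  by apply/derivable1_diffP; exact: ex_derive.
have cp r : {within `[a, b], continuous (fun x : R => x `^ r)}.
  apply: derivable_within_continuous => x; rewrite in_itv/= => /andP[ax _].
  by apply: ex_derive; apply: is_derive1_powR; exact: lt_le_trans a0 ax.
have F : (\int[mu]_(x in `[a, b]) (x `^ p)%:E =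
    ((b `^ (p + 1) - a `^ (p + 1)) / (p + 1))%:E)%E.
  rewrite (@continuous_FTC2 _ _ (fun y : R => (p + 1)^-1 * y `^ (p + 1)))//.
  - by rewrite -EFinB -mulrBr mulrC.
  - split.
    + move=> x; rewrite in_itv/= => /andP[ax _].
      by have H := D x (lt_trans a0 ax); exact: ex_derive.
    + by apply: cvg_at_right_filter; exact: C.
    + by apply: cvg_at_left_filter; apply: C; exact: lt_trans ab.
  - move=> x; rewrite in_itv/= => /andP[ax _].
    by have H := D x (lt_trans a0 ax); rewrite derive1E; exact: derive_val.
have If : Int ((fun x => x `^ p) \_ `[a, b]).
  apply/(Int_patch _ (measurable_itv _)); apply/integrableP; split.
    by apply/measurable_EFinP; apply: measurable_funTS; exact: measurable_powR.
  have -> : (\int[mu]_(x in `[a, b]) `|(EFin \o (fun x : R => (x `^ p)%R)) x| =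
             \int[mu]_(x in `[a, b]) (x `^ p)%:E)%E.
    by apply: eq_integral => x _; rewrite /= ger0_norm// powR_ge0.
  by rewrite F ltry.
rewrite (funext E); split=> //.
by rewrite -Rintegral_mkcond /Rintegral F.
Qed.

Lemma Int_powR_near0 p : - 1 < p -> Int (fun x => x `^ p * \1_(`]0, 1]) x).
Proof.
move=> p1; have p10 : 0 < p + 1 by lra.
have e0 n : 0 < n.+2%:R^-1 :> R by rewrite invr_gt0 ltr0n.
have e1 n : n.+2%:R^-1 < 1 :> R by rewrite invf_lt1 ?ltr0n// ltr1n.
have [||||//] := @int_fatou R (fun n x => x `^ p * \1_(`[n.+2%:R^-1, 1]) x)
  (fun x => x `^ p * \1_(`]0, 1]) x) (p + 1)^-1.
- by move=> n; apply: (int_powR_itv (e0 n) (e1 n) (lt0r_neq0 p10)).1.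
- by move=> n x; rewrite mulr_ge0 ?powR_ge0// indicE.
- move=> n; rewrite (int_powR_itv (e0 n) (e1 n) (lt0r_neq0 p10)).2.
  by rewrite powR1 ler_pdivrMr// mulVf ?lt0r_neq0// gerBl powR_ge0.
- move=> x; apply: cvg_near_cst; near=> n; congr (_ * _); rewrite !indicE !mem_setE !in_itv/=.
  congr ((_ && _)%:R); apply/idP/idP => [|x0]; first exact: lt_le_trans.
  rewrite -[leRHS]invrK lef_pV2 ?posrE ?ltr0n ?invr_gt0//.
  apply: (@le_trans _ _ n%:R); last by rewrite ler_nat; apply: leqW; apply: leqnSn.
  by near: n; exact: nbhs_infty_ger.
Unshelve. all: by end_near. Qed.

Lemma Int_powR_infty q : q < - 1 -> Int (fun x => x `^ q * \1_(`[1, +oo[) x).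
Proof.
move=> q1; have q10 : q + 1 < 0 by lra.
have e1 n : 1 < n.+2%:R :> R by rewrite ltr1n.
have [||||//] := @int_fatou R (fun n x => x `^ q * \1_(`[1, n.+2%:R]) x)
  (fun x => x `^ q * \1_(`[1, +oo[) x) (- (q + 1)^-1).
- by move=> n; apply: (int_powR_itv ltr01 (e1 n) (ltr0_neq0 q10)).1.
- by move=> n x; rewrite mulr_ge0 ?powR_ge0// indicE.
- move=> n; rewrite (int_powR_itv ltr01 (e1 n) (ltr0_neq0 q10)).2.
  rewrite powR1 ler_ndivrMr// mulNr mulVf ?ltr0_neq0//.
  by have := powR_ge0 n.+2%:R (q + 1); set z := _ `^ _; lra.
- move=> x; apply: cvg_near_cst; near=> n; congr (_ * _); rewrite !indicE !mem_setE !in_itv/= andbT.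
  suff -> : x <= n.+2%:R by rewrite andbT.
  apply: (@le_trans _ _ n%:R); last by rewrite ler_nat; apply: leqW; apply: leqnSn.
  by apply: le_trans (ler_norm _) _; near: n; exact: nbhs_infty_ger.
Unshelve. all: by end_near. Qed.

(** The density with which exponentials [exp(-l z)] are mixed to give [z^(s-1)]. *)
Definition wt s l : R := if 0 < l then l `^ (- s) else 0.

Lemma wtE s l : wt s l = l `^ (- s) * \1_(`]0, +oo[) l.
Proof.
by rewrite /wt indicE mem_setE in_itv/= andbT; case: ifP => _; rewrite ?mulr1 ?mulr0.
Qed.

Lemma wt_ge0 s l : 0 <= wt s l.
Proof. by rewrite /wt; case: ifP => // _; exact: powR_ge0. Qed.

Lemma measurable_wt s : measurable_fun setT (wt s).
Proof. by rewrite (funext (wtE s)); exact: measurable_powR_mul_indic. Qed.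

Lemma wt_scale s t l : 0 < t -> wt s (t * l) = t `^ (- s) * wt s l.
Proof.
move=> t0; rewrite /wt pmulr_rgt0//; case: ifP => l0; last by rewrite mulr0.
by rewrite powRM// ltW.
Qed.

(** The singularity at [0] is summable because [s < 1], the tail because
    [s + p > 1]. *)
Lemma Int_wt_mul s g (p : R) : 0 < s < 1 -> measurable_fun setT g ->
  1 - s < p -> (forall l, 0 < l -> 0 <= g l <= 1) -> (forall l, 1 <= l -> g l <= l `^ (- p)) ->
  Int (fun l => wt s l * g l).
Proof.
move=> /andP[s0 s1] mg p1 g1 gp.
have I1 : Int (fun x => x `^ (- s) * \1_(`]0, 1]) x) by apply: Int_powR_near0; lra.
have I2 : Int (fun x => x `^ (- s - p) * \1_(`[1, +oo[) x) by apply: Int_powR_infty; lra.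
apply: (Int_le _ _ (IntD I1 I2)).
  by apply: measurable_funM => //; exact: measurable_wt.
move=> l; have A0 : 0 <= l `^ (- s) * \1_(`]0, 1]) l by rewrite mulr_ge0 ?powR_ge0// indicE.
have B0 : 0 <= l `^ (- s - p) * \1_(`[1, +oo[) l by rewrite mulr_ge0 ?powR_ge0// indicE.
rewrite /wt; case: ifPn => l0; last by rewrite mul0r normr0 addr_ge0.
have /andP[g0 gl1] := g1 l l0; rewrite ger0_norm ?mulr_ge0 ?powR_ge0//.
have [l1|l1] := leP l 1.
  apply: (@le_trans _ _ (l `^ (- s) * \1_(`]0, 1]) l)); last by rewrite lerDl.
  rewrite indicE mem_set/=; last by rewrite in_itv/= l0.
  by rewrite ler_wpM2l// powR_ge0.
apply: (@le_trans _ _ (l `^ (- s - p) * \1_(`[1, +oo[) l)); last by rewrite lerDr.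
rewrite indicE mem_set/=; last by rewrite in_itv/= ltW.
rewrite mulr1 powRD; last by rewrite (gt_eqF l0) implybT.
by rewrite ler_wpM2l ?powR_ge0// gp// ltW.
Qed.

Lemma powRN1 l : 0 < l -> l `^ (-1) = l^-1.
Proof. by move=> l0; rewrite powR_inv1// ltW. Qed.

Lemma Int_wt_exp s t : 0 < s < 1 -> 0 < t -> Int (fun l => wt s l * expR (- t * l)).
Proof.
move=> s01 t0.
have I1 : Int (fun l => wt s l * expR (- l)).
  apply: (Int_wt_mul (p := 1) s01).
  - apply: continuous_measurable_fun => x; apply: continuous_comp; first exact: opp_continuous.
    exact: continuous_expR.
  - by move: s01 => /andP[]; lra.
  - by move=> l l0; rewrite expR_ge0/= expR_le1 oppr_le0 ltW.
  - move=> l l1; have l0 : 0 < l by lra.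
    rewrite powRN1// expRN lef_pV2 ?posrE ?expR_gt0//.
    by have := expR_ge1Dx l; lra.
have := IntZl (t `^ s) (Int_affine 0 (lt0r_neq0 t0) I1); congr Int; apply/funext => l.
rewrite addr0 wt_scale// !mulrA -powRD; last by rewrite subrr eqxx/= (gt_eqF t0).
by rewrite subrr powRr0 mul1r mulNr.
Qed.

(** The Euler integral, rescaled. It also gives the positivity of [Gamma]. *)
Lemma int_wt_exp s t : 0 < s < 1 -> 0 < t ->
  \int[mu]_l (wt s l * expR (- t * l)) = t `^ (s - 1) * Gamma (1 - s).
Proof.
move=> s01 t0; have I1 := Int_wt_exp s01 ltr01.
have -> : Gamma (1 - s) = \int[mu]_l (wt s l * expR (- 1 * l)).
  rewrite /Gamma Rintegral_mkcond; apply: eq_int => l.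
  rewrite patchE mem_setE in_itv/= andbT /wt; case: ifP => _; last by rewrite mul0r.
  by rewrite mulN1r; congr (_ `^ _ * _); ring.
rewrite (int_affine 0 (lt0r_neq0 t0) I1) gtr0_norm//.
have E l : wt s (t * l + 0) * expR (- 1 * (t * l + 0)) = t `^ (- s) * (wt s l * expR (- t * l)).
  by rewrite addr0 wt_scale// mulN1r mulNr mulrA.
have P : t `^ (s - 1) * (t * t `^ (- s)) = 1.
  have -> : t * t `^ (- s) = t `^ 1 * t `^ (- s) by rewrite powRr1// ltW.
  rewrite -!powRD ?(gt_eqF t0) ?implybT//.
  have -> : s - 1 + (1 - s) = 0 by ring.
  by rewrite powRr0.
by rewrite (eq_int E) (intZl _ (Int_wt_exp s01 t0)) [t * _]mulrA mulrA P mul1r.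
Qed.

Lemma int_pos_on_unit f : Int f -> (forall x, 0 <= f x) -> (forall x, 0 < x -> 0 < f x) ->
  0 < \int[mu]_x f x.
Proof.
move=> If f0 fp; rewrite lt_neqAle int_ge0// andbT eq_sym; apply/negP => /eqP E.
have [N [mN N0 HN]] := Int_0_ae If f0 E.
have : (mu (`]0%R, 1%R[%classic : set R) <= mu N)%E.
  apply: le_measure; rewrite ?inE//.
  move=> x /=; rewrite in_itv/= => /andP[x0 _]; apply: HN => /= fx.
  by have := fp x x0; rewrite fx ltxx.
by rewrite N0 lebesgue_measure_itv/= lte_fin ltr01 -EFinB subr0 lee_fin ler10.
Qed.

Lemma Gamma_gt0 s : 0 < s < 1 -> 0 < Gamma s.
Proof.
move=> /andP[s0 s1]; have t01 : 0 < 1 - s < 1 by apply/andP; split; lra.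
have := int_wt_exp t01 ltr01; rewrite powR1 mul1r => E.
have -> : s = 1 - (1 - s) by ring.
rewrite -E; apply: int_pos_on_unit; first exact: Int_wt_exp.
  by move=> x; rewrite mulr_ge0 ?wt_ge0 ?expR_ge0.
by move=> x x0; rewrite mulr_gt0 ?expR_gt0// /wt x0 powR_gt0.
Qed.

(** The cosine and sine transforms of [x^(s-1)] at frequency [1], up to the factor
    [Gamma (1 - s)]. Their positivity is what the inversion of the symbol rests on. *)
Definition cos_cst s : R := \int[mu]_l (wt s l * (l / (l ^+ 2 + 1))).
Definition sin_cst s : R := \int[mu]_l (wt s l * (1 / (l ^+ 2 + 1))).

Lemma measurable_ratio (a b w : R) : w != 0 ->
  measurable_fun setT (fun l : R => (a * l + b) / (l ^+ 2 + w ^+ 2)).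
Proof.
move=> w0; apply: continuous_measurable_fun => x; apply: cvgM.
  by apply: cvgD; [exact: continuous_scale|exact: cvg_cst].
apply: cvgV; first by rewrite addrC gt_eqF//; apply: ltr_pwDl; rewrite ?sqr_ge0// exprn_even_gt0.
by apply: cvgD; [exact: exprn_continuous|exact: cvg_cst].
Qed.

Lemma Int_cos_cst s : 0 < s < 1 -> Int (fun l => wt s l * (l / (l ^+ 2 + 1))).
Proof.
move=> s01; apply: (Int_wt_mul (p := 1) s01).
- by have := measurable_ratio 1 0 (oner_neq0 R); under eq_fun do rewrite mul1r addr0 expr1n.
- by move: s01 => /andP[]; lra.
- move=> l l0; have D : 0 < l ^+ 2 + 1 by rewrite ltr_wpDl ?sqr_ge0.
  rewrite divr_ge0 ?(ltW l0) ?(ltW D)//= ler_pdivrMr// mul1r.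
  by have := sqr_ge0 (l - 1); nra.
- move=> l l1; have l0 : 0 < l by lra.
  have D : 0 < l ^+ 2 + 1 by rewrite ltr_wpDl ?sqr_ge0.
  by rewrite powRN1// ler_pdivrMr// mulrC ler_pdivlMr//; nra.
Qed.

Lemma Int_sin_cst s : 0 < s < 1 -> Int (fun l => wt s l * (1 / (l ^+ 2 + 1))).
Proof.
move=> s01; apply: (Int_wt_mul (p := 1) s01).
- by have := measurable_ratio 0 1 (oner_neq0 R); under eq_fun do rewrite mul0r add0r expr1n.
- by move: s01 => /andP[]; lra.
- move=> l l0; have D : 0 < l ^+ 2 + 1 by rewrite ltr_wpDl ?sqr_ge0.
  rewrite divr_ge0 ?(ltW D)//= ler_pdivrMr// mul1r.
  by have := sqr_ge0 l; lra.
- move=> l l1; have l0 : 0 < l by lra.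
  have D : 0 < l ^+ 2 + 1 by rewrite ltr_wpDl ?sqr_ge0.
  by rewrite powRN1// ler_pdivrMr// mulrC ler_pdivlMr//; nra.
Qed.

Lemma cos_cst_gt0 s : 0 < s < 1 -> 0 < cos_cst s.
Proof.
move=> s01; have D l : 0 < l ^+ 2 + 1 :> R by rewrite ltr_wpDl ?sqr_ge0.
apply: int_pos_on_unit; first exact: Int_cos_cst.
  move=> l; rewrite /wt; case: ifPn => l0; last by rewrite mul0r.
  by rewrite mulr_ge0 ?powR_ge0// divr_ge0// ltW.
by move=> l l0; rewrite /wt l0 mulr_gt0 ?powR_gt0// divr_gt0.
Qed.

Lemma sin_cst_gt0 s : 0 < s < 1 -> 0 < sin_cst s.
Proof.
move=> s01; have D l : 0 < l ^+ 2 + 1 :> R by rewrite ltr_wpDl ?sqr_ge0.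
apply: int_pos_on_unit; first exact: Int_sin_cst.
  by move=> l; rewrite mulr_ge0 ?wt_ge0// divr_ge0// ltW.
by move=> l l0; rewrite /wt l0 mulr_gt0 ?powR_gt0// divr_gt0.
Qed.

(** Homogeneity of the weight. *)
Let scale_cst s (w : R) g : 0 < w -> Int (fun l => wt s l * g l) ->
  Int (fun l => wt s l * g (w^-1 * l)) /\
  \int[mu]_l (wt s l * g (w^-1 * l)) = w `^ (1 - s) * \int[mu]_l (wt s l * g l).
Proof.
move=> w0 Ig; have wV : 0 < w^-1 by rewrite invr_gt0.
have I1 := Int_affine 0 (lt0r_neq0 wV) Ig.
have E l : wt s (w^-1 * l + 0) * g (w^-1 * l + 0) = w `^ s * (wt s l * g (w^-1 * l)).
  rewrite addr0 wt_scale// mulrA; congr (_ * _ * _).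
  by rewrite -powRN1// -powRrM mulN1r opprK.
rewrite (funext E) in I1.
have I2 : Int (fun l => wt s l * g (w^-1 * l)).
  have := IntZl (w `^ (- s)) I1; congr Int; apply/funext => l.
  by rewrite mulrA -powRD ?addNr ?eqxx ?gt_eqF// powRr0 mul1r.
have P : w `^ (1 - s) * (w^-1 * w `^ s) = 1.
  rewrite -powRN1// -!powRD ?(gt_eqF w0) ?implybT//.
  have -> : 1 - s + (-1 + s) = 0 by ring.
  by rewrite powRr0.
split=> //; rewrite (int_affine 0 (lt0r_neq0 wV) Ig) gtr0_norm// (eq_int E).
by rewrite (intZl _ I2) [w^-1 * _]mulrA mulrA P mul1r.
Qed.

Lemma int_cos_cst s (w : R) : 0 < s < 1 -> 0 < w ->
  Int (fun l => wt s l * (l / (l ^+ 2 + w ^+ 2))) /\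
  \int[mu]_l (wt s l * (l / (l ^+ 2 + w ^+ 2))) = w `^ (- s) * cos_cst s.
Proof.
move=> s01 w0; have [I1 E1] := scale_cst w0 (Int_cos_cst s01).
have E l : w^-1 * (wt s l * ((w^-1 * l) / ((w^-1 * l) ^+ 2 + 1))) =
    wt s l * (l / (l ^+ 2 + w ^+ 2)).
  have D : l ^+ 2 + w ^+ 2 != 0 by rewrite addrC gt_eqF// sqrD_gt0.
  by field; rewrite (gt_eqF w0)/= D.
have I2 := IntZl w^-1 I1; rewrite (funext E) in I2.
split=> //; rewrite -(eq_int E); apply: (etrans (intZl w^-1 I1)).
rewrite E1 mulrA; congr (_ * _).
rewrite -powRN1// -powRD ?(gt_eqF w0) ?implybT//; congr (_ `^ _); ring.
Qed.

Lemma int_sin_cst s (w : R) : 0 < s < 1 -> 0 < w ->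
  Int (fun l => wt s l * (w / (l ^+ 2 + w ^+ 2))) /\
  \int[mu]_l (wt s l * (w / (l ^+ 2 + w ^+ 2))) = w `^ (- s) * sin_cst s.
Proof.
move=> s01 w0; have [I1 E1] := scale_cst w0 (Int_sin_cst s01).
have E l : w^-1 * (wt s l * (1 / ((w^-1 * l) ^+ 2 + 1))) =
    wt s l * (w / (l ^+ 2 + w ^+ 2)).
  have D : l ^+ 2 + w ^+ 2 != 0 by rewrite addrC gt_eqF// sqrD_gt0.
  by field; rewrite (gt_eqF w0)/= D.
have I2 := IntZl w^-1 I1; rewrite (funext E) in I2.
split=> //; rewrite -(eq_int E); apply: (etrans (intZl w^-1 I1)).
rewrite E1 mulrA; congr (_ * _).
rewrite -powRN1// -powRD ?(gt_eqF w0) ?implybT//; congr (_ `^ _); ring.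
Qed.

End Powers.

(** * Fractional integrals and their symbols *)
Section FractionalIntegrals.
Context {R : realType}.
Local Notation mu := (@lebesgue_measure R).
Implicit Types (f g h u phi chi K : R -> R) (x y z xi l s t : R) (d : bool).

(** The direction: [true] for the left operators, [false] for the right ones. *)
Definition sgd d : R := if d then 1 else -1.

Lemma sgd_sqr d : sgd d * sgd d = 1.
Proof. by case: d; rewrite /sgd ?mulr1// mulrNN mulr1. Qed.

Lemma sgd_neq0 d : sgd d != 0.
Proof. by case: d; rewrite /sgd ?oppr_eq0 oner_eq0. Qed.

Lemma norm_sgd d : `|sgd d| = 1.
Proof. by case: d; rewrite /sgd ?normrN normr1. Qed.

Lemma sgdN d : sgd (~~ d) = - sgd d.
Proof. by case: d; rewrite /sgd /= ?opprK. Qed.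

(** The kernel [z^(s-1)] on the half-line of the direction [d], so that both fractional
    integrals are convolutions over the whole line. *)
Definition rlk s d z : R := if 0 < sgd d * z then (sgd d * z) `^ (s - 1) else 0.

Definition RL s d u x : R := (Gamma s)^-1 * \int[mu]_y (rlk s d (x - y) * u y).

Lemma RLint_lE s u x : RLint_l s u x = RL s true u x.
Proof.
rewrite /RLint_l /RL; congr (_ * _); rewrite Rintegral_mkcond; apply: eq_int => y.
rewrite patchE mem_setE in_itv/= /rlk /sgd mul1r subr_gt0 /kernel_l.
by case: ifP => //; rewrite mul0r.
Qed.

Lemma RLint_rE s u x : RLint_r s u x = RL s false u x.
Proof.
rewrite /RLint_r /RL; congr (_ * _); rewrite Rintegral_mkcond; apply: eq_int => y.
rewrite patchE mem_setE in_itv/= andbT /rlk /sgd mulN1r opprB subr_gt0 /kernel_r.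
by case: ifP => //; rewrite mul0r.
Qed.

Lemma integrable_kernel_l s u x :
  mu.-integrable `]-oo, x[ (EFin \o kernel_l s u x) <->
  Int (fun y => rlk s true (x - y) * u y).
Proof.
have -> : (fun y => rlk s true (x - y) * u y) = (kernel_l s u x) \_ `]-oo, x[.
  apply/funext => y; rewrite patchE mem_setE in_itv/= /rlk /sgd mul1r subr_gt0 /kernel_l.
  by case: ifP => //; rewrite mul0r.
exact: Int_patch.
Qed.

Lemma integrable_kernel_r s u x :
  mu.-integrable `]x, +oo[ (EFin \o kernel_r s u x) <->
  Int (fun y => rlk s false (x - y) * u y).
Proof.
have -> : (fun y => rlk s false (x - y) * u y) = (kernel_r s u x) \_ `]x, +oo[.
  apply/funext => y; rewrite patchE mem_setE in_itv/= andbT /rlk /sgd mulN1r opprB subr_gt0 /kernel_r.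
  by case: ifP => //; rewrite mul0r.
exact: Int_patch.
Qed.

Lemma rlk_ge0 s d z : 0 <= rlk s d z.
Proof. by rewrite /rlk; case: ifP => // _; exact: powR_ge0. Qed.

Lemma rlkE s d z : rlk s d z = wt (1 - s) (sgd d * z + 0).
Proof. by rewrite /rlk /wt addr0 opprB. Qed.

Lemma measurable_rlk s d : measurable_fun setT (rlk s d).
Proof.
rewrite (funext (rlkE s d)); apply: (measurableT_comp (measurable_wt _)).
exact: measurable_affine.
Qed.

(** Kernels dominated by a summable function plus a constant, which act on bounded
    summable functions. This covers at once the singular kernels [z^(s-1)], not summable at
    infinity, and the exponentials into which they decompose. *)
Definition tame K (k0 : R -> R) : Prop :=
  [/\ measurable_fun setT K, Int k0, forall z, 0 <= k0 z & forall z, `|K z| <= k0 z + 1].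

Definition bdd phi (M : R) : Prop := Int phi /\ forall x, `|phi x| <= M.

Lemma bdd_L2 phi M : bdd phi M -> phi \in L2.
Proof.
move=> [Ip pM]; apply/L2P; split; first exact: Int_mfun.
by under eq_fun do rewrite expr2; exact: (Int_bounded_mul (Int_mfun Ip) pM Ip).
Qed.

Lemma bdd_norm phi M : bdd phi M -> bdd (fun x => `|phi x|) M.
Proof. by move=> [Ip pM]; split; [exact: Int_norm|move=> x; rewrite normr_id]. Qed.

Lemma bdd_ge0 phi M : bdd phi M -> 0 <= M.
Proof. by move=> [_ /(_ 0)]; exact: le_trans. Qed.

Definition rlk0 s d z : R := (sgd d * z + 0) `^ (s - 1) * \1_(`]0, 1]) (sgd d * z + 0).

Lemma rlk_tame s d : 0 < s < 1 -> tame (rlk s d) (rlk0 s d).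
Proof.
move=> /andP[s0 s1]; split.
- exact: measurable_rlk.
- have I : Int (fun x => x `^ (s - 1) * \1_(`]0, 1]) x) by apply: Int_powR_near0; lra.
  exact: (Int_affine 0 (sgd_neq0 d) I).
- by move=> z; rewrite mulr_ge0 ?powR_ge0// indicE.
- move=> z; rewrite ger0_norm ?rlk_ge0// /rlk0 addr0 /rlk.
  have A0 : 0 <= (sgd d * z) `^ (s - 1) * \1_(`]0, 1]) (sgd d * z) by rewrite mulr_ge0 ?powR_ge0// indicE.
  case: ifPn => [z0|_]; last by rewrite addr_ge0.
  have [z1|z1] := leP (sgd d * z) 1.
    by rewrite indicE mem_set ?mulr1 ?lerDl//= in_itv/= z0.
  rewrite -[leLHS]add0r lerD// -[leRHS](powRr0 (sgd d * z)) ler_powR ?ltW//; lra.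
Qed.

Lemma Int_tame K k0 phi M x : tame K k0 -> bdd phi M ->
  Int (fun y => K (x - y) * phi y).
Proof.
move=> [mK I0 k00 Kk] [Ip pM]; have mp := Int_mfun Ip.
apply: (Int_le _ _ (IntD (IntZl M (Int_sub x I0)) (Int_norm Ip))).
  apply: measurable_funM => //; apply: (measurableT_comp mK).
  exact: measurable_funB.
move=> y; rewrite normrM; apply: (le_trans (ler_wpM2r (normr_ge0 _) (Kk _))).
by rewrite mulrDl mul1r lerD2r mulrC ler_wpM2r.
Qed.

Lemma tame_bound K k0 phi M x : tame K k0 -> bdd phi M ->
  `|\int[mu]_y (K (x - y) * phi y)| <= M * (\int[mu]_z k0 z) + \int[mu]_y `|phi y|.
Proof.
move=> tK bp; have IK := Int_tame x tK bp; case: tK bp => [mK I0 k00 Kk] [Ip pM].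
apply: (le_trans (int_norm IK)).
rewrite -(int_sub x I0) -(intZl M (Int_sub x I0)) -(intD (IntZl M (Int_sub x I0)) (Int_norm Ip)).
apply: int_le; [exact: Int_norm|exact: IntD (IntZl M (Int_sub x I0)) (Int_norm Ip)|].
move=> y; rewrite normrM; apply: (le_trans (ler_wpM2r (normr_ge0 _) (Kk _))).
by rewrite mulrDl mul1r lerD2r mulrC ler_wpM2r.
Qed.

(** By Fubini, pairing [K * phi] with [chi] amounts to pairing [K] with [xcorr phi chi],
    which makes the dependence on the kernel linear and explicit. *)
Definition xcorr phi chi z : R := \int[mu]_x (phi (x - z) * chi x).

Lemma Int_xcorr_section phi chi M z : bdd phi M -> Int chi ->
  Int (fun x => phi (x - z) * chi x).
Proof.
move=> [Ip pM] Ic; apply: (Int_bounded_mul _ (fun x => pM _) Ic).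
exact: (Int_mfun (Int_shift z Ip)).
Qed.

Lemma Int_xcorr phi chi : Int phi -> Int chi -> Int (xcorr phi chi).
Proof.
move=> Ip Ic; have := Int_convolution (Int_refl Ip) Ic; congr Int.
by apply/funext => z; apply: eq_int => x; rewrite opprB.
Qed.

Lemma xcorr_bound phi chi M z : bdd phi M -> Int chi ->
  `|xcorr phi chi z| <= M * \int[mu]_x `|chi x|.
Proof.
move=> bp Ic; have I := Int_xcorr_section z bp Ic.
apply: (le_trans (int_norm I)); rewrite -intZl; last exact: Int_norm.
apply: int_le; [exact: Int_norm|exact/IntZl/Int_norm|].
by move=> x; rewrite normrM ler_wpM2r//; exact: bp.2.
Qed.

Lemma Int_tame_xcorr K k0 phi chi M : tame K k0 -> bdd phi M -> Int chi ->
  Int (fun z => K z * xcorr phi chi z).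
Proof.
move=> [mK I0 k00 Kk] bp Ic; have Iq := Int_xcorr bp.1 Ic.
apply: (Int_le _ _ (IntD (IntZr (M * \int[mu]_x `|chi x|) I0) (Int_norm Iq))).
  by apply: measurable_funM => //; exact: Int_mfun.
move=> z; rewrite normrM; apply: (le_trans (ler_wpM2r (normr_ge0 _) (Kk _))).
rewrite mulrDl mul1r lerD2r; apply: ler_wpM2l => //.
exact: xcorr_bound.
Qed.

Lemma tame_norm K k0 : tame K k0 -> tame (fun z => `|K z|) k0.
Proof.
by move=> [mK I0 k00 Kk]; split=> // [|z]; [exact: measurableT_comp|rewrite normr_id].
Qed.

Lemma measurable_tame K k0 phi M : tame K k0 -> bdd phi M ->
  measurable_fun setT (fun x => \int[mu]_y (K (x - y) * phi y)).
Proof.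
move=> tK bp; have [mK I0 k00 Kk] := tK; have [Ip pM] := bp.
pose Kn (n : nat) z := K z * \1_(`[- n%:R, n%:R]) z.
have IKn n : Int (Kn n).
  have I1 : Int (\1_(`[- n%:R, n%:R]) : R -> R) by exact: integrable_indic_itv.
  apply: (Int_le _ _ (IntD I0 I1)).
    by apply: measurable_funM => //; exact: measurable_indic.
  move=> z; rewrite /Kn normrM indicE; case: (_ \in _) => /=.
    by rewrite normr1 mulr1; exact: Kk.
  by rewrite normr0 mulr0 addr0.
apply: (@measurable_fun_cvg _ _ R setT (fun n x => \int[mu]_y (Kn n (x - y) * phi y))).
  by move=> n; exact: Int_mfun (Int_convolution (IKn n) Ip).
move=> x _; have Ix := Int_tame x tK bp.
have [|||||_] // := @int_DC R (fun n y => Kn n (x - y) * phi y)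
  (fun y => K (x - y) * phi y) (fun y => `|K (x - y) * phi y|).
- move=> n; apply: measurable_funM; last exact: Int_mfun.
  exact: (Int_mfun (Int_sub x (IKn n))).
- exact: Int_mfun Ix.
- apply: aeW => y; apply: cvg_near_cst; near=> n.
  rewrite /Kn indicE mem_set ?mulr1//= in_itv/= -ler_norml.
  by near: n; exact: nbhs_infty_ger.
- apply: aeW => y n; rewrite normrM [leRHS]normrM ler_wpM2r// /Kn normrM indicE.
  by case: (_ \in _) => /=; rewrite ?normr1 ?normr0 ?mulr1 ?mulr0.
- exact: Int_norm.
Unshelve. all: by end_near. Qed.

Lemma tame_pairing K k0 phi chi M : tame K k0 -> bdd phi M -> Int chi ->
  Int (fun x => (\int[mu]_y (K (x - y) * phi y)) * chi x) /\
  \int[mu]_x ((\int[mu]_y (K (x - y) * phi y)) * chi x) =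
  \int[mu]_z (K z * xcorr phi chi z).
Proof.
move=> tK bp Ic; have [mK I0 k00 Kk] := tK; have [Ip pM] := bp.
have mc := Int_mfun Ic; have mp := Int_mfun Ip.
pose F (p : R * R) := K p.2 * (phi (p.1 - p.2) * chi p.1).
have mF : measurable_fun setT F.
  apply: measurable_funM; first exact: (measurableT_comp mK measurable_snd).
  by apply: measurable_funM; [exact: measurable_sub2|exact: (measurableT_comp mc measurable_fst)].
have bpn := bdd_norm bp; have Icn := Int_norm Ic.
have [] := Fubini_package mF.
  apply: (@Fubini_majorant_swap _ F (fun z x => `|K z| * (`|phi (x - z)| * `|chi x|)) mF).
    apply: aeW => z; split; first by apply: IntZl; exact: (Int_xcorr_section z bpn Icn).
    by move=> x; rewrite /F/= !normrM.
  have E z : \int[mu]_x (`|K z| * (`|phi (x - z)| * `|chi x|)) =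
      `|K z| * xcorr (fun x => `|phi x|) (fun x => `|chi x|) z.
    by rewrite (intZl _ (Int_xcorr_section z bpn Icn)).
  by rewrite (funext E); exact: (Int_tame_xcorr (tame_norm tK) bpn Icn).
move=> _ _ I1 _ E.
have E1 x : \int[mu]_z F (x, z) = (\int[mu]_y (K (x - y) * phi y)) * chi x.
  have Ix := Int_tame x tK bp.
  rewrite -(intZr _ Ix) -(int_sub x (IntZr (chi x) Ix)).
  by apply: eq_int => z; rewrite /F/= subKr mulrA.
split; first by rewrite -(funext E1).
rewrite -(eq_int E1) E; apply: eq_int => z.
by rewrite -(intZl _ (Int_xcorr_section z bp Ic)).
Qed.

(** * The symbol of the exponential kernels *)
Definition ek d l z : R := exph l (sgd d * z + 0).

Lemma Int_ek d l : 0 < l -> Int (ek d l).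
Proof. by move=> l0; have := Int_affine 0 (sgd_neq0 d) (Int_exph l0). Qed.

Lemma ek_ge0 d l z : 0 <= ek d l z.
Proof. exact: exph_ge0. Qed.

Lemma ek_le1 d l z : 0 <= l -> ek d l z <= 1.
Proof.
move=> l0; rewrite /ek exphE; case: ifP => // z0.
by rewrite expR_le1 mulNr oppr_le0 mulr_ge0.
Qed.

Lemma ek_tame d l : 0 < l -> tame (ek d l) (fun=> 0).
Proof.
move=> l0; split; [exact: Int_mfun (Int_ek d l0)|exact: Int0|by []|].
by move=> z; rewrite add0r ger0_norm ?ek_ge0// ek_le1// ltW.
Qed.

Lemma int_ek f d l : 0 < l -> measurable_fun setT f -> (forall x, `|f x| <= 1) ->
  \int[mu]_z (f z * ek d l z) = \int[mu]_z (f (sgd d * z) * exph l z).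
Proof.
move=> l0 mf f1.
have mfd : measurable_fun setT (fun z => f (sgd d * z)).
  by apply: (measurableT_comp mf); exact: measurable_funM.
have I : Int (fun z => f (sgd d * z) * exph l z).
  by apply: (Int_bounded_mul mfd (fun z => f1 _)); exact: Int_exph.
rewrite (int_affine 0 (sgd_neq0 d) I) norm_sgd mul1r.
by apply: eq_int => z; rewrite /ek addr0 mulrA sgd_sqr mul1r.
Qed.

Lemma cos_sgd d x : cos (sgd d * x) = cos x.
Proof. by case: d; rewrite /sgd ?mul1r// mulN1r cosN. Qed.

Lemma sin_sgd d x : sin (sgd d * x) = sgd d * sin x.
Proof. by case: d; rewrite /sgd ?mul1r// !mulN1r sinN. Qed.

Lemma int_cos_ek d l w : 0 < l ->
  \int[mu]_z (cos (w * z) * ek d l z) = l / (l ^+ 2 + w ^+ 2).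
Proof.
move=> l0; rewrite (int_ek d l0 (measurable_cos_scale w)); last by move=> x; exact: abs_cos_le1.
rewrite -(int_cos_exph w l0); apply: eq_int => z.
by rewrite mulrCA cos_sgd.
Qed.

Lemma int_sin_ek d l w : 0 < l ->
  \int[mu]_z (sin (w * z) * ek d l z) = sgd d * (w / (l ^+ 2 + w ^+ 2)).
Proof.
move=> l0; rewrite (int_ek d l0 (measurable_sin_scale w)); last by move=> x; exact: abs_sin_le1.
rewrite -(int_sin_exph w l0) -intZl.
  by apply: eq_int => z; rewrite mulrCA sin_sgd mulrA.
by apply: (Int_bounded_mul (measurable_sin_scale w) (fun x => abs_sin_le1 _)); exact: Int_exph.
Qed.

(** By the addition formula, convolution with a one-sided kernel mixes the values of the
    transform at [xi] and [- xi], with coefficients its cosine and sine transforms. *)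
Lemma hartley_ek d l phi xi : 0 < l -> Int phi ->
  hartley (fun x => \int[mu]_y (ek d l (x - y) * phi y)) xi =
  (l * hartley phi xi + sgd d * (2 * pi * xi) * hartley phi (- xi)) /
  (l ^+ 2 + (2 * pi * xi) ^+ 2).
Proof.
move=> l0 Ip; have Ie := Int_ek d l0.
have [_ _ E] := convolution_pairing Ie Ip (measurable_casl xi) (fun x => abs_cas_le2 _).
have -> : hartley (fun x => \int[mu]_y (ek d l (x - y) * phi y)) xi =
   \int[mu]_x ((\int[mu]_y (ek d l (x - y) * phi y)) * cas (2 * pi * x * xi)).
  by apply: eq_int => x; rewrite mulrC.
rewrite E.
set w := 2 * pi * xi; set D := l ^+ 2 + w ^+ 2.
have Ic : Int (fun z => cos (w * z) * ek d l z).
  by apply: (Int_bounded_mul (measurable_cos_scale w) (fun x => abs_cos_le1 _)).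
have Is : Int (fun z => sin (w * z) * ek d l z).
  by apply: (Int_bounded_mul (measurable_sin_scale w) (fun x => abs_sin_le1 _)).
have H y : phi y * \int[mu]_x (ek d l (x - y) * cas (2 * pi * x * xi)) =
    (l / D) * (cas (2 * pi * y * xi) * phi y) +
    (sgd d * (w / D)) * (cas (2 * pi * y * (- xi)) * phi y).
  rewrite -(int_cos_ek d w l0) -(int_sin_ek d w l0).
  have Ics := IntD (IntZl (cas (2 * pi * y * xi)) Ic) (IntZl (cas (2 * pi * y * (- xi))) Is).
  have -> : \int[mu]_x (ek d l (x - y) * cas (2 * pi * x * xi)) =
     \int[mu]_z (cas (2 * pi * y * xi) * (cos (w * z) * ek d l z) +
                cas (2 * pi * y * (- xi)) * (sin (w * z) * ek d l z)).
    rewrite -(int_shift y Ics); apply: eq_int => x.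
    have -> : 2 * pi * x * xi = 2 * pi * y * xi + w * (x - y) by rewrite /w; ring.
    by rewrite casD mulrN; ring.
  rewrite (intD (IntZl _ Ic) (IntZl _ Is)) (intZl _ Ic) (intZl _ Is); ring.
rewrite (eq_int H).
rewrite (intD (IntZl _ (Int_cas xi Ip)) (IntZl _ (Int_cas (- xi) Ip))).
rewrite (intZl _ (Int_cas xi Ip)) (intZl _ (Int_cas (- xi) Ip)) -/(hartley phi xi) -/(hartley phi (- xi)).
by rewrite mulrDl; ring.
Qed.

Lemma ek_pairing d l phi M chi : 0 < l -> bdd phi M -> test_function chi ->
  let H xi := (l * hartley phi xi + sgd d * (2 * pi * xi) * hartley phi (- xi)) /
     (l ^+ 2 + (2 * pi * xi) ^+ 2) * hartley chi xi in
  Int H /\ \int[mu]_z (ek d l z * xcorr phi chi z) = \int[mu]_xi H xi.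
Proof.
move=> l0 bp tc H; have Ic := test_function_Int tc; have te := ek_tame d l0.
have [_ <-] := tame_pairing te bp Ic.
have Iw := Int_convolution (Int_ek d l0) bp.1.
have [M' bw] : exists M', bdd (fun x => \int[mu]_y (ek d l (x - y) * phi y)) M'.
  by eexists; split; [exact: Iw|move=> x; exact: (tame_bound x te bp)].
have Lw := bdd_L2 bw.
have E xi : hartley (fun x => \int[mu]_y (ek d l (x - y) * phi y)) xi * hartley chi xi = H xi.
  by rewrite (hartley_ek d xi l0 bp.1).
rewrite -(hartley_test_Parseval Iw Lw tc); split; last exact: eq_int.
rewrite -(funext E); apply: L2_mul; first exact: (hartley_contraction Iw Lw).1.
exact: (hartley_contraction Ic (test_function_L2 tc)).1.
Qed.

End FractionalIntegrals.

Section Symbol.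
Context {R : realType}.
Local Notation mu := (@lebesgue_measure R).
Implicit Types (f g h u phi chi K : R -> R) (x y z xi l s t p : R) (d : bool).

(** Over the reals the Fourier multiplier [|w|^p (a - i b sgn w)], [w = 2 pi xi],
    couples the frequencies [xi] and [- xi] of the Hartley transform. *)
Definition mult p (a b : R) h xi : R := freq xi `^ p * (a * h xi + b * Num.sg xi * h (- xi)).

Lemma measurable_sgr : measurable_fun setT (@Num.sg R).
Proof.
have E (x : R) : Num.sg x = \1_(`]0, +oo[) x - \1_(`]-oo, 0[) x.
  rewrite !indicE !mem_setE !in_itv/= andbT.
  have [x0|x0|<-] := ltgtP 0 x; last by rewrite sgr0 subrr.
    by rewrite gtr0_sg// subr0.
  by rewrite ltr0_sg// sub0r.
by rewrite (funext E); apply: measurable_funB; exact: measurable_indic.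
Qed.

Lemma measurable_mult p a b h : measurable_fun setT h ->
  measurable_fun setT (mult p a b h).
Proof.
move=> mh; apply: measurable_funM; first exact: measurable_freq_powR.
apply: measurable_funD; first by apply: measurable_funM; [exact: measurable_cst|exact: mh].
apply: measurable_funM; last exact: measurable_fun_refl.
apply: measurable_funM; [exact: measurable_cst|exact: measurable_sgr].
Qed.

Lemma subordination s d z : 0 < s < 1 -> z != 0 ->
  Int (fun l => wt s l * ek d l z) /\
  \int[mu]_l (wt s l * ek d l z) = Gamma (1 - s) * rlk s d z.
Proof.
move=> s01 z0; rewrite /rlk.
have : sgd d * z != 0 by rewrite mulf_neq0// sgd_neq0.
rewrite neq_lt => /orP[t0|t0].
  rewrite ltNge (ltW t0)/= mulr0.
  have E l : wt s l * ek d l z = 0 by rewrite /ek exphE addr0 leNgt t0/= mulr0.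
  by rewrite (funext E); split; [exact: Int0|rewrite /Rintegral integral0].
rewrite t0; have E l : wt s l * ek d l z = wt s l * expR (- (sgd d * z) * l).
  by rewrite /ek exphE addr0 (ltW t0) !mulNr (mulrC l).
rewrite (funext E); split; first exact: Int_wt_exp.
by rewrite int_wt_exp// mulrC.
Qed.

Lemma measurable_ek2 d : measurable_fun setT (fun p : R * R => ek d p.2 p.1).
Proof.
have E (p : R * R) : ek d p.2 p.1 = expR (- p.2 * (sgd d * p.1)) * \1_(`[0, +oo[) (sgd d * p.1).
  rewrite /ek exphE addr0 indicE mem_setE in_itv/= andbT.
  by case: ifP => _; rewrite ?mulr1 ?mulr0.
have m1 : measurable_fun setT (fun p : R * R => sgd d * p.1).
  by apply: measurable_funM => //; exact: measurable_fst.
rewrite (funext E); apply: measurable_funM.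
  have mexp : measurable_fun setT (@expR R).
    by apply: continuous_measurable_fun; exact: continuous_expR.
  apply: (measurableT_comp mexp); apply: measurable_funM => //.
  by apply: measurable_funN; exact: measurable_snd.
by apply: (measurableT_comp _ m1); exact: measurable_indic.
Qed.

(** The kernel [z^(s-1)] is replaced by its mixture of exponentials. *)
Lemma rlk_pairing_sub s d phi M chi : 0 < s < 1 -> bdd phi M -> test_function chi ->
  Gamma (1 - s) * \int[mu]_z (rlk s d z * xcorr phi chi z) =
  \int[mu]_l (wt s l * \int[mu]_z (ek d l z * xcorr phi chi z)).
Proof.
move=> s01 bp tc; have Ic := test_function_Int tc.
set Q := xcorr phi chi; have IQ : Int Q := Int_xcorr bp.1 Ic.
have IrQ : Int (fun z => rlk s d z * Q z) := Int_tame_xcorr (rlk_tame d s01) bp Ic.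
pose F (p : R * R) := wt s p.2 * ek d p.2 p.1 * Q p.1.
have mF : measurable_fun setT F.
  apply: measurable_funM; last exact: (measurableT_comp (Int_mfun IQ) measurable_fst).
  apply: measurable_funM; first exact: (measurableT_comp (measurable_wt s) measurable_snd).
  exact: measurable_ek2.
have [] := Fubini_package mF.
  (* At [z = 0] the mixture of exponentials diverges. *)
  apply: (@Fubini_majorant _ F (fun z l => if z == 0 then 0 else wt s l * ek d l z * `|Q z|) mF).
    apply: aeS ae_neq0 => z z0; rewrite (negbTE z0).
    split; first by apply: IntZr; exact: (subordination d s01 z0).1.
    by move=> l; rewrite /F/= normrM ger0_norm// mulr_ge0 ?wt_ge0 ?ek_ge0.
  have := IntZl (Gamma (1 - s)) (Int_norm IrQ); congr Int; apply/funext => z.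
  have [->|z0] := eqVneq z 0.
    by rewrite /rlk mulr0 ltxx mul0r normr0 mulr0 /Rintegral integral0.
  have [I E] := subordination d s01 z0.
  by rewrite (intZr _ I) E normrM (ger0_norm (rlk_ge0 _ _ _)) mulrA.
move=> _ _ I1 _ E.
have -> : \int[mu]_l (wt s l * \int[mu]_z (ek d l z * Q z)) = \int[mu]_l \int[mu]_z F (z, l).
  apply: eq_int => l; have [l0|l0] := ltP 0 l.
    have I := Int_tame_xcorr (ek_tame d l0) bp Ic.
    by rewrite -(intZl _ I); apply: eq_int => z; rewrite /F/= mulrA.
  have wt0 : wt s l = 0 by rewrite /wt ltNge l0.
  rewrite wt0 mul0r /F; under [RHS]eq_int do rewrite /= wt0 !mul0r.
  by rewrite /Rintegral integral0.
rewrite -E -(intZl _ IrQ); apply: int_ae_eq.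
- exact: Int_mfun (IntZl _ IrQ).
- exact: Int_mfun I1.
- apply: aeS ae_neq0 => z z0; have [I E2] := subordination d s01 z0.
  by rewrite /F/= (intZr _ I) E2 mulrA.
Qed.

Lemma sg_freq xi : Num.sg xi * freq xi = 2 * pi * xi.
Proof.
rewrite /freq normrM (gtr0_norm twopi_gt0) mulrCA; congr (_ * _).
by rewrite -numEsg.
Qed.

Lemma freq_gt0 xi : xi != 0 -> 0 < freq xi.
Proof. by move=> x0; rewrite normr_gt0 mulf_neq0// gt_eqF// twopi_gt0. Qed.

Lemma freq_sqr xi : freq xi ^+ 2 = (2 * pi * xi) ^+ 2.
Proof. by rewrite real_normK// num_real. Qed.

Lemma measurable_invD2 : measurable_fun setT (fun p : R * R => (p.2 ^+ 2 + (2 * pi * p.1) ^+ 2)^-1).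
Proof.
have E (p : R * R) : (p.2 ^+ 2 + (2 * pi * p.1) ^+ 2)^-1 = (p.2 ^+ 2 + (2 * pi * p.1) ^+ 2) `^ (-1).
  by rewrite powR_inv1// addr_ge0 ?sqr_ge0.
rewrite (funext E); apply: (measurableT_comp (measurable_powR _)).
apply: measurable_funD; apply: measurable_funX; first exact: measurable_snd.
by apply: measurable_funM => //; exact: measurable_fst.
Qed.

(** On the frequency side each exponential has a rational symbol in [w = 2 pi xi]; mixing
    these with the density [l^(-s)] yields the power [|w|^(-s)] by homogeneity. *)
Lemma rlk_symbol s d phi M chi : 0 < s < 1 -> bdd phi M -> test_function chi ->
  (fun xi => freq xi `^ (- s) * hartley phi xi) \in L2 ->
  \int[mu]_l (wt s l * \int[mu]_z (ek d l z * xcorr phi chi z)) =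
  \int[mu]_xi (mult (- s) (cos_cst s) (sgd d * sin_cst s) (hartley phi) xi * hartley chi xi).
Proof.
move=> s01 bp tc Lh; have Ic := test_function_Int tc.
have Lhc : hartley chi \in L2 := (hartley_contraction Ic (test_function_L2 tc)).1.
have mp := measurable_hartley bp.1; have mc := measurable_hartley Ic.
have mpr := measurable_fun_refl mp.
pose H l xi := (l * hartley phi xi + sgd d * (2 * pi * xi) * hartley phi (- xi)) /
  (l ^+ 2 + (2 * pi * xi) ^+ 2) * hartley chi xi.
pose F (p : R * R) := wt s p.2 * H p.2 p.1.
have mF : measurable_fun setT F.
  apply: measurable_funM; first exact: (measurableT_comp (measurable_wt s) measurable_snd).
  apply: measurable_funM; last exact: (measurableT_comp mc measurable_fst).
  apply: measurable_funM; last exact: measurable_invD2.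
  apply: measurable_funD; apply: measurable_funM.
  - exact: measurable_snd.
  - exact: (measurableT_comp mp measurable_fst).
  - by apply: measurable_funM => //; apply: measurable_funM => //; exact: measurable_fst.
  - exact: (measurableT_comp mpr measurable_fst).
pose a xi := `|hartley phi xi * hartley chi xi|.
pose b xi := `|hartley phi (- xi) * hartley chi xi|.
have Ia : Int (fun xi => freq xi `^ (- s) * a xi).
  have := Int_norm (L2_mul Lh Lhc); congr Int; apply/funext => xi.
  by rewrite /a !normrM mulrA (ger0_norm (powR_ge0 _ _)).
have Ib : Int (fun xi => freq xi `^ (- s) * b xi).
  have := Int_norm (L2_mul (L2_refl Lh) Lhc); congr Int; apply/funext => xi.
  by rewrite /b freqN !normrM mulrA (ger0_norm (powR_ge0 _ _)).
have cs xi (x0 : xi != 0) := int_cos_cst s01 (freq_gt0 x0).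
have ss xi (x0 : xi != 0) := int_sin_cst s01 (freq_gt0 x0).
have [] := Fubini_package mF.
  apply: (@Fubini_majorant _ F (fun xi l => if xi == 0 then 0 else
     wt s l * (l / (l ^+ 2 + freq xi ^+ 2)) * a xi +
     wt s l * (freq xi / (l ^+ 2 + freq xi ^+ 2)) * b xi) mF).
    apply: aeS ae_neq0 => xi x0; rewrite (negbTE x0).
    split; first by apply: IntD; apply: IntZr; [exact: (cs _ x0).1|exact: (ss _ x0).1].
    move=> l; rewrite /F/= normrM (ger0_norm (wt_ge0 _ _)).
    have [l0|l0] := ltP 0 l; last by rewrite /wt ltNge l0 !mul0r addr0.
    rewrite -!mulrA -mulrDr ler_wpM2l ?wt_ge0// /H freq_sqr.
    have D0 := sqrD_gt0 (2 * pi * xi) l0.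
    rewrite -/(freq xi) mulrDl mulrDl; apply: (le_trans (ler_normD _ _)).
    rewrite /a /b !normrM norm_sgd mul1r (gtr0_norm l0) (gtr0_norm (_ : 0 < (l ^+ 2 + (2 * pi * xi) ^+ 2)^-1)) ?invr_gt0//.
    by rewrite le_eqVlt; apply/orP; left; apply/eqP; rewrite /freq !normrM; ring.
  have := IntD (IntZl (cos_cst s) Ia) (IntZl (sin_cst s) Ib); congr Int; apply/funext => xi.
  have [->|x0] := eqVneq xi 0.
    have s0 : - s != 0 by rewrite oppr_eq0 gt_eqF//; case/andP: s01.
    by rewrite {1 2}/freq mulr0 normr0 powR0// !mul0r !mulr0 addr0 /Rintegral integral0.
  have [I1 E1] := cs _ x0; have [I2 E2] := ss _ x0.
  rewrite (intD (IntZr _ I1) (IntZr _ I2)) (intZr _ I1) (intZr _ I2) E1 E2.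
  by rewrite !(mulrCA _ (_ `^ _)) !mulrA.
move=> _ _ I1 _ E.
have -> : \int[mu]_l (wt s l * \int[mu]_z (ek d l z * xcorr phi chi z)) =
          \int[mu]_l \int[mu]_xi F (xi, l).
  apply: eq_int => l; have [l0|l0] := ltP 0 l; last first.
    have wt0 : wt s l = 0 by rewrite /wt ltNge l0.
    rewrite wt0 mul0r /F; under [RHS]eq_int do rewrite /= wt0 mul0r.
    by rewrite /Rintegral integral0.
  have [I ->] := ek_pairing d l0 bp tc.
  by rewrite -(intZl _ I).
rewrite -E; apply: int_ae_eq.
- exact: Int_mfun I1.
- apply: measurable_funM; [exact: measurable_mult|exact: mc].
apply: aeS ae_neq0 => xi x0; have [J1 E1] := cs _ x0; have [J2 E2] := ss _ x0.
transitivity (\int[mu]_l (wt s l * (l / (l ^+ 2 + freq xi ^+ 2)) * (hartley phi xi * hartley chi xi) +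
  wt s l * (freq xi / (l ^+ 2 + freq xi ^+ 2)) * (sgd d * Num.sg xi * hartley phi (- xi) * hartley chi xi))).
  apply: eq_int => l; rewrite /F/= /H -freq_sqr -sg_freq; ring.
rewrite (intD (IntZr _ J1) (IntZr _ J2)) (intZr _ J1) (intZr _ J2) E1 E2 /mult.
ring.
Qed.

End Symbol.

Section FractionalL2.
Context {R : realType}.
Local Notation mu := (@lebesgue_measure R).
Implicit Types (f g h k u q phi chi K : R -> R) (x y z xi l s t p a b : R) (d : bool).

Lemma loc_Int_bounded f (M : R) : measurable_fun setT f -> (forall x, `|f x| <= M) ->
  loc_Int f.
Proof.
move=> mf fM; split=> // a b; apply: (Int_bounded_mul mf fM).
exact: integrable_indic_itv.
Qed.

Lemma multE p a b h xi : mult p a b h xi =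
  a * (freq xi `^ p * h xi) + b * (Num.sg xi * (freq (- xi) `^ p * h (- xi))).
Proof. by rewrite /mult freqN; ring. Qed.

Lemma L2_sg f : f \in L2 -> (fun x => Num.sg x * f x) \in L2.
Proof.
move=> Lf; apply: (L2_le _ Lf).
  by apply: measurable_funM; [exact: measurable_sgr|exact: L2_mfun].
move=> x; rewrite normrM ler_piMl//; have [->|x0] := eqVneq x 0.
  by rewrite sgr0 normr0.
by rewrite normr_sg x0.
Qed.

Lemma mult_L2 p a b h : (fun xi => freq xi `^ p * h xi) \in L2 -> mult p a b h \in L2.
Proof.
move=> Lh; rewrite (funext (multE p a b h)).
by apply: L2D; apply: L2Z => //; apply: L2_sg; exact: (L2_refl Lh).
Qed.

(** Reflecting [xi] changes the sign of the [sgn] part only. *)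
Lemma mult_adjoint p a b h k :
  Int (fun xi => freq xi `^ p * (h xi * k xi)) ->
  Int (fun xi => freq xi `^ p * (h (- xi) * k xi)) ->
  measurable_fun setT h -> measurable_fun setT k ->
  Int (fun xi => mult p a b h xi * k xi) /\
  \int[mu]_xi (h xi * mult p a (- b) k xi) = \int[mu]_xi (mult p a b h xi * k xi).
Proof.
move=> I1 I2 mh mk.
have sg1 x : `|Num.sg x| <= 1 :> R.
  by have [->|x0] := eqVneq x 0; rewrite ?sgr0 ?normr0// normr_sg x0.
have I3 : Int (fun xi => Num.sg xi * (freq xi `^ p * (h (- xi) * k xi))).
  exact: (Int_bounded_mul measurable_sgr sg1 I2).
have E xi : mult p a b h xi * k xi = a * (freq xi `^ p * (h xi * k xi)) +
    b * (Num.sg xi * (freq xi `^ p * (h (- xi) * k xi))).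
  by rewrite /mult; ring.
have J := IntD (IntZl a I1) (IntZl b I3).
split; first by rewrite (funext E).
rewrite (eq_int E) (intD (IntZl a I1) (IntZl b I3)) -(int_refl (IntZl b I3)).
rewrite -(intD (IntZl a I1) (Int_refl (IntZl b I3))).
by apply: eq_int => xi; rewrite /mult opprK sgrN freqN; ring.
Qed.

Definition cos_const s : R := cos_cst s / (Gamma s * Gamma (1 - s)).
Definition sin_const s : R := sin_cst s / (Gamma s * Gamma (1 - s)).

Lemma GammaM_gt0 s : 0 < s < 1 -> 0 < Gamma s * Gamma (1 - s).
Proof.
move=> s01; apply: mulr_gt0; first exact: Gamma_gt0.
by apply: Gamma_gt0; move: s01 => /andP[s0 s1]; apply/andP; split; lra.
Qed.

Lemma cos_const_gt0 s : 0 < s < 1 -> 0 < cos_const s.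
Proof. by move=> s01; rewrite divr_gt0 ?GammaM_gt0// cos_cst_gt0. Qed.

Lemma sin_const_gt0 s : 0 < s < 1 -> 0 < sin_const s.
Proof. by move=> s01; rewrite divr_gt0 ?GammaM_gt0// sin_cst_gt0. Qed.

Definition RLmult s d h : R -> R := mult (- s) (cos_const s) (sgd d * sin_const s) h.

Lemma RL_bounded s d phi M : 0 < s < 1 -> bdd phi M ->
  measurable_fun setT (RL s d phi) /\ exists C, forall x, `|RL s d phi x| <= C.
Proof.
move=> s01 bp; have tK := rlk_tame d s01; split.
  by apply: measurable_funM; [exact: measurable_cst|exact: (measurable_tame tK bp)].
have G0 := Gamma_gt0 s01.
exists ((Gamma s)^-1 * (M * (\int[mu]_z rlk0 s d z) + \int[mu]_y `|phi y|)) => x.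
rewrite /RL normrM gtr0_norm ?invr_gt0//; apply: ler_wpM2l.
  by rewrite invr_ge0 ltW.
exact: (tame_bound x tK bp).
Qed.

(** [RL s d phi] is bounded, and not a priori square integrable: it is identified with the
    inverse transform of the multiplied [hartley phi] by testing. *)
Lemma isH_RL s d phi M : 0 < s < 1 -> bdd phi M ->
  (fun xi => freq xi `^ (- s) * hartley phi xi) \in L2 ->
  isH (RL s d phi) (RLmult s d (hartley phi)).
Proof.
move=> s01 bp Lh; have [mRL [C RLC]] := RL_bounded d s01 bp.
have LT : RLmult s d (hartley phi) \in L2 by exact: mult_L2.
have [_ [w [Tw _ _ _]]] := isH_exists LT; have wT := isH_sym Tw.
have [Lw _ wT'] := wT; have [_ _ Tw'] := Tw.
apply: (isH_ae wT) => //; [exact: L2_mfun LT| |exact: aeW].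
apply: test_function_ext; [exact: loc_Int_L2|exact: loc_Int_bounded RLC|].
move=> chi tc; have Ic := test_function_Int tc; have Lc := test_function_L2 tc.
have tK := rlk_tame d s01.
have [I E] := tame_pairing tK bp Ic.
have G1 := Gamma_gt0 s01; have G2 := GammaM_gt0 s01.
have S := rlk_pairing_sub d s01 bp tc.
rewrite (rlk_symbol d s01 bp tc Lh) in S.
have [_ Lhc' _] := isH_hartley Ic Lc.
rewrite (Tw' _ Ic Lc).
have -> : \int[mu]_x (RL s d phi x * chi x) =
   (Gamma s)^-1 * \int[mu]_z (rlk s d z * xcorr phi chi z).
  by rewrite -E -(intZl _ I); apply: eq_int => x; rewrite /RL mulrA.
have G3 : Gamma (1 - s) != 0 by apply: contraTneq G2 => ->; rewrite mulr0 ltxx.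
have LS : mult (- s) (cos_cst s) (sgd d * sin_cst s) (hartley phi) \in L2 by exact: mult_L2.
have -> : \int[mu]_z (rlk s d z * xcorr phi chi z) = (Gamma (1 - s))^-1 *
   \int[mu]_xi (mult (- s) (cos_cst s) (sgd d * sin_cst s) (hartley phi) xi * hartley chi xi).
  apply: (mulfI G3); rewrite [RHS]mulrA (mulfV G3) mul1r; exact: S.
rewrite mulrA -(intZl _ (L2_mul LS Lhc')); apply: eq_int => xi.
rewrite /RLmult /mult /cos_const /sin_const.
have G4 : Gamma s != 0 by rewrite gt_eqF.
move: G3 G4; move: (Gamma s) (Gamma (1 - s)) (cos_cst s) (sin_cst s) => A B C' D B0 A0.
move: (hartley phi xi) (hartley phi (- xi)) (hartley chi xi) (freq xi `^ (- s)) => *.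
by field; rewrite A0 B0.
Qed.

(** ** Low frequencies *)
Lemma Int_freq_near0 p : - 1 < p -> Int (fun xi => freq xi `^ p * \1_(`]0, 1]) (freq xi)).
Proof.
move=> p1; have I := Int_powR_near0 p1.
have c0 : 2 * pi != 0 :> R by rewrite gt_eqF// twopi_gt0.
have I2 := Int_affine 0 c0 I.
have I3 := IntD I2 (Int_refl I2).
apply: Int_ae_eq I3.
  apply: (measurableT_comp (Int_mfun I)); exact: measurable_freq.
apply: aeS ae_neq0 => xi; rewrite neq_lt !addr0 mulrN /freq => /orP[x0|x0].
  have n0 : 2 * pi * xi < 0 by rewrite pmulr_rlt0 ?twopi_gt0.
  rewrite (ltr0_norm n0) indicE memNset/=; last by rewrite in_itv/= ltNge (ltW n0).
  by rewrite mulr0 add0r.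
have n0 : 0 < 2 * pi * xi by rewrite mulr_gt0 ?twopi_gt0.
have E : \1_(`]0, 1]) (- (2 * pi * xi)) = 0 :> R.
  by rewrite indicE memNset//= in_itv/= oppr_gt0 ltNge (ltW n0).
by rewrite (gtr0_norm n0) E mulr0 addr0.
Qed.

Lemma freq_le_near0 p xi : p <= 0 -> xi != 0 ->
  freq xi `^ p <= freq xi `^ p * \1_(`]0, 1]) (freq xi) + 1.
Proof.
move=> p0 x0; have f0 := freq_gt0 x0.
have [f1|f1] := leP (freq xi) 1.
  by rewrite indicE mem_set ?mulr1 ?lerDl//= in_itv/= f0.
have A : 0 <= freq xi `^ p * \1_(`]0, 1]) (freq xi) by rewrite mulr_ge0 ?powR_ge0// indicE.
apply: (@le_trans _ _ 1); last by rewrite lerDr.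
by rewrite -(powRr0 (freq xi)) ler_powR// ltW.
Qed.

Lemma freq_powR_sqr xi s : (freq xi `^ (- s)) ^+ 2 = freq xi `^ (- (s * 2)).
Proof. by rewrite -powR_mulrn ?powR_ge0// -powRrM mulNr. Qed.

(** [s < 1 / 2] makes [|w|^(-2 s)] summable near [0]. *)
Lemma low_freq_L2 s k M : 0 < s < 1 / 2 -> k \in L2 -> (forall xi, `|k xi| <= M) ->
  (fun xi => freq xi `^ (- s) * k xi) \in L2.
Proof.
move=> /andP[s0 s1] Lk kM; have mk := L2_mfun Lk.
have mf : measurable_fun setT (fun xi => freq xi `^ (- s) * k xi).
  by apply: measurable_funM => //; exact: measurable_freq_powR.
have p1 : - 1 < - (s * 2) by lra.
apply/L2P; split=> //.
apply: (Int_le_ae _ _ (IntD (IntZl (M ^+ 2) (Int_freq_near0 p1)) (L2_sqr Lk))).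
  exact: measurable_funX.
apply: aeS ae_neq0 => xi x0; rewrite ger0_norm ?sqr_ge0// exprMn freq_powR_sqr.
have p2 : - (s * 2) <= 0 by lra.
apply: (le_trans (ler_wpM2r (sqr_ge0 _) (freq_le_near0 p2 x0))).
rewrite mulrDl mul1r lerD2r mulrC ler_wpM2r ?mulr_ge0 ?powR_ge0 ?indicE//.
have M0 : 0 <= M by apply: le_trans (kM 0).
by rewrite -(real_normK (num_real (k xi))) ler_pXn2r ?nnegrE.
Qed.

Lemma loc_Int_low_freq s k : 0 < s < 1 / 2 -> k \in L2 ->
  loc_Int (fun xi => freq xi `^ (- s) * k xi).
Proof.
move=> /andP[s0 s1] Lk.
under eq_fun do rewrite mulrC; apply: loc_Int_mul => //; last exact: measurable_freq_powR.
split; first by apply: measurable_funX; exact: measurable_freq_powR.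
move=> a b; have p1 : - 1 < - (s * 2) by lra.
have I1 : Int (\1_(`[a, b]) : R -> R) by exact: integrable_indic_itv.
apply: (Int_le_ae _ _ (IntD (Int_freq_near0 p1) I1)).
  apply: measurable_funM; last exact: measurable_indic.
  by apply: measurable_funX; exact: measurable_freq_powR.
apply: aeS ae_neq0 => xi x0; rewrite freq_powR_sqr ger0_norm; last first.
  by rewrite mulr_ge0 ?powR_ge0// indicE.
have p2 : - (s * 2) <= 0 by lra.
have := freq_le_near0 p2 x0; have A : 0 <= freq xi `^ (- (s * 2)) * \1_(`]0, 1]) (freq xi).
  by rewrite mulr_ge0 ?powR_ge0// indicE.
rewrite [\1_(`[a, b]) xi]indicE; case: (_ \in _) => /=; first by rewrite mulr1.
by rewrite mulr0 addr0.
Qed.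

Lemma low_freq_hartley s phi M : 0 < s < 1 / 2 -> bdd phi M ->
  (fun xi => freq xi `^ (- s) * hartley phi xi) \in L2.
Proof.
move=> s01 bp; apply: (low_freq_L2 s01 (M := 2 * \int[mu]_x `|phi x|)).
  exact: (hartley_contraction bp.1 (bdd_L2 bp)).1.
by move=> xi; exact: hartley_bound bp.1.
Qed.

End FractionalL2.

(** * Fractional integrals of square-integrable functions *)
Section FractionalIntegralsL2.
Context {R : realType}.
Local Notation mu := (@lebesgue_measure R).
Implicit Types (f g h k q u w phi chi psi : R -> R) (x y z xi l s t p a b : R) (d : bool).

Lemma measurable_int_section (F : R * R -> R) : measurable_fun setT F ->
  measurable_fun setT (fun x => \int[mu]_y F (x, y)).
Proof.
move=> mF.
have mE : measurable_fun setT (EFin \o F) by exact/measurable_EFinP.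
apply: (measurableT_comp (fine_measurable measurableT)).
pose P x := (\int[mu]_y ((EFin \o F)^\+ (x, y)))%E.
pose N x := (\int[mu]_y ((EFin \o F)^\- (x, y)))%E.
have mP : measurable_fun setT P.
  apply: (measurable_fun_fubini_tonelli_F (m2:=mu)) => //; exact: measurable_funepos.
have mN : measurable_fun setT N.
  apply: (measurable_fun_fubini_tonelli_F (m2:=mu)) => //; exact: measurable_funeneg.
have := emeasurable_funB mP mN; congr measurable_fun.
by apply/funext => x; rewrite [RHS]integralE; congr (_ - _)%E; apply: eq_integral => y _; rewrite ?funeposE ?funenegE.
Qed.

Lemma rlk_opp s d z : rlk s (~~ d) (- z) = rlk s d z.
Proof. by rewrite /rlk sgdN mulrNN. Qed.

Lemma rlk_swap s d x y : rlk s d (x - y) = rlk s (~~ d) (y - x).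
Proof. by rewrite -rlk_opp opprB. Qed.

Lemma measurable_rlk_section s d u : measurable_fun setT u ->
  measurable_fun setT (fun z : R * R => rlk s d (z.1 - z.2) * u z.2).
Proof.
move=> mu'; apply: measurable_funM; first exact: (measurable_sub2 (measurable_rlk s d)).
exact: (measurableT_comp mu' measurable_snd).
Qed.

Lemma measurable_RL s d u : measurable_fun setT u -> measurable_fun setT (RL s d u).
Proof.
move=> mu'; apply: measurable_funM; first exact: measurable_cst.
exact: (measurable_int_section (measurable_rlk_section s d mu')).
Qed.

Lemma half_lt1 s : 0 < s < 1 / 2 -> 0 < s < 1.
Proof. by move=> /andP[s0 s1]; apply/andP; split; lra. Qed.

Lemma isH_RL_bdd s d phi M : 0 < s < 1 / 2 -> bdd phi M ->
  isH (RL s d phi) (RLmult s d (hartley phi)).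
Proof.
move=> s01 bp; apply: (isH_RL d (half_lt1 s01) bp); exact: (low_freq_hartley s01 bp).
Qed.

(** Integrate in [x] first: the result is the fractional integral of [|phi|] in the
    opposite direction, which is square integrable, against [|u|]. *)
Lemma RL_L2_Fubini s d u phi M : 0 < s < 1 / 2 -> u \in L2 -> bdd phi M ->
  let F (z : R * R) := rlk s d (z.1 - z.2) * u z.2 * phi z.1 in
  measurable_fun setT F /\ (\int[mu]_x \int[mu]_y `|F (x, y)|%:E < +oo)%E.
Proof.
move=> s01 Lu bp F; have bpn := bdd_norm bp.
have mF : measurable_fun setT F.
  apply: measurable_funM; first exact: (measurable_rlk_section s d (L2_mfun Lu)).
  exact: (measurableT_comp (Int_mfun bp.1) measurable_fst).
split=> //.
have tK := rlk_tame (~~ d) (half_lt1 s01).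
have [LR _ _] := isH_RL_bdd (~~ d) s01 bpn.
apply: (@Fubini_majorant_swap _ F
  (fun y x => rlk s (~~ d) (y - x) * `|phi x| * `|u y|) mF).
- apply: aeW => y; split; first exact: (IntZr _ (Int_tame y tK bpn)).
  move=> x; rewrite /F/= normrM [`|_ * u y|]normrM ger0_norm ?rlk_ge0// rlk_swap.
  by rewrite mulrAC.
- have E y : \int[mu]_x (rlk s (~~ d) (y - x) * `|phi x| * `|u y|) =
     Gamma s * (RL s (~~ d) (fun x => `|phi x|) y * `|u y|).
    rewrite (intZr _ (Int_tame y tK bpn)) /RL mulrA mulrA mulfV ?mul1r//.
    by rewrite gt_eqF// Gamma_gt0// half_lt1.
  by rewrite (funext E); apply: IntZl; apply: L2_mul => //; exact: L2_norm.
Qed.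

(** Pair with a strictly positive function, so that summability of the product is
    summability of the kernel. *)
Lemma RL_L2_Int s d u : 0 < s < 1 / 2 -> u \in L2 ->
  {ae mu, forall x, Int (fun y => rlk s d (x - y) * u y)}.
Proof.
move=> s01 Lu.
have be : bdd (expa 1 : R -> R) 1.
  split; first exact: Int_expa.
  by move=> x; rewrite /expa ger0_norm ?expR_ge0// expR_le1 mulN1r oppr_le0.
have [mF Foo] := RL_L2_Fubini d s01 Lu be.
have [A _ _ _ _] := Fubini_package mF Foo.
apply: aeS A => x Ix; have e0 : expa 1 x != 0 :> R by rewrite gt_eqF// expR_gt0.
have := IntZr (expa 1 x)^-1 Ix; congr Int.
by apply/funext => y /=; rewrite mulfK.
Qed.

Lemma RL_L2_transpose s d u phi M : 0 < s < 1 / 2 -> u \in L2 -> bdd phi M ->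
  Int (fun x => RL s d u x * phi x) /\
  \int[mu]_x (RL s d u x * phi x) = \int[mu]_x (u x * RL s (~~ d) phi x).
Proof.
move=> s01 Lu bp; have [mF Foo] := RL_L2_Fubini d s01 Lu bp.
have [_ _ I1 I2 E] := Fubini_package mF Foo.
have mR := measurable_funM (measurable_RL s d (L2_mfun Lu)) (Int_mfun bp.1).
have A : {ae mu, forall x, (Gamma s)^-1 * (\int[mu]_y (rlk s d (x - y) * u y * phi x)) =
    RL s d u x * phi x}.
  by apply: aeS (RL_L2_Int d s01 Lu) => x Ix; rewrite (intZr _ Ix) mulrA.
have I := IntZl (Gamma s)^-1 I1.
split; first exact: (Int_ae_eq mR A I).
rewrite -(int_ae_eq (Int_mfun I) mR A) (intZl _ I1) E -(intZl _ I2).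
apply: eq_int => y /=; rewrite /RL mulrCA; congr (_ * _).
have tK := rlk_tame (~~ d) (half_lt1 s01).
rewrite -(intZl _ (Int_tame y tK bp)); apply: eq_int => x.
by rewrite rlk_swap; ring.
Qed.

Lemma bdd_indic_itv a b : bdd (\1_(`[a, b]) : R -> R) 1.
Proof.
split; first exact: integrable_indic_itv.
by move=> x; rewrite indicE; case: (_ \in _); rewrite ?normr1 ?normr0.
Qed.

Lemma loc_Int_RL s d u : 0 < s < 1 / 2 -> u \in L2 -> loc_Int (RL s d u).
Proof.
move=> s01 Lu; split; first exact: (measurable_RL s d (L2_mfun Lu)).
by move=> a b; exact: (RL_L2_transpose d s01 Lu (bdd_indic_itv a b)).1.
Qed.

Lemma bdd_test psi : test_function psi -> exists M, bdd psi M.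
Proof.
move=> tp; have [_ _ [M _ HM]] := test_function_bounded tp.
by exists M; split=> //; exact: test_function_Int.
Qed.

(** The symbol is moved from [phi], where it is known, to [k] by transposing twice:
    [RL] becomes its opposite, and so does the sign of the [sgn] part. *)
Lemma RL_L2_pairing s d u k phi M : 0 < s < 1 / 2 -> isH u k -> bdd phi M ->
  Int (fun xi => RLmult s d k xi * hartley phi xi) /\
  \int[mu]_x (RL s d u x * phi x) = \int[mu]_xi (RLmult s d k xi * hartley phi xi).
Proof.
move=> s01 uk bp; have [Lu Lk _] := uk.
have hR := isH_RL_bdd (~~ d) s01 bp.
have L1 := low_freq_hartley s01 bp.
have mh := measurable_hartley bp.1.
have I1 : Int (fun xi => freq xi `^ (- s) * (k xi * hartley phi xi)).
  by under eq_fun do rewrite mulrCA; exact: L2_mul.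
have I2 : Int (fun xi => freq xi `^ (- s) * (k (- xi) * hartley phi xi)).
  by under eq_fun do rewrite mulrCA; apply: L2_mul => //; exact: L2_refl.
have [J E] := mult_adjoint (cos_const s) (sgd d * sin_const s) I1 I2 (L2_mfun Lk) mh.
split; first exact: J.
rewrite (RL_L2_transpose d s01 Lu bp).2 (isH_Parseval uk hR) -E.
by apply: eq_int => xi; rewrite /RLmult sgdN mulNr.
Qed.

Lemma isH_RL_L2 s d u k : 0 < s < 1 / 2 -> isH u k ->
  (fun xi => freq xi `^ (- s) * k xi) \in L2 ->
  isH (RL s d u) (RLmult s d k).
Proof.
move=> s01 uk Lk; have [Lu _ _] := uk.
have LT : RLmult s d k \in L2 by exact: mult_L2.
have [_ [w [Tw _ _ _]]] := isH_exists LT; have wT := isH_sym Tw; have [Lw _ _] := wT.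
apply: (isH_ae wT).
- exact: (measurable_RL s d (L2_mfun Lu)).
- exact: L2_mfun LT.
- apply: test_function_ext; [exact: loc_Int_L2|exact: loc_Int_RL|].
  move=> chi tc; have [M bc] := bdd_test tc.
  rewrite (RL_L2_pairing d s01 uk bc).2.
  by have [_ _ ->] := Tw; [|exact: bc.1|exact: bdd_L2 bc].
- exact: aeW.
Qed.

End FractionalIntegralsL2.

(** * The transform of a test function *)
Section HartleyTest.
Context {R : realType}.
Local Notation mu := (@lebesgue_measure R).
Implicit Types (f g h k q u w phi chi psi F : R -> R) (x y z xi l s t p a b : R) (d : bool).

Lemma int_derive_compact f F a : continuous f -> (forall x, is_derive x 1 F (f x)) ->
  (forall x, a < `|x| -> F x = 0) -> (forall x, a < `|x| -> f x = 0) ->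
  \int[mu]_x f x = 0.
Proof.
move=> cf dF F0 f0.
have cF : continuous F.
  by move=> x; apply: differentiable_continuous; apply/derivable1_diffP; exact: ex_derive.
pose b := `|a| + 1.
have b0 : 0 < b by rewrite ltr_wpDl.
have ab : a < b by rewrite (le_lt_trans (ler_norm _))// ltrDl.
have -> : \int[mu]_x f x = \int[mu]_x (f \_ `[- b, b]) x.
  apply: eq_int => x; rewrite patchE mem_setE in_itv/= -ler_norml.
  by case: ifPn => //; rewrite -ltNge => bx; apply: f0; exact: lt_trans bx.
rewrite -Rintegral_mkcond /Rintegral (@continuous_FTC2 _ f F)//.
- have A : a < `|b| by rewrite (gtr0_norm b0).
  have B : a < `|- b| by rewrite normrN.
  by rewrite (F0 _ A) (F0 _ B) -EFinB subrr.
- by rewrite gtrN.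
- exact: continuous_subspaceT.
- split; first by move=> x _; exact: ex_derive.
  + by apply: cvg_at_right_filter; exact: cF.
  + by apply: cvg_at_left_filter; exact: cF.
- by move=> x _; rewrite derive1E; exact: derive_val.
Qed.

Lemma is_derive_cas_scale (w : R) x :
  is_derive x 1 (fun y => cas (w * y)) (w * cas (- (w * x))).
Proof.
have := is_deriveD (is_derive_cos_scale w x) (is_derive_sin_scale w x) => H.
by apply: (is_derive_eq H); rewrite /cas cosN sinN; ring.
Qed.

Lemma is_derive_test psi x : test_function psi -> is_derive x 1 psi (derive1 psi x).
Proof.
by move=> [sp _]; split; [exact: (sp 0%N)|rewrite derive1E].
Qed.

Lemma hartley_derive psi xi : test_function psi ->
  hartley (derive1 psi) xi = - (2 * pi * xi) * hartley psi (- xi).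
Proof.
move=> tp; have tp' := test_function_derive tp.
have Ip := test_function_Int tp; have Ip' := test_function_Int tp'.
set w := 2 * pi * xi.
have I1 := IntZl w (Int_cas (- xi) Ip); have I2 := Int_cas xi Ip'.
have E x : w * (cas (2 * pi * x * (- xi)) * psi x) + cas (2 * pi * x * xi) * derive1 psi x =
    cas (w * x) * derive1 psi x + psi x * (w * cas (- (w * x))).
  have -> : 2 * pi * x * xi = w * x by rewrite /w; ring.
  have -> : 2 * pi * x * (- xi) = - (w * x) by rewrite /w; ring.
  by ring.
have C v : continuous (fun x : R => cas (v * x)).
  by move=> x; apply: continuous_comp; [exact: continuous_scale|exact: continuous_cas].
have C1 := C w.
have C2 : continuous (fun x => cas (- (w * x))).
  by under eq_fun do rewrite -mulNr; exact: C.
have [a pa _] := test_function_bounded tp; have [a' pa' _] := test_function_bounded tp'.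
pose F x := cas (w * x) * psi x.
pose f x := cas (w * x) * derive1 psi x + psi x * (w * cas (- (w * x))).
have cp := test_function_continuous tp; have cp' := test_function_continuous tp'.
have cf : continuous f.
  move=> x; apply: (@cvgD _ _ _ _ _ (fun x => cas (w * x) * derive1 psi x)
    (fun x => psi x * (w * cas (- (w * x))))).
    by apply: (@cvgM _ _ _ _ (fun x => cas (w * x))); [exact: C1|exact: cp'].
  apply: (@cvgM _ _ _ _ psi); first exact: cp.
  by apply: (@cvgM _ _ _ _ (fun=> w)); [exact: cvg_cst|exact: C2].
have dF x : is_derive x 1 F (f x).
  exact: (is_deriveM (is_derive_cas_scale w x) (is_derive_test x tp)).
have H : \int[mu]_x f x = 0.
  apply: (@int_derive_compact f F (Num.max a a') cf dF) => x; rewrite gt_max => /andP[ax ax'].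
    by rewrite /F pa// mulr0.
  by rewrite /f pa// pa'// mulr0 mul0r addr0.
move: H; rewrite -(eq_int E) (intD I1 I2) (intZl w (Int_cas (- xi) Ip)).
rewrite -/(hartley psi (- xi)) -/(hartley (derive1 psi) xi).
by move=> H; lra.
Qed.

(** Two integrations by parts give decay like [1 / (1 + (2 pi xi) ^ 2)], a multiple of the
    Poisson kernel. *)
Lemma bdd_hartley_test chi : test_function chi -> exists M, bdd (hartley chi) M.
Proof.
move=> tc; have Ic := test_function_Int tc.
have tc1 := test_function_derive tc; have tc2 := test_function_derive tc1.
exists (2 * \int[mu]_x `|chi x|); split; last by move=> xi; exact: hartley_bound.
pose C := 2 * (\int[mu]_x `|chi x|) + 2 * (\int[mu]_x `|derive1 (derive1 chi) x|).
apply: (Int_le (measurable_hartley Ic) _ (IntZl (C / 2) (Int_poisson (@ltr01 R)))).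
move=> xi.
have H2 := hartley_bound xi (test_function_Int tc2).
have H0 := hartley_bound xi Ic.
move: H2; rewrite (hartley_derive xi tc1) (hartley_derive (- xi) tc) opprK.
set w := 2 * pi * xi.
have -> : 2 * pi * - xi = - w by rewrite /w; ring.
have -> : - w * (- - w * hartley chi xi) = - (w ^+ 2 * hartley chi xi) by ring.
rewrite normrN normrM (ger0_norm (sqr_ge0 w)) => H2.
rewrite /poisson -/w expr1n.
have W : 0 < 1 + w ^+ 2 by rewrite ltr_wpDr ?sqr_ge0.
rewrite mulr1 mulrA divfK// ler_pdivlMr// mulrDr mulr1 [_ * w ^+ 2]mulrC /C.
exact: lerD.
Qed.

Lemma hartley_hartley_test chi : test_function chi ->
  {ae mu, forall x, hartley (hartley chi) x = chi x}.
Proof.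
move=> tc; have [M bc] := bdd_hartley_test tc.
have H1 := isH_hartley bc.1 (bdd_L2 bc).
have H2 := isH_sym (isH_hartley (test_function_Int tc) (test_function_L2 tc)).
exact: (isH_uniq H1 H2 (aeW _ (fun=> erefl))).
Qed.

Lemma loc_Int_RLmult s d k : 0 < s < 1 / 2 -> k \in L2 -> loc_Int (RLmult s d k).
Proof.
move=> s01 Lk; have [_ I1] := loc_Int_low_freq s01 Lk.
have [_ I2] := loc_Int_low_freq s01 (L2_refl Lk).
split; first exact: measurable_mult (L2_mfun Lk).
move=> a b.
have sg1 x : `|Num.sg x| <= 1 :> R.
  by have [->|x0] := eqVneq x 0; rewrite ?sgr0 ?normr0// normr_sg x0.
have := IntD (IntZl (cos_const s) (I1 a b))
  (IntZl (sgd d * sin_const s) (Int_bounded_mul measurable_sgr sg1 (I2 a b))).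
by congr Int; apply/funext => xi; rewrite /RLmult /mult; ring.
Qed.

(** Uniqueness of the solution starts from an [u] about whose low frequencies nothing is
    known, so [|w|^(-s) k] may fail to be square integrable; it is locally summable, and
    this suffices for testing against transforms of test functions. *)
Lemma RL_L2_symbol s d u k g q : 0 < s < 1 / 2 -> isH u k -> isH g q ->
  {ae mu, forall x, g x = RL s d u x} -> {ae mu, forall xi, q xi = RLmult s d k xi}.
Proof.
move=> s01 uk gq gu; have [Lu Lk _] := uk; have [Lg Lq gq'] := gq.
apply: test_function_ext; [exact: loc_Int_L2|exact: loc_Int_RLmult|].
move=> chi tc; have Ic := test_function_Int tc; have Lc := test_function_L2 tc.
have [M bc] := bdd_hartley_test tc; have mh := Int_mfun bc.1.
rewrite (gq' _ Ic Lc).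
have [_ mRL] := RL_L2_pairing d s01 uk bc.
transitivity (\int[mu]_x (RL s d u x * hartley chi x)).
  apply: int_ae_eq.
  - by apply: measurable_funM; [exact: L2_mfun Lg|exact: mh].
  - by apply: measurable_funM; [exact: (measurable_RL s d (L2_mfun Lu))|exact: mh].
  - by apply: aeS gu => x ->.
rewrite mRL; apply: int_ae_eq.
- apply: measurable_funM; first exact: measurable_mult (L2_mfun Lk).
  exact: (measurable_hartley bc.1).
- by apply: measurable_funM; [exact: measurable_mult (L2_mfun Lk)|exact: Int_mfun].
- by apply: aeS (hartley_hartley_test tc) => x ->.
Qed.

End HartleyTest.

(** * Weak fractional derivatives *)
Section WeakDerivatives.
Context {R : realType}.
Local Notation mu := (@lebesgue_measure R).
Implicit Types (f g h k q u w phi chi psi F : R -> R) (x y z xi l s t p a b : R) (d : bool).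

Lemma RL_convolution s d psi M x : 0 < s < 1 -> bdd psi M ->
  Int (fun z => rlk s d z * psi (x - z)) /\
  RL s d psi x = (Gamma s)^-1 * \int[mu]_z (rlk s d z * psi (x - z)).
Proof.
move=> s01 bp; have I := Int_sub x (Int_tame x (rlk_tame d s01) bp).
have E : (fun z => rlk s d (x - (x - z)) * psi (x - z)) = (fun z => rlk s d z * psi (x - z)).
  by apply/funext => z; rewrite subKr.
rewrite E in I; split; first exact: I.
by rewrite /RL -(int_sub x I); congr (_ * _); apply: eq_int => y; rewrite subKr.
Qed.

(** The derivative falls on the test function, which is bounded with compact
    support, so that the singular kernel is only seen on a bounded range. *)
Lemma derive1_RL s d psi x : 0 < s < 1 -> test_function psi ->
  derive1 (RL s d psi) x = RL s d (derive1 psi) x.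
Proof.
move=> s01 tp; have tp' := test_function_derive tp.
have [M bp] := bdd_test tp; have [M' bp'] := bdd_test tp'.
have [A pA _] := test_function_bounded tp'.
have [mK I0 k00 Kk] := rlk_tame d s01.
pose f x z := rlk s d z * psi (x - z).
have Df y z : is_derive y 1 (fun y => f y z) (rlk s d z * derive1 psi (y - z)).
  apply: is_derive_cst_scale.
  have B := is_derive_test (1 * y + - z) tp.
  have := @is_derive1_comp R psi (fun y => 1 * y + - z) y _ _ B (is_derive_affine 1 (- z) y).
  by rewrite mulr1 mul1r; under eq_fun do rewrite mul1r.
have P1 y z : partial1of2 f y z = rlk s d z * derive1 psi (y - z).
  by rewrite partial1of2E; have H := Df y z; exact: derive_val.
(* For [y] near [x], the point [y - z] lies in the support of [derive1 psi] only if [z]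
   lies in a fixed interval. *)
pose G z := M' * (rlk0 s d z + \1_(`[x - 1 - A, x + 1 + A]) z).
have M0 := bdd_ge0 bp'.
have I1 : Int (\1_(`[x - 1 - A, x + 1 + A]) : R -> R) by exact: integrable_indic_itv.
have IG : Int G by apply: IntZl; exact: IntD.
have G0 z : 0 <= G z by rewrite mulr_ge0// addr_ge0// indicE.
have Ix : (`]x - 1, x + 1[%classic : set R) x by rewrite /= in_itv/= ltrBlDr ltrDl ltr01.
have H1 y : `]x - 1, x + 1[%classic y -> mu.-integrable setT (EFin \o f y).
  by move=> _; exact: (RL_convolution d y s01 bp).1.
have H2 y (z : R) : `]x - 1, x + 1[%classic y -> setT z -> derivable (f ^~ z) y 1.
  by move=> _ _; have H := Df y z; exact: ex_derive.
have H3 y (z : R) : `]x - 1, x + 1[%classic y -> setT z -> `|partial1of2 f y z| <= G z.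
  rewrite P1 /= in_itv/= => /andP[y1 y2] _; rewrite normrM /G mulrC.
  have [Az|Az] := ltP A `|y - z|.
    by rewrite pA// normr0 mul0r; exact: G0.
  have zi : z \in `[x - 1 - A, x + 1 + A].
    move: Az; rewrite ler_norml in_itv/= => /andP[a1 a2]; apply/andP; split; lra.
  rewrite indicE mem_setE zi; apply: ler_pM => //; exact: bp'.2.
have D1 := @derivable_under_integral R _ _ mu f setT measurableT x (x - 1) (x + 1)
  Ix H1 H2 G G0 IG H3.
have D2 := @differentiation_under_integral R _ _ mu f setT measurableT x (x - 1) (x + 1)
  Ix H1 H2 G G0 IG H3.
have -> : RL s d psi = fun y => (Gamma s)^-1 * \int[mu]_z f y z.
  by apply/funext => y; exact: (RL_convolution d y s01 bp).2.
have D : is_derive x 1 (fun y => \int[mu]_z f y z) (RL s d (derive1 psi) x * Gamma s).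
  split; first exact: D1.
  rewrite -derive1E D2 (RL_convolution d x s01 bp').2 mulrAC mulVf ?mul1r; last first.
    by rewrite gt_eqF// Gamma_gt0.
  by apply: eq_int => z; exact: P1.
have H := is_derive_cst_scale (Gamma s)^-1 D.
rewrite derive1E derive_val mulrCA mulVf ?mulr1//.
by rewrite gt_eqF// Gamma_gt0.
Qed.

(** For [0 < s < 1] the fractional derivative of a test function, in either direction. *)
Definition RLtest s d psi x : R := sgd d * RL (1 - s) d (derive1 psi) x.

Lemma RLorder1 s : 0 < s < 1 -> RLorder s = 1%N.
Proof.
by move=> /andP[s0 s1]; rewrite /RLorder (@truncn_def _ s 0)// ltW.
Qed.

Lemma onem_itv s : 0 < s < 1 -> 0 < 1 - s < 1.
Proof. by move=> /andP[s0 s1]; apply/andP; split; lra. Qed.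

Lemma RLder_lE s psi : 0 < s < 1 -> test_function psi -> RLder_l s psi = RLtest s true psi.
Proof.
move=> s01 tp; apply/funext => x; rewrite /RLder_l (RLorder1 s01) /RLtest mul1r.
rewrite -(derive1_RL _ _ (onem_itv s01) tp) /derive1n/=.
by congr (derive1 _ x); apply/funext => y; rewrite RLint_lE.
Qed.

Lemma RLder_rE s psi : 0 < s < 1 -> test_function psi -> RLder_r s psi = RLtest s false psi.
Proof.
move=> s01 tp; apply/funext => x; rewrite /RLder_r (RLorder1 s01) /RLtest expr1.
rewrite -(derive1_RL _ _ (onem_itv s01) tp) /derive1n/=.
have -> : RLint_r (1 - s) psi = RL (1 - s) false psi by apply/funext => y; rewrite RLint_rE.
by [].
Qed.

(** [D^s = D^(s-1) d/dx]: the derivative contributes a factor [i w], which raises the power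
    by [1] and exchanges the roles of the cosine and sine constants. *)
Definition WDmult s d h : R -> R := mult s (sin_const (1 - s)) (- (sgd d * cos_const (1 - s))) h.

Lemma hartley_derive_freq psi xi : test_function psi ->
  hartley (derive1 psi) xi = - (Num.sg xi * (freq xi * hartley psi (- xi))).
Proof. by move=> tp; rewrite (hartley_derive xi tp) -sg_freq; ring. Qed.

Lemma powR_le1D a p : 0 <= a -> 0 <= p <= 1 -> a `^ p <= 1 + a.
Proof.
move=> a0 /andP[p0 p1]; have [a1|a1] := leP a 1.
  have : a `^ p <= 1.
    have := @ge0_ler_powR R p p0 a 1; rewrite powR1 !nnegrE; apply => //.
  by move=> H; apply: (le_trans H); rewrite lerDl.
apply: (@le_trans _ _ a); last by rewrite lerDr.
by rewrite -[leRHS](powRr1 a0) ler_powR// ltW.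
Qed.

Lemma test_freq_L2 s psi : 0 <= s <= 1 -> test_function psi ->
  (fun xi => freq xi `^ s * hartley psi xi) \in L2.
Proof.
move=> s01 tp; have tp' := test_function_derive tp.
have L0 := (hartley_contraction (test_function_Int tp) (test_function_L2 tp)).1.
have L1 := (hartley_contraction (test_function_Int tp') (test_function_L2 tp')).1.
apply: (L2_le_ae _ (L2D (L2_norm L0) (L2_norm (L2_refl L1)))).
  by apply: measurable_funM; [exact: measurable_freq_powR|exact: L2_mfun L0].
apply: aeS ae_neq0 => xi x0.
rewrite (hartley_derive_freq (- xi) tp) opprK normrN freqN sgrN mulNr normrN.
rewrite normrM (ger0_norm (powR_ge0 _ _)) normrM normr_sg x0 mul1r normrM.
rewrite (ger0_norm (normr_ge0 _)) (ger0_norm (addr_ge0 _ _))//.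
rewrite -[X in X + _]mul1r -mulrDl; apply: ler_wpM2r => //.
exact: (powR_le1D (normr_ge0 _) s01).
Qed.

Lemma isH_RLtest s d psi : 0 < s < 1 -> test_function psi ->
  isH (RLtest s d psi) (WDmult s d (hartley psi)).
Proof.
move=> s01 tp; have tp' := test_function_derive tp; have [M' bp'] := bdd_test tp'.
have /andP[s0 s1] := s01.
have sle : 0 <= s <= 1 by rewrite !ltW.
have Ls := test_freq_L2 sle tp.
have E xi : xi != 0 -> freq xi `^ (- (1 - s)) * freq xi = freq xi `^ s.
  move=> x0; have f0 := freq_gt0 x0.
  rewrite -[X in _ * X](powRr1 (ltW f0)) -powRD ?(gt_eqF f0) ?implybT//.
  by congr (_ `^ _); ring.
have mh := measurable_hartley (test_function_Int tp').
have L' : (fun xi => freq xi `^ (- (1 - s)) * hartley (derive1 psi) xi) \in L2.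
  apply: (L2_le_ae _ (L2_refl Ls)).
    by apply: measurable_funM; [exact: measurable_freq_powR|exact: mh].
  apply: aeS ae_neq0 => xi x0.
  rewrite (hartley_derive_freq xi tp) mulrN normrN mulrCA normrM normr_sg x0 mul1r.
  by rewrite mulrA (E _ x0) freqN.
have H := isH_RL d (onem_itv s01) bp' L'.
have [LR LM _] := H.
have H2 := isH_lin (sgd d) 0 H H.
apply: (isH_ae H2).
- exact: L2_mfun (L2Z _ LR).
- exact: L2_mfun (mult_L2 _ _ Ls).
- by apply: aeW => x; rewrite mul0r addr0.
- apply: aeS ae_neq0 => xi x0.
  rewrite mul0r addr0 /RLmult /WDmult /mult.
  rewrite (hartley_derive_freq xi tp) (hartley_derive_freq (- xi) tp) opprK freqN sgrN.
  rewrite -(E _ x0).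
  have S1 : Num.sg xi * Num.sg xi = 1 by rewrite -expr2 sqr_sg x0.
  set A := freq xi `^ _; set hm := hartley psi (- xi); set hp := hartley psi xi.
  have -> : sgd d * (A * (cos_const (1 - s) * - (Num.sg xi * (freq xi * hm)) +
      sgd d * sin_const (1 - s) * Num.sg xi * - (- Num.sg xi * (freq xi * hp)))) =
    A * freq xi * ((sgd d * sgd d) * (Num.sg xi * Num.sg xi) * sin_const (1 - s) * hp -
      sgd d * cos_const (1 - s) * Num.sg xi * hm) by ring.
  by rewrite S1 sgd_sqr; ring.
Qed.

(** The direction of the test operator is opposite to that of the derivative. *)
Definition is_weak s d u w : Prop := [/\ loc_Int u, loc_Int w &
  forall psi, test_function psi -> Int (fun x => u x * RLtest s (~~ d) psi x) /\
    \int[mu]_x (u x * RLtest s (~~ d) psi x) = \int[mu]_x (w x * psi x)].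

Lemma is_weak_lE s u w : 0 < s < 1 -> is_weak_l s u w <-> is_weak s true u w.
Proof.
move=> s01; split=> [[/loc_IntP lu /loc_IntP lw H]|[/loc_IntP lu /loc_IntP lw H]];
  split=> // psi tp; have := H psi tp; by rewrite /inner (RLder_rE s01 tp).
Qed.

Lemma is_weak_rE s u w : 0 < s < 1 -> is_weak_r s u w <-> is_weak s false u w.
Proof.
move=> s01; split=> [[/loc_IntP lu /loc_IntP lw H]|[/loc_IntP lu /loc_IntP lw H]];
  split=> // psi tp; have := H psi tp; by rewrite /inner (RLder_lE s01 tp).
Qed.

Lemma is_weak_uniq s d u w w' : is_weak s d u w -> is_weak s d u w' ->
  {ae mu, forall x, w x = w' x}.
Proof.
move=> [_ lw H] [_ lw' H']; apply: test_function_ext => // psi tp.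
by rewrite -(H psi tp).2 -(H' psi tp).2.
Qed.

(** Parseval on both sides of the defining identity, and transposition of the symbol. *)
Lemma isH_weak s d u k w : 0 < s < 1 -> isH u k ->
  (fun xi => freq xi `^ s * k xi) \in L2 -> isH w (WDmult s d k) -> is_weak s d u w.
Proof.
move=> s01 uk Lsk wk; have [Lu Lk _] := uk; have [Lw LT _] := wk.
split; [exact: loc_Int_L2|exact: loc_Int_L2|] => psi tp.
have Ip := test_function_Int tp; have Lp := test_function_L2 tp.
have pH := isH_hartley Ip Lp; have [_ Lhp _] := pH.
have tH := isH_RLtest (~~ d) s01 tp; have [Lt _ _] := tH.
split; first exact: L2_mul.
have I1 : Int (fun xi => freq xi `^ s * (k xi * hartley psi xi)).
  by under eq_fun do rewrite mulrA; exact: L2_mul.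
have I2 : Int (fun xi => freq xi `^ s * (k (- xi) * hartley psi xi)).
  under eq_fun do rewrite -freqN mulrA; apply: L2_mul => //.
  exact: (L2_refl Lsk).
have [_ E] := mult_adjoint (sin_const (1 - s)) (- (sgd d * cos_const (1 - s))) I1 I2
  (L2_mfun Lk) (L2_mfun Lhp).
rewrite (isH_Parseval uk tH) (isH_Parseval wk pH) -E.
by apply: eq_int => xi; rewrite /WDmult sgdN mulNr.
Qed.

End WeakDerivatives.

(** * Inversion of the symbol *)
Section Inversion.
Context {R : realType}.
Local Notation mu := (@lebesgue_measure R).
Implicit Types (f g h k q u v w phi chi psi F : R -> R) (x y z xi l s t p a b : R) (d : bool).

Lemma powR_sqr x p : 0 <= x -> (x `^ p) ^+ 2 = x `^ (2 * p).
Proof. by move=> x0; rewrite -powR_mulrn ?powR_ge0// -powRrM mulrC. Qed.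

Lemma Hhat_isH p w h : isH w h -> Hhat p w <-> (fun xi => freq xi `^ p * h xi) \in L2.
Proof.
move=> wh; have [_ Lh _] := wh; have mh := L2_mfun Lh.
have mph k : measurable_fun setT k -> measurable_fun setT (fun xi => freq xi `^ p * k xi).
  by move=> mk; apply: measurable_funM; [exact: measurable_freq_powR|exact: mk].
have E k xi : (freq xi `^ p * k xi) ^+ 2 = freq xi `^ (2 * p) * k xi ^+ 2.
  by rewrite exprMn (powR_sqr _ (normr_ge0 _)).
split=> [/HhatP[k wk I]|Lp].
  have [_ Lk _] := wk.
  have Lpk : (fun xi => freq xi `^ p * k xi) \in L2.
    apply/L2P; split; first exact: mph (L2_mfun Lk).
    rewrite (funext (E k)); apply: (Int_le _ _ I).
      rewrite -(funext (E k)); apply: measurable_funX; exact: mph (L2_mfun Lk).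
    move=> xi; rewrite normrM (ger0_norm (sqr_ge0 _)) (ger0_norm (powR_ge0 _ _)).
    by rewrite ler_wpM2r ?sqr_ge0// lerDr.
  apply: (L2_ae_eq (mph _ mh) _ Lpk).
  by apply: aeS (isH_uniq wk wh (aeW _ (fun=> erefl))) => xi ->.
apply/HhatP; exists h => //.
have := IntD (L2_sqr Lh) (L2_sqr Lp); congr Int; apply/funext => xi.
by rewrite E [RHS]mulrDl mul1r.
Qed.

(** Equations between transforms hold almost everywhere, but inverting the symbol requires
    them at [xi] and [- xi] simultaneously. *)
Lemma ae_refl0 f : measurable_fun setT f -> {ae mu, forall x, f x = 0} ->
  {ae mu, forall x, f (- x) = 0}.
Proof.
move=> mf f0.
have I : Int (fun x => `|f x|).
  apply: (Int_ae_eq _ _ Int0); first exact: measurableT_comp.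
  by apply: aeS f0 => x ->; rewrite normr0.
have Z : \int[mu]_x `|f (- x)| = 0.
  rewrite (int_refl I); transitivity (\int[mu]_x (0 : R)).
    apply: int_ae_eq; [exact: Int_mfun I|exact: Int_mfun Int0|].
    by apply: aeS f0 => x ->; rewrite normr0.
  by rewrite /Rintegral integral0.
apply: aeS (Int_0_ae (Int_refl I) (fun=> normr_ge0 _) Z) => x /eqP.
by rewrite normr_eq0 => /eqP.
Qed.

Lemma powR_le_pm x s p : 0 < x -> - s <= p <= s -> x `^ p <= x `^ s + x `^ (- s).
Proof.
move=> x0 /andP[p1 p2]; have [x1|x1] := leP 1 x.
  by apply: (le_trans (ler_powR x1 p2)); rewrite lerDl powR_ge0.
have x01 : 0 < x <= 1 by rewrite x0 ltW.
by apply: (le_trans (ger_powR x01 p1)); rewrite lerDr powR_ge0.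
Qed.

(** The sum of an integral and of a derivative of order [s] acts on the frequency side
    as [P k + sgn Q k(-.)], with [P] and [Q] even and [P] positive. For each pair of
    opposite frequencies this is a linear system of determinant [P ^ 2 + Q ^ 2]. *)
Section TwoSided.
Variables (s a1 b1 a2 b2 : R).
Hypothesis (a1_gt0 : 0 < a1) (a2_gt0 : 0 < a2) (s_ge0 : 0 <= s).

Definition sum_symb k xi := mult (- s) a1 b1 k xi + mult s a2 b2 k xi.

Definition even_symb xi := a1 * freq xi `^ (- s) + a2 * freq xi `^ s.
Definition odd_symb xi := b1 * freq xi `^ (- s) + b2 * freq xi `^ s.

Definition inv_symb h xi :=
  (even_symb xi * h xi - Num.sg xi * odd_symb xi * h (- xi)) /
  (even_symb xi ^+ 2 + odd_symb xi ^+ 2).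

Lemma sum_symbE k xi :
  sum_symb k xi = even_symb xi * k xi + Num.sg xi * odd_symb xi * k (- xi).
Proof. by rewrite /sum_symb /mult /even_symb /odd_symb; ring. Qed.

Lemma even_symbN xi : even_symb (- xi) = even_symb xi.
Proof. by rewrite /even_symb freqN. Qed.

Lemma odd_symbN xi : odd_symb (- xi) = odd_symb xi.
Proof. by rewrite /odd_symb freqN. Qed.

Lemma even_symb_gt0 xi : xi != 0 -> 0 < even_symb xi.
Proof.
move=> x0; have f0 := freq_gt0 x0.
by apply: addr_gt0; apply: mulr_gt0 => //; exact: powR_gt0.
Qed.

Lemma symb_norm_gt0 xi : xi != 0 -> 0 < even_symb xi ^+ 2 + odd_symb xi ^+ 2.
Proof. by move=> x0; rewrite ltr_wpDr ?sqr_ge0// exprn_gt0// even_symb_gt0. Qed.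

Lemma sum_inv_symb h xi : xi != 0 -> sum_symb (inv_symb h) xi = h xi.
Proof.
move=> x0; rewrite sum_symbE /inv_symb even_symbN odd_symbN opprK sgrN.
have D := symb_norm_gt0 x0; have S1 : Num.sg xi ^+ 2 = 1 by rewrite sqr_sg x0.
move: D S1; move: (even_symb xi) (odd_symb xi) (Num.sg xi) (h xi) (h (- xi)) => P Q e a b D S1.
have D0 : P ^+ 2 + Q ^+ 2 != 0 by rewrite gt_eqF.
rewrite !mulrA -mulrDl; apply: (canLR (mulfK D0)).
have -> : P * (P * a - e * Q * b) + e * Q * (P * b - - e * Q * a) =
  P ^+ 2 * a + e ^+ 2 * Q ^+ 2 * a by ring.
by rewrite S1; ring.
Qed.

Lemma inv_sum_symb k xi : xi != 0 -> inv_symb (sum_symb k) xi = k xi.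
Proof.
move=> x0; rewrite /inv_symb !sum_symbE even_symbN odd_symbN opprK sgrN.
have D := symb_norm_gt0 x0; have S1 : Num.sg xi ^+ 2 = 1 by rewrite sqr_sg x0.
move: D S1; move: (even_symb xi) (odd_symb xi) (Num.sg xi) (k xi) (k (- xi)) => P Q e a b D S1.
have D0 : P ^+ 2 + Q ^+ 2 != 0 by rewrite gt_eqF.
apply: (canLR (mulfK D0)).
have -> : P * (P * a + e * Q * b) - e * Q * (P * b + - e * Q * a) =
  P ^+ 2 * a + e ^+ 2 * Q ^+ 2 * a by ring.
by rewrite S1; ring.
Qed.

Definition inv_bound : R := a1^-1 + a2^-1.

Lemma inv_bound_ge0 : 0 <= inv_bound.
Proof. by rewrite addr_ge0// invr_ge0 ltW. Qed.

Lemma even_symb_ge p xi : xi != 0 -> - s <= p <= s ->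
  freq xi `^ p <= inv_bound * even_symb xi.
Proof.
move=> x0 ps; apply: (le_trans (powR_le_pm (freq_gt0 x0) ps)).
rewrite /inv_bound /even_symb.
move: (powR_ge0 (freq xi) s) (powR_ge0 (freq xi) (- s)).
move: (freq xi `^ s) (freq xi `^ (- s)) => B A B0 A0.
have V1 : 0 <= a1^-1 by rewrite invr_ge0 ltW.
have V2 : 0 <= a2^-1 by rewrite invr_ge0 ltW.
have -> : (a1^-1 + a2^-1) * (a1 * A + a2 * B) =
   B + A + (a1^-1 * (a2 * B) + a2^-1 * (a1 * A)) by field; rewrite !gt_eqF.
by rewrite lerDl addr_ge0// mulr_ge0// mulr_ge0// ltW.
Qed.

(** As [|Q| P <= P ^ 2 + Q ^ 2], the inverse gains the full size of [P], both at low
    and at high frequencies. *)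
Lemma inv_symb_le h p xi : xi != 0 -> - s <= p <= s ->
  freq xi `^ p * `|inv_symb h xi| <= inv_bound * (`|h xi| + `|h (- xi)|).
Proof.
move=> x0 ps; have P0 := even_symb_gt0 x0; have D := symb_norm_gt0 x0.
have C0 := inv_bound_ge0.
apply: (@le_trans _ _ (inv_bound * (even_symb xi * `|inv_symb h xi|))).
  by rewrite mulrA; apply: ler_wpM2r => //; exact: even_symb_ge.
apply: ler_wpM2l => //; rewrite /inv_symb normrM normfV (gtr0_norm D) mulrA.
rewrite ler_pdivrMr//.
have N : `|even_symb xi * h xi - Num.sg xi * odd_symb xi * h (- xi)| <=
   even_symb xi * `|h xi| + `|odd_symb xi| * `|h (- xi)|.
  apply: (le_trans (ler_normB _ _)); rewrite !normrM normr_sg x0 mul1r.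
  by rewrite (gtr0_norm P0).
apply: (le_trans (ler_wpM2l (ltW P0) N)).
move: P0 D (normr_ge0 (h xi)) (normr_ge0 (h (- xi))) (normr_ge0 (odd_symb xi)).
rewrite -(real_normK (num_real (odd_symb xi))).
move: (even_symb xi) (`|odd_symb xi|) (`|h xi|) (`|h (- xi)|) => P Q a b P0 D a0 b0 Q0.
have H1 : 0 <= Q ^+ 2 * a by rewrite mulr_ge0// sqr_ge0.
have H2 : 0 <= (P ^+ 2 + Q ^+ 2 - P * Q) * b.
  by rewrite mulr_ge0//; have := sqr_ge0 (P - Q); have := mulr_ge0 (ltW P0) Q0; nra.
by rewrite -subr_ge0; apply: le_trans (addr_ge0 H1 H2) _; rewrite le_eqVlt; apply/orP; left;
  apply/eqP; ring.
Qed.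

Lemma measurable_even_symb : measurable_fun setT even_symb.
Proof.
by apply: measurable_funD;
  (apply: measurable_funM; [exact: measurable_cst|exact: measurable_freq_powR]).
Qed.

Lemma measurable_odd_symb : measurable_fun setT odd_symb.
Proof.
by apply: measurable_funD;
  (apply: measurable_funM; [exact: measurable_cst|exact: measurable_freq_powR]).
Qed.

Lemma measurable_sum_symb k : measurable_fun setT k -> measurable_fun setT (sum_symb k).
Proof. by move=> mk; apply: measurable_funD; exact: measurable_mult. Qed.

Lemma measurable_inv_symb h : measurable_fun setT h -> measurable_fun setT (inv_symb h).
Proof.
move=> mh; have mP := measurable_even_symb; have mQ := measurable_odd_symb.
apply: measurable_funM.
  apply: measurable_funB; first by apply: measurable_funM; [exact: mP|exact: mh].
  apply: measurable_funM; last exact: measurable_fun_refl.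
  by apply: measurable_funM; [exact: measurable_sgr|exact: mQ].
have E xi : (even_symb xi ^+ 2 + odd_symb xi ^+ 2)^-1 =
    (even_symb xi ^+ 2 + odd_symb xi ^+ 2) `^ (-1).
  by rewrite powR_inv1// addr_ge0 ?sqr_ge0.
rewrite (funext E); apply: (measurableT_comp (measurable_powR _)).
by apply: measurable_funD; apply: measurable_funX; [exact: mP|exact: mQ].
Qed.

(** The case [t = 0], [p = 0, s, - s] gives the three memberships needed for the
    decomposition; [p = s] gives the gain of [s] derivatives. *)
Lemma inv_symb_L2 h p t : - s <= p <= s ->
  h \in L2 -> (fun xi => freq xi `^ t * h xi) \in L2 ->
  (fun xi => freq xi `^ (p + t) * inv_symb h xi) \in L2.
Proof.
move=> ps Lh Lth; apply: (L2_le_ae _ (L2Z inv_bound (L2D (L2_norm Lth) (L2_norm (L2_refl Lth))))).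
  by apply: measurable_funM; [exact: measurable_freq_powR|exact: measurable_inv_symb (L2_mfun Lh)].
apply: aeS ae_neq0 => xi x0; have f0 := freq_gt0 x0.
have B := inv_symb_le h x0 ps.
rewrite freqN [leLHS]normrM [`|freq xi `^ t * h xi|]normrM [`|freq xi `^ t * h (- xi)|]normrM.
rewrite !(ger0_norm (powR_ge0 _ _)) -mulrDr.
have N : 0 <= freq xi `^ t * (`|h xi| + `|h (- xi)|) by rewrite mulr_ge0 ?powR_ge0 ?addr_ge0.
rewrite (ger0_norm (mulr_ge0 inv_bound_ge0 N)) [leRHS]mulrCA powRD ?(gt_eqF f0) ?implybT//.
by rewrite [X in X * _ <= _]mulrC -mulrA ler_wpM2l ?powR_ge0.
Qed.

(** High frequencies lose [s] derivatives; at low ones the weight [|w|^t] is at most [1],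
    and the sum itself is the bound. *)
Lemma sum_symb_L2 k t : 0 < t -> (fun xi => freq xi `^ (s + t) * k xi) \in L2 ->
  measurable_fun setT k -> sum_symb k \in L2 ->
  (fun xi => freq xi `^ t * sum_symb k xi) \in L2.
Proof.
move=> t0 Lk mk Lf.
pose C := a1 + `|b1| + a2 + `|b2|.
apply: (L2_le_ae _ (L2D (L2_norm Lf) (L2Z C (L2D (L2_norm Lk) (L2_norm (L2_refl Lk)))))).
  by apply: measurable_funM; [exact: measurable_freq_powR|exact: measurable_sum_symb].
apply: aeS ae_neq0 => xi x0; have f0 := freq_gt0 x0.
have C0 : 0 <= C by rewrite !addr_ge0// ltW.
rewrite freqN [leLHS]normrM [`|freq xi `^ _ * k xi|]normrM [`|freq xi `^ _ * k (- xi)|]normrM.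
rewrite !(ger0_norm (powR_ge0 _ _)) -mulrDr.
have N : 0 <= C * (freq xi `^ (s + t) * (`|k xi| + `|k (- xi)|)).
  by rewrite mulr_ge0// mulr_ge0 ?powR_ge0// addr_ge0.
rewrite [leRHS]ger0_norm ?addr_ge0//.
have [f1|f1] := leP (freq xi) 1.
  apply: (@le_trans _ _ `|sum_symb k xi|); last by rewrite lerDl.
  rewrite ler_piMl// -(powRr0 (freq xi)); apply: ger_powR; last exact: ltW.
  by rewrite f0.
rewrite -[leLHS]add0r lerD//.
have B : `|sum_symb k xi| <= C * freq xi `^ s * (`|k xi| + `|k (- xi)|).
  have ss : - s <= s by have := s_ge0; lra.
  have ms := ler_powR (ltW f1) ss.
  have m0 := powR_ge0 (freq xi) (- s).
  have B1 : `|even_symb xi| <= C * freq xi `^ s.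
    rewrite /even_symb; move: (freq xi `^ s) (freq xi `^ (- s)) ms m0 => Y X XY X0.
    rewrite ger0_norm; last by rewrite addr_ge0// mulr_ge0 ?(ltW a1_gt0) ?(ltW a2_gt0)// (le_trans X0).
    have := ler_wpM2l (ltW a1_gt0) XY.
    have := mulr_ge0 (normr_ge0 b1) (le_trans X0 XY); have := mulr_ge0 (normr_ge0 b2) (le_trans X0 XY).
    by rewrite /C; lra.
  have B2 : `|odd_symb xi| <= C * freq xi `^ s.
    rewrite /odd_symb; move: (freq xi `^ s) (freq xi `^ (- s)) ms m0 => Y X XY X0.
    have Y0 := le_trans X0 XY.
    apply: (le_trans (ler_normD _ _)); rewrite !normrM (ger0_norm X0) (ger0_norm Y0).
    have := ler_wpM2l (normr_ge0 b1) XY.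
    have := mulr_ge0 (ltW a1_gt0) Y0; have := mulr_ge0 (ltW a2_gt0) Y0.
    by rewrite /C; lra.
  rewrite sum_symbE; apply: (le_trans (ler_normD _ _)).
  rewrite [X in X + _]normrM [X in _ + X]normrM [`|Num.sg xi * _|]normrM normr_sg x0 mul1r mulrDr.
  by apply: lerD; apply: ler_wpM2r.
apply: (le_trans (ler_wpM2l (powR_ge0 _ _) B)).
rewrite addrC powRD ?(gt_eqF f0) ?implybT//.
by rewrite le_eqVlt; apply/orP; left; apply/eqP; ring.
Qed.

End TwoSided.

End Inversion.

(** * The decomposition *)
Section Decomposition.
Context {R : realType}.
Local Notation mu := (@lebesgue_measure R).
Implicit Types (f g h k q u v w : R -> R) (x xi s t r : R) (d : bool).

Definition is_RL s d u g : Prop :=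
  {ae mu, forall x, Int (fun y => rlk s d (x - y) * u y) /\ g x = RL s d u x}.

Lemma is_RLint_lE s u g : is_RLint_l s u g <-> is_RL s true u g.
Proof.
by split; apply: aeS => x [/integrable_kernel_l I ->]; rewrite RLint_lE; split.
Qed.

Lemma is_RLint_rE s u g : is_RLint_r s u g <-> is_RL s false u g.
Proof.
by split; apply: aeS => x [/integrable_kernel_r I ->]; rewrite RLint_rE; split.
Qed.

Definition two_sided s d1 d2 f u : Prop := exists g h,
  [/\ is_RL s d1 u g, is_weak s d2 u h & ae_eq_fun f (fun x => g x + h x)].

(** Unique solvability, with transfer of regularity, of [f = A u] in the space of order
    [r]; [sol u] reads [f = A u]. *)
Definition uniquely_solvable r f (sol : (R -> R) -> Prop) : Prop := exists u,
  [/\ Hhat r u, sol u, (forall v, Hhat r v -> sol v -> ae_eq_fun v u) &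
      forall t, 0 < t -> (Hhat t f <-> Hhat (r + t) u)].

Lemma eq_uniquely_solvable r f (sol sol' : (R -> R) -> Prop) :
  (forall v, sol v <-> sol' v) ->
  uniquely_solvable r f sol -> uniquely_solvable r f sol'.
Proof.
move=> E [u [H1 H2 H3 H4]]; exists u; split=> //; first exact/E.
by move=> v Hv /E; exact: H3.
Qed.

Section Symbol.
Variables (s : R) (d1 d2 : bool).
Hypothesis s01 : 0 < s < 1 / 2.

Let a1 := cos_const s.
Let b1 := sgd d1 * sin_const s.
Let a2 := sin_const (1 - s).
Let b2 := - (sgd d2 * cos_const (1 - s)).
Let s01' : 0 < s < 1. Proof. exact: half_lt1. Qed.
Let a1_gt0 : 0 < a1. Proof. exact: cos_const_gt0. Qed.
Let a2_gt0 : 0 < a2. Proof. exact/sin_const_gt0/onem_itv. Qed.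
Let s_ge0 : 0 <= s. Proof. by case/andP: s01 => /ltW. Qed.

Let inv_symb_L2' h p t : - s <= p <= s ->
  h \in L2 -> (fun xi => freq xi `^ t * h xi) \in L2 ->
  (fun xi => freq xi `^ (p + t) * inv_symb s a1 b1 a2 b2 h xi) \in L2.
Proof. exact: inv_symb_L2. Qed.

Lemma two_sided_exists f hf u : isH f hf -> isH u (inv_symb s a1 b1 a2 b2 hf) ->
  two_sided s d1 d2 f u.
Proof.
move=> fH uk; have [Lu Lk _] := uk; have [Lf Lh _] := fH.
set k := inv_symb s a1 b1 a2 b2 hf in uk Lk *.
have Lh0 : (fun xi => freq xi `^ 0 * hf xi) \in L2.
  by rewrite (_ : (fun xi => _) = hf)//; apply/funext => xi; rewrite powRr0 mul1r.
have Lm : (fun xi => freq xi `^ (- s) * k xi) \in L2.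
  have := @inv_symb_L2' hf (- s) 0; rewrite addr0; apply=> //.
  by rewrite lexx/=; have := s_ge0; lra.
have Lp : (fun xi => freq xi `^ s * k xi) \in L2.
  have := @inv_symb_L2' hf s 0; rewrite addr0; apply=> //.
  by rewrite lexx andbT; have := s_ge0; lra.
have gH := isH_RL_L2 d1 s01 uk Lm.
have LW : WDmult s d2 k \in L2 by exact: mult_L2.
have [_ [w [Hw _ _ _]]] := isH_exists LW; have wH := isH_sym Hw.
exists (RL s d1 u), w; split.
- by apply: aeS (RL_L2_Int d1 s01 Lu).
- exact: isH_weak wH.
- apply: aeS (isH_inj fH (isH_lin 1 1 gH wH) _) => [x ->|]; first by rewrite !mul1r.
  apply: aeS ae_neq0 => xi x0; rewrite !mul1r.
  exact: (esym (@sum_inv_symb R s a1 b1 a2 b2 a1_gt0 a2_gt0 hf xi x0)).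
Qed.

(** Subtracting the weak derivative, whose transform is known because [v] has [s]
    derivatives, isolates the fractional integral. *)
Lemma two_sided_symb f hf v k : isH f hf -> isH v k -> Hhat s v ->
  two_sided s d1 d2 f v ->
  {ae mu, forall xi, k xi = inv_symb s a1 b1 a2 b2 hf xi}.
Proof.
move=> fH vk Hv [g [h [RLg Wh fgh]]]; have [Lv Lk _] := vk; have [Lf Lh _] := fH.
have Lp := (Hhat_isH s vk).1 Hv.
have LW : WDmult s d2 k \in L2 by exact: mult_L2.
have [_ [w [Hw _ _ _]]] := isH_exists LW; have wH := isH_sym Hw.
have hw := is_weak_uniq Wh (isH_weak s01' vk Lp wH).
have E1 : {ae mu, forall x, 1 * f x + (- 1) * w x = RL s d1 v x}.
  apply: aeS3 fgh hw RLg => x -> -> [_ ->]; ring.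
have E2 := RL_L2_symbol s01 vk (isH_lin 1 (- 1) fH wH) E1.
have mk := L2_mfun Lk; have mf := L2_mfun Lh.
pose D xi := hf xi - sum_symb s a1 b1 a2 b2 k xi.
have mD : measurable_fun setT D by apply: measurable_funB => //; exact: measurable_sum_symb.
have D0 : {ae mu, forall xi, D xi = 0}.
  apply: aeS E2 => xi E; rewrite /D /sum_symb -/(RLmult s d1 k xi) -/(WDmult s d2 k xi).
  by rewrite -E; ring.
have E3 : forall xi, D xi = 0 -> hf xi = sum_symb s a1 b1 a2 b2 k xi.
  by move=> xi /eqP; rewrite subr_eq0 => /eqP.
apply: aeS3 D0 (ae_refl0 mD D0) ae_neq0 => xi /E3 H1 /E3 H2 x0.
rewrite -{1}(@inv_sum_symb R s a1 b1 a2 b2 a1_gt0 a2_gt0 k xi x0).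
by rewrite /inv_symb H1 H2.
Qed.

Lemma two_sided_solvable f : f \in L2 -> uniquely_solvable s f (two_sided s d1 d2 f).
Proof.
move=> Lf; have [_ [hf [fH _ _ _]]] := isH_exists Lf; have [_ Lh _] := fH.
set k := inv_symb s a1 b1 a2 b2 hf.
have Lh0 : (fun xi => freq xi `^ 0 * hf xi) \in L2.
  by rewrite (_ : (fun xi => _) = hf)//; apply/funext => xi; rewrite powRr0 mul1r.
have ps : - s <= s <= s by rewrite lexx andbT; have := s_ge0; lra.
have p0 : - s <= 0 <= s by rewrite s_ge0 andbT; have := s_ge0; lra.
have Lk : k \in L2.
  have := inv_symb_L2' p0 Lh Lh0; rewrite addr0.
  by rewrite (_ : (fun xi => _) = k)//; apply/funext => xi; rewrite powRr0 mul1r.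
have [_ [u [Hu _ _ _]]] := isH_exists Lk; have uk := isH_sym Hu.
have mk := L2_mfun Lk.
exists u; split.
- apply/(Hhat_isH s uk); have := inv_symb_L2' ps Lh Lh0; by rewrite addr0.
- exact: two_sided_exists uk.
- move=> v Hv Tv; have [q vq _] := (HhatP s v).1 Hv.
  exact: (isH_inj vq uk (two_sided_symb fH vq Hv Tv)).
- move=> t t0; apply: (iff_trans (Hhat_isH t fH)); apply: iff_sym.
  apply: (iff_trans (Hhat_isH (s + t) uk)); split=> [Lst|Lt]; last exact: inv_symb_L2'.
  have E : {ae mu, forall xi, sum_symb s a1 b1 a2 b2 k xi = hf xi}.
    by apply: aeS ae_neq0 => xi x0; exact: sum_inv_symb.
  have LS : sum_symb s a1 b1 a2 b2 k \in L2.
    apply: (L2_ae_eq _ _ Lh); first exact: measurable_sum_symb.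
    by apply: aeS E => xi ->.
  have := sum_symb_L2 a1_gt0 a2_gt0 s_ge0 t0 Lst mk LS.
  apply: L2_ae_eq; last by apply: aeS E => xi ->.
  by apply: measurable_funM; [exact: measurable_freq_powR|exact: L2_mfun Lh].
Qed.

End Symbol.

(** For [s = 0] the equation is [f = 2 u]. *)
Lemma double_solvable f : f \in L2 ->
  uniquely_solvable 0 f (fun v => ae_eq_fun f (fun x => v x + v x)).
Proof.
move=> Lf; have [_ [hf [fH _ _ _]]] := isH_exists Lf; have [_ Lh _] := fH.
pose half (q : R -> R) x := 2^-1 * q x.
have uk : isH (half f) (half hf).
  have := isH_lin 2^-1 0 fH fH; congr isH; apply/funext => x; rewrite mul0r addr0//.
exists (half f); split.
- apply/(Hhat_isH 0 uk); rewrite (_ : (fun xi => _) = half hf); first exact: L2Z.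
  by apply/funext => xi; rewrite powRr0 mul1r.
- by apply: aeW => x; rewrite /half; lra.
- by move=> v _ fv; apply: aeS fv => x; rewrite /half => ->; lra.
- move=> t t0; apply: (iff_trans (Hhat_isH t fH)); rewrite add0r.
  apply: iff_sym; apply: (iff_trans (Hhat_isH t uk)); split=> L.
    rewrite (_ : (fun xi => _) = fun xi => 2 * (freq xi `^ t * half hf xi)); first exact: L2Z.
    by apply/funext => xi; rewrite /half; field.
  rewrite (_ : (fun xi => _) = fun xi => 2^-1 * (freq xi `^ t * hf xi)); first exact: L2Z.
  by apply/funext => xi; rewrite /half; ring.
Qed.

End Decomposition.

Section RealOrder.
Context {R : realType}.
Implicit Types (f g h u v w : R -> R) (s : R) (e : bool).

Definition is_D e : R -> (R -> R) -> (R -> R) -> Prop := if e then is_D_l else is_D_r.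

Lemma is_D_neg e s u w : 0 < s -> is_D e (- s) u w <-> is_RL s e u w.
Proof.
rewrite -oppr_lt0 => s0; case: e; rewrite /is_D /is_D_l /is_D_r s0 opprK.
  exact: is_RLint_lE.
exact: is_RLint_rE.
Qed.

Lemma is_D_pos e s u w : 0 < s < 1 -> is_D e s u w <-> is_weak s e u w.
Proof.
move=> s01; have /andP[s0 _] := s01.
case: e; rewrite /is_D /is_D_l /is_D_r ltNge (ltW s0)/= (gt_eqF s0).
  exact: is_weak_lE.
exact: is_weak_rE.
Qed.

Lemma is_D_0 e u w : is_D e 0 u w <-> ae_eq_fun w u.
Proof. by case: e; rewrite /is_D /is_D_l /is_D_r ltxx eqxx. Qed.

Definition decomp e s f u : Prop := exists g h,
  [/\ is_D true (- s) u g, is_D e s u h & ae_eq_fun f (fun x => g x + h x)].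

(** For [s < 0] the first operator is the derivative and the second one the integral, of
    order [- s] in both cases. *)
Lemma decomp_solvable e s : - (1 / 2) < s < 1 / 2 -> forall f, f \in L2 ->
  uniquely_solvable `|s| f (decomp e s f).
Proof.
move=> /andP[s1 s2] f Lf; have [s0|s0|s0] := ltgtP s 0.
- rewrite (ltr0_norm s0); have h : 0 < - s < 1 / 2 by apply/andP; split; lra.
  have /andP[r0 _] := h; have r01 := half_lt1 h.
  apply: eq_uniquely_solvable (two_sided_solvable e true h Lf) => v.
  split=> -[a [b [A B C]]]; exists b, a; split.
  + exact/(is_D_pos true _ _ r01).
  + by have := (is_D_neg e v a r0).2 A; rewrite opprK.
  + by apply: aeS C => x ->; rewrite addrC.
  + by apply/(is_D_neg e v b r0); rewrite opprK.
  + exact/(is_D_pos true _ _ r01).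
  + by apply: aeS C => x ->; rewrite addrC.
- rewrite (gtr0_norm s0); have h : 0 < s < 1 / 2 by rewrite s0.
  have r01 := half_lt1 h.
  apply: eq_uniquely_solvable (two_sided_solvable true e h Lf) => v.
  split=> -[a [b [A B C]]]; exists a, b; split=> //.
  + exact/(is_D_neg true _ _ s0).
  + exact/(is_D_pos e _ _ r01).
  + exact/(is_D_neg true _ _ s0).
  + exact/(is_D_pos e _ _ r01).
- rewrite s0 normr0; apply: eq_uniquely_solvable (double_solvable Lf) => v.
  split=> [C|[a [b [A B C]]]].
    exists v, v; split; last exact: C.
      by rewrite oppr0; apply/is_D_0; exact: aeW.
    by apply/is_D_0; exact: aeW.
  move: A B; rewrite oppr0 => /is_D_0 A /is_D_0 B.
  by apply: aeS3 A B C => x -> -> ->.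
Qed.

End RealOrder.

Theorem theorem5p1 (R : realType) :
  (forall s : R, - (1 / 2) < s < 1 / 2 ->
    forall f : R -> R, f \in L2 ->
    exists u : R -> R,
      [/\ Hhat `|s| u,
          decomp_lr s f u,
          (forall v : R -> R, Hhat `|s| v -> decomp_lr s f v -> ae_eq_fun v u)
        & (forall t : R, 0 < t -> (Hhat t f <-> Hhat (`|s| + t) u))]) /\
  (forall s : R, - (1 / 2) < s < 1 / 2 ->
    forall f : R -> R, f \in L2 ->
    exists u : R -> R,
      [/\ Hhat `|s| u,
          decomp_ll s f u,
          (forall v : R -> R, Hhat `|s| v -> decomp_ll s f v -> ae_eq_fun v u)
        & (forall t : R, 0 < t -> (Hhat t f <-> Hhat (`|s| + t) u))]).
Proof.
split.
- exact: decomp_solvable false.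
- exact: decomp_solvable true.
Qed.
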